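(* Let $s>4$ and let $\zeta\in H^s(\mathbb T^2)$ be nowhere one-dimensional. If $v\in H^s(\mathbb T^2)$ satisfies $\langle v,A\zeta\rangle=0$ for all $A\in\mathfrak g_{\mathrm{PSA}}$, then $v=0$.
   Context: $\mathbb T^2=\mathbb R^2/(2\pi\mathbb Z)^2$, $\mathbb Z^2_*=\mathbb Z^2\setminus\{0\}$, $e_k(x)=e^{\iota k\cdot x}$, $k^\perp=(k_2,-k_1)$. $H^s(\mathbb T^2)$ is the Sobolev space of real-valued mean-zero functions with $\|\varphi\|_{H^s}^2=\sum_{k\in\mathbb Z^2_*}|k|^{2s}|\hat\varphi(k)|^2<\infty$. $\langle f,g\rangle=\int_{\mathbb T^2}fg\,dx$ (extended complex-linearly in $g$ for complex-valued $g$). For $k\in\mathbb Z^2_*$ let $\mathsf H^k=\frac{\iota}{|k|^2}\,e_k\,(k^\perp\cdot\nabla)$ (equivalently $\mathsf H^k=(K*e_k)\cdot\nabla$ with $K*f=\nabla^\perp(-\Delta)^{-1}f$, $\nabla^\perp=(\partial_2,-\partial_1)$). With $[A,B]=AB-BA$ and complex linear span, $$\mathfrak g_{\mathrm{PSA}}=\mathrm{Span}\big(\mathsf H^k,\ [\Delta,\mathsf H^k],\ [[\Delta,\mathsf H^k],\mathsf H^\ell],\ [[[\Delta,\mathsf H^k],\mathsf H^{-k}],\mathsf H^\ell]:k,\ell\in\mathbb Z^2_*\big).$$ A function $\zeta:\mathbb T^2\to\mathbb R$ is one-dimensional on a (nonempty) open set $W\subseteq\mathbb T^2$ if $\zeta(x)=f(\ell\cdot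 x)$ for all $x\in W$, for some $f:\mathbb R\to\mathbb R$ and some $\ell\in\mathbb R^2\setminus\{0\}$ (with $\ell\cdot x$ evaluated in a lift of $W$ to $\mathbb R^2$, e.g. for $W$ a small ball). It is nowhere one-dimensional if it is one-dimensional on no nonempty open set. *)

(* Defs.v *)
From HB Require Import structures.
From mathcomp Require Import all_boot all_order all_algebra.
From mathcomp Require Import all_classical all_reals all_analysis.
From mathcomp Require Import complex.
Set Implicit Arguments.
Unset Strict Implicit.
Unset Printing Implicit Defensive.
Import Order.TTheory GRing.Theory Num.Theory.
Import numFieldNormedType.Exports.
Local Open Scope classical_set_scope.
Local Open Scope ring_scope.
Local Open Scope complex_scope.

(* A function on the torus R^2 / (2 pi Z)^2 is encoded as a function on R * R
   that is 2 pi-periodic in each variable; integrals over the torus are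
   integrals over the fundamental domain [0, 2 pi]^2. *)
Section Torus.
Variable R : realType.

Definition mu2 :
    {measure set (measurableTypeR R * measurableTypeR R) -> \bar R} :=
  (@lebesgue_measure R \x @lebesgue_measure R)%E.

Definition fund : set (R * R) := `[0, 2 * pi] `*` `[0, 2 * pi].

Definition periodic2 (T : Type) (f : R * R -> T) : Prop :=
  forall x : R * R,
    f (x.1 + 2 * pi, x.2) = f x /\ f (x.1, x.2 + 2 * pi) = f x.

Definition re_part (f : R * R -> R[i]) (x : R * R) : R := complex.Re (f x).
Definition im_part (f : R * R -> R[i]) (x : R * R) : R := complex.Im (f x).

Definition tint (f : R * R -> R[i]) : R[i] :=
  (\int[mu2]_(x in fund) re_part f x)%R +i*
  (\int[mu2]_(x in fund) im_part f x)%R.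

Definition L2 (f : R * R -> R) : Prop :=
  [/\ periodic2 f,
      measurable_fun [set: measurableTypeR R * measurableTypeR R] f &
      mu2.-integrable fund (fun x => ((f x) ^+ 2)%:E)].

Definition L2C (f : R * R -> R[i]) : Prop := L2 (re_part f) /\ L2 (im_part f).

(* Complex-linear in the second argument. *)
Definition inner (f : R * R -> R) (g : R * R -> R[i]) : R[i] :=
  tint (fun x => (f x)%:C * g x).

Definition dotk (k : int * int) (x : R * R) : R :=
  k.1%:~R * x.1 + k.2%:~R * x.2.

Definition normk2 (k : int * int) : R := k.1%:~R ^+ 2 + k.2%:~R ^+ 2.

Definition perpk (k : int * int) : int * int := (k.2, - k.1).

Definition ek (k : int * int) (x : R * R) : R[i] :=
  cos (dotk k x) +i* sin (dotk k x).

Definition fourier (f : R * R -> R) (k : int * int) : R[i] :=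
  ((2 * pi) ^- 2)%:C * inner f (ek (- k)).

(* Elements are represented by (measurable) functions, not by classes modulo
   null sets.  The space so defined is the Sobolev space for s >= 0; the
   weight |k|^(2s) is written (|k|^2)^s. *)
Definition Hs (s : R) (f : R * R -> R) : Prop :=
  [/\ L2 f,
      (\int[mu2]_(x in fund) f x)%R = 0 &
      (\esum_(k in [set k : int * int | (k != 0)%R])
         ((normk2 k `^ s) * (complex.Re `|fourier f k|) ^+ 2)%:E < +oo)%E].

(* Partial derivatives of complex-valued functions; true stands for the first
   coordinate and false for the second one. *)
Definition dir (j : bool) : R * R := if j then (1, 0) else (0, 1).

Definition pd (j : bool) (f : R * R -> R[i]) (x : R * R) : R[i] :=
  'D_(dir j) (re_part f) x +i* 'D_(dir j) (im_part f) x.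

Definition test_function (phi : R * R -> R[i]) : Prop :=
  periodic2 phi /\
  forall (js : seq bool) (x : R * R),
    differentiable (re_part (foldr pd phi js)) x /\
    differentiable (im_part (foldr pd phi js)) x.

(* The operators below act on distributions on the torus, so that they can be
   composed without loss of regularity.  A distribution is a functional of
   which only the values at test functions are relevant. *)
Definition distribution2 : Type := (R * R -> R[i]) -> R[i].

Definition dist_eq (S T : distribution2) : Prop :=
  forall phi, test_function phi -> S phi = T phi.

Definition dist_of (f : R * R -> R[i]) : distribution2 :=
  fun phi => tint (fun x => f x * phi x).

Definition operator : Type := distribution2 -> distribution2.

Definition dpd (j : bool) : operator := fun T phi => - T (pd j phi).

Definition dmul (a : R * R -> R[i]) : operator :=
  fun T phi => T (fun x => a x * phi x).

Definition lap : operator :=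
  fun T phi => dpd true (dpd true T) phi + dpd false (dpd false T) phi.

Definition kgrad (k : int * int) : operator :=
  fun T phi => k.1%:~R * dpd true T phi + k.2%:~R * dpd false T phi.

Definition HH (k : int * int) : operator :=
  fun T phi => ((0 +i* 1) / (normk2 k)%:C) * dmul (ek k) (kgrad (perpk k) T) phi.

Definition comm (A B : operator) : operator :=
  fun T phi => A (B T) phi - B (A T) phi.

Inductive psa_generator : operator -> Prop :=
| psa_gen1 k : k != 0 -> psa_generator (HH k)
| psa_gen2 k : k != 0 -> psa_generator (comm lap (HH k))
| psa_gen3 k l : k != 0 -> l != 0 ->
    psa_generator (comm (comm lap (HH k)) (HH l))
| psa_gen4 k l : k != 0 -> l != 0 ->
    psa_generator (comm (comm (comm lap (HH k)) (HH (- k))) (HH l)).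

Definition complex_span (G : operator -> Prop) (A : operator) : Prop :=
  exists (n : nat) (c : 'I_n -> R[i]) (B : 'I_n -> operator),
    (forall i, G (B i)) /\
    (forall T phi, A T phi = \sum_(i < n) c i * B i T phi).

Definition g_PSA : operator -> Prop := complex_span psa_generator.

(* A zeta, computed in the sense of distributions, is the L^2 function g.
   Every element of g_PSA is a differential operator of order at most 2 (the
   higher order terms of the commutators cancel), hence such a g exists, and is
   unique up to null sets, as soon as zeta is in H^2. *)
Definition acts_to (A : operator) (zeta : R * R -> R) (g : R * R -> R[i]) :
    Prop :=
  L2C g /\ dist_eq (A (dist_of (fun x => (zeta x)%:C))) (dist_of g).

Definition one_dim_on (W : set (R * R)) (zeta : R * R -> R) : Prop :=
  exists (f : R -> R) (l : R * R), l != 0 /\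
    forall x, W x -> zeta x = f (l.1 * x.1 + l.2 * x.2).

(* Open sets of the plane suffice: each nonempty open subset of the torus
   contains one that lifts, and being one-dimensional passes to subsets. *)
Definition nowhere_one_dim (zeta : R * R -> R) : Prop :=
  forall W : set (R * R), open W -> W !=set0 -> ~ one_dim_on W zeta.

End Torus.

(* Main.v *)
From HB Require Import structures.
Require Import Defs.
From mathcomp Require Import all_boot all_order all_algebra.
From mathcomp Require Import all_classical all_reals all_analysis.
From mathcomp Require Import measurable_realfun complex.
From mathcomp Require Import ring lra zify.
Import Order.TTheory GRing.Theory Num.Theory.
Import numFieldNormedType.Exports.
Set Implicit Arguments.
Unset Strict Implicit.
Unset Printing Implicit Defensive.
Local Open Scope classical_set_scope.
Local Open Scope ring_scope.

(* Write {f,g} = d_2 f d_1 g - d_1 f d_2 g, P_k = k^perp.grad and c_l = i/|l|^2.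
   The commutators collapse: [[Delta,H^k],H^-k] = (2/|k|^2) P_k^2, so that the
   fourth kind of generators sends zeta to
     (2 c_l/|k|^2) e_l (2 i kappa P_k P_l zeta - kappa^2 P_l zeta),
   kappa = k^perp.l, while H^l zeta = c_l e_l P_l zeta.  Orthogonality of v to
   these functions hence gives <v, e_l P_l zeta> = 0 and, taking for k^perp the
   vectors l and e_j + 2 l, <v, e_l P_l d_j zeta> = 0.  Since s > 4, v and zeta
   are sums of Fourier series that can be differentiated twice; an integration
   by parts shows that all Fourier coefficients of {v,zeta} and {v,d_j zeta}
   vanish.  Where grad v does not vanish, grad zeta and its derivatives are
   therefore parallel to grad v, the direction of grad zeta is locally constant
   and zeta is locally one-dimensional.  Hence grad v = 0 and v = 0. *)

(** * Measure and integration on the torus *)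

(** The fourth kind of generators carries the factor $\kappa=k^\perp\cdot l$, so it is silent in
    directions orthogonal to $l$, and $e_j$ may be one of them; the two auxiliary vectors are never
    orthogonal to $l$, and $e_j$ is a combination of them. The bound $s>4$ comes from splitting
    $|k|^3|\hat f(k)|$, by the inequality between means, into $|k|^{2s}|\hat f(k)|^2$ and
    $|k|^{6-2s}$: the latter is summable over the lattice exactly for $s>4$. Three powers of $|k|$
    are spent because the second termwise differentiation rests on a quadratic Taylor remainder. The
    commutators pass through third-order terms, while [zeta] has only two classical derivatives at
    hand. They are therefore computed on smooth test functions, by transposition, and only the
    surviving second-order expression is moved back to [zeta]. Uniqueness of Fourier coefficients of
    integrable functions serves three times: for the series of [v] and [zeta], for the symmetry of
    mixed partial derivatives, and for the vanishing of the brackets. *)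

Section Plane.
Variable R : realType.
Local Notation plane := (measurableTypeR R * measurableTypeR R)%type.

(** The product sigma-algebra is generated by rectangles, so open sets are reached through a
    countable base: boxes with rational centres and radii $1/(n+1)$. *)
Lemma open_measurable2 (A : set (R * R)) : open A -> measurable (A : set plane).
Proof.
move=> oA.
pose box (i : rat * rat * nat) : set plane :=
  ball (ratr i.1.1 : R) i.2.+1%:R^-1 `*` ball (ratr i.1.2 : R) i.2.+1%:R^-1.
have mbox i : measurable (box i).
  by apply: measurableX; apply: open_measurable; exact: ball_open.
(* Boxes are enumerated by [unpickle]; numbers that code nothing and boxes not contained in [A]
   contribute the empty set. *)
pose F j : set plane := if unpickle j is Some i then
  if `[< box i `<=` A >] then box i else set0 else set0.
have -> : (A : set plane) = \bigcup_j F j.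
  apply/seteqP; split => [x Ax|x [j _]]; last first.
    by rewrite /F; case: unpickle => // i; case: ifPn => // /asboolP h; exact: h.
  have /nbhs_ballP[e /= e0 xeA] := open_nbhs_nbhs (conj oA Ax).
  have [n ne] : exists n : nat, n.+1%:R^-1 < e / 2.
    have e20 : 0 < e / 2 by rewrite divr_gt0.
    have [n _ h] := near_infty_natSinv_lt (PosNum e20).
    by exists n; exact: (h n (leqnn n)).
  have rp (y : R) : exists p : rat, ball (ratr p : R) n.+1%:R^-1 y.
    have n0 : 0 < n.+1%:R^-1 :> R by rewrite invr_gt0.
    have /rat_in_itvoo[p] : y - n.+1%:R^-1 < y + n.+1%:R^-1 by apply: (@lt_trans _ _ y); rewrite ?ltrDl// ltrBlDr ltrDl.
    rewrite in_itv/= => /andP[p1 p2]; exists p; rewrite /ball/= ltr_distlC.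
    apply/andP; split; [rewrite ltrBlDr // in p2 *|by rewrite -ltrBlDr].
  have [p xp] := rp x.1; have [q xq] := rp x.2.
  have sub : box (p, q, n) `<=` A.
    have tri (u w z : R) : ball z n.+1%:R^-1 u -> ball z n.+1%:R^-1 w -> ball u e w.
      rewrite /ball/= => zu zw; rewrite (le_lt_trans (ler_distD z _ _))//.
      rewrite (splitr e) distrC ltrD//; exact: (lt_trans _ ne).
    move=> y [yp yq]; apply: xeA; split; first exact: tri xp yp.
    exact: tri xq yq.
  have [j jE] : exists j, unpickle j = Some (p, q, n).
    by exists (pickle (p, q, n)); exact: pickleK.
  exists j; first exact: I.
  by rewrite /F jE (asboolT sub).
apply: bigcupT_measurable => j; rewrite /F; case: unpickle => [i|]; last exact: measurable0.
by case: ifPn => _; [exact: mbox|exact: measurable0].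
Qed.

Lemma continuous_measurable2 (f : R * R -> R) : continuous f ->
  measurable_fun [set: plane] (f : plane -> measurableTypeR R).
Proof.
move=> cf; apply: (measurability _ (RGenOInfty.measurableE R)) => //.
move=> _ [_ [x ->] <-]; rewrite setTI; apply: open_measurable2.
by apply: open_comp => // y _; exact: cf.
Qed.

Lemma pi2_gt0 : 0 < 2 * pi :> R. Proof. by rewrite mulr_gt0 // pi_gt0. Qed.

Lemma measurable_fund : measurable (@fund R : set plane).
Proof. by apply: measurableX; exact: measurable_itv. Qed.

Lemma mu2X (A B : set R) : measurable (A : set (measurableTypeR R)) ->
  measurable (B : set (measurableTypeR R)) ->
  mu2 R (A `*` B) = (lebesgue_measure A * lebesgue_measure B)%E.
Proof. exact: product_measure1E. Qed.

Lemma mu2_fund : mu2 R (@fund R) = ((2 * pi) ^+ 2)%:E.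
Proof.
rewrite /fund mu2X ?lebesgue_measure_itv//= ?lte_fin ?pi2_gt0//.
by rewrite -!EFinD subr0 -EFinM expr2.
Qed.

Lemma compact_fund : compact (@fund R).
Proof. by apply: compact_setX; exact: segment_compact. Qed.

Lemma continuous_integrable2 (f : R * R -> R) : continuous f ->
  (mu2 R).-integrable (@fund R) (EFin \o f).
Proof.
move=> cf; apply: measurable_bounded_integrable.
- exact: measurable_fund.
- by rewrite mu2_fund ltry.
- exact: measurable_funTS (continuous_measurable2 cf).
- have [M [Mr h]] :=
    compact_bounded (continuous_compact (continuous_subspaceT cf) compact_fund).
  by exists M; split=> // N MN x fx; apply: (h N MN); exists x.
Qed.
End Plane.

(** * Integration over full periods *)

Section TorusIntegral.
Variable R : realType.
Local Notation plane := (measurableTypeR R * measurableTypeR R)%type.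
Implicit Types f g : R * R -> R.

(** Both difference quotients are the same function of [h]. One-variable calculus along lines
    (fundamental theorem, mean value theorem, chain rule) enters the plane through this
    equivalence. *)
Lemma is_derive_line f (x v : R * R) (s d : R) :
  is_derive (x + s *: v) v f d <-> is_derive s 1 (fun t : R => f (x + t *: v)) d.
Proof.
have E : (fun h : R => h^-1 *: ((f \o shift (x + s *: v)) (h *: v) - f (x + s *: v)))
  = (fun h => h^-1 *: (((fun t : R => f (x + t *: v)) \o shift s) (h *: 1)
       - f (x + s *: v))).
  apply/funext => h /=; congr (_ *: (f _ - _)).
  have -> : h *: (1 : R) = h by rewrite /GRing.scale/= mulr1.
  by rewrite scalerDl addrCA.
have De : 'D_v f (x + s *: v) = 'D_1 (fun t : R => f (x + t *: v)) s.
  exact: (f_equal (fun g : R -> R => lim (g h @[h --> 0^'])) E).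
have Dd : derivable f (x + s *: v) v = derivable (fun t : R => f (x + t *: v)) s 1.
  exact: (f_equal (fun g : R -> R => cvg (g h @[h --> 0^'])) E).
by split => -[H1 H2]; split; [rewrite -Dd|rewrite -De|rewrite Dd|rewrite De].
Qed.

Lemma continuous_line f (x v : R * R) : continuous f ->
  continuous (fun t : R => f (x + t *: v)).
Proof.
move=> cf t; apply: (@continuous_comp _ _ _ (fun t : R => x + t *: v) f).
  by apply: cvgD; [exact: cvg_cst|exact: scalel_continuous].
exact: cf.
Qed.

Lemma pair_line1 (u y : R) : (u, y) = (0, y) + u *: (1, 0) :> R * R.
Proof. by apply/eqP; rewrite xpair_eqE/= /GRing.scale/= mulr1 mulr0 add0r addr0 !eqxx. Qed.

Lemma pair_line2 (u y : R) : (y, u) = (y, 0) + u *: (0, 1) :> R * R.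
Proof. by apply/eqP; rewrite xpair_eqE/= /GRing.scale/= mulr1 mulr0 add0r addr0 !eqxx. Qed.

Lemma fund_integral0 (f : R * R -> R) : continuous f ->
  (forall y, (\int[lebesgue_measure]_(x in `[0%R, (2 * pi)%R]) (f (x, y))%:E = 0)%E) \/
  (forall x, (\int[lebesgue_measure]_(y in `[0%R, (2 * pi)%R]) (f (x, y))%:E = 0)%E) ->
  (\int[mu2 R]_(x in @fund R) f x)%R = 0.
Proof.
move=> cf H; rewrite /Rintegral.
have mfund := @measurable_fund R.
(* Fubini is applied on the whole plane, to the extension by zero. *)
have intf : (mu2 R).-integrable setT ((EFin \o f) \_ (@fund R)).
  by apply/integrable_restrict; rewrite ?setTI//; exact: continuous_integrable2.
rewrite integral_mkcond; case: H => H.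
- rewrite -(integral21_prod_meas1 intf) /fubini_G.
  rewrite integral0_eq // => y _.
  have [yI|yI] := pselect ((`[0, 2 * pi]%classic : set R) y).
    rewrite -[RHS](H y) [RHS]integral_mkcond; apply: eq_integral => x _.
    rewrite !patchE/=; congr (if _ then _ else _).
    by apply/idP/idP => /set_mem/= h; apply/mem_set => //; case: h.
  rewrite integral0_eq // => x _; rewrite patchE memNset//.
  by move=> -[].
- rewrite -(integral12_prod_meas1 intf) /fubini_F.
  rewrite integral0_eq // => x _.
  have [xI|xI] := pselect ((`[0, 2 * pi]%classic : set R) x).
    rewrite -[RHS](H x) [RHS]integral_mkcond; apply: eq_integral => y _.
    rewrite !patchE/=; congr (if _ then _ else _).
    by apply/idP/idP => /set_mem/= h; apply/mem_set => //; case: h.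
  rewrite integral0_eq // => y _; rewrite patchE memNset//.
  by move=> -[].
Qed.

Lemma FTC_period (F f : R -> R) : continuous f ->
  (forall t : R, is_derive t 1 F (f t)) -> F (2 * pi) = F 0 ->
  (\int[lebesgue_measure]_(x in `[0%R, (2 * pi)%R]) (f x)%:E = 0)%E.
Proof.
move=> cf dF per.
have cF : continuous F.
  by move=> t; apply: differentiable_continuous; apply/derivable1_diffP; case: (dF t).
rewrite (@continuous_FTC2 _ f F) ?pi2_gt0 //.
- by rewrite per -EFinB subrr.
- exact: continuous_subspaceT.
- split.
  + by move=> t _; case: (dF t).
  + by apply: cvg_at_right_filter; exact: cF.
  + by apply: cvg_at_left_filter; exact: cF.
- by move=> t _; rewrite derive1E; case: (dF t).
Qed.

(** Along direction [j] the boundary values at the two ends of a period cancel. Every later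
    integration by parts is this statement applied to a product. *)
Lemma integral_dir (j : bool) f g : continuous g -> periodic2 f ->
  (forall x, is_derive x (dir R j) f (g x)) ->
  (\int[mu2 R]_(x in @fund R) g x)%R = 0.
Proof.
move=> cg pf df; apply: fund_integral0 => //; case: j df => /= df.
- left => y; apply: (@FTC_period (fun t : R => f (t, y))).
  + by under eq_fun do rewrite pair_line1; exact: continuous_line.
  + move=> t; under eq_fun do rewrite pair_line1; apply/is_derive_line.
    by rewrite -pair_line1; exact: df.
  + by have /= [<- _] := pf (0, y); rewrite add0r.
- right => y; apply: (@FTC_period (fun t : R => f (y, t))).
  + by under eq_fun do rewrite pair_line2; exact: continuous_line.
  + move=> t; under eq_fun do rewrite pair_line2; apply/is_derive_line.
    by rewrite -pair_line2; exact: df.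
  + by have /= [_ <-] := pf (y, 0); rewrite add0r.
Qed.
End TorusIntegral.

(** * Uniqueness of Fourier coefficients *)

Section Threshold.
Variable R : realType.

Lemma bernoulli_ineq (h : R) n : -1 <= h -> 1 + n%:R * h <= (1 + h) ^+ n.
Proof.
move=> h1; elim: n => [|n IH]; first by rewrite mul0r addr0 expr0.
have h0 : 0 <= 1 + h by lra.
rewrite exprS; apply: le_trans (ler_wpM2l h0 IH).
rewrite -natr1; have : 0 <= n%:R * h ^+ 2 by rewrite mulr_ge0 // sqr_ge0.
nra.
Qed.

(** With $r=s^2$ one has $n r^n=(n s^n)s^n$: the first factor is bounded by $1/(1-s)$ and the second
    tends to 0. *)
Lemma cvg_natM_exp (r : R) : 0 <= r -> r < 1 -> (fun n => n%:R * r ^+ n) @ \oo --> 0.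
Proof.
move=> r0 r1; pose s := Num.sqrt r.
have s0 : 0 <= s by exact: sqrtr_ge0.
have s1 : s < 1 by rewrite -[ltRHS]sqrtr1 ltr_sqrt.
have rE : r = s * s by rewrite -expr2 sqr_sqrtr.
have u0 : 0 < 1 - s by rewrite subr_gt0.
have key n : (1 + n%:R * (1 - s)) * s ^+ n <= 1.
  elim: n => [|n IH]; first by rewrite mul0r addr0 expr0 mulr1.
  apply: le_trans IH; rewrite exprS mulrA ler_wpM2r ?exprn_ge0//.
  rewrite -natr1; have : 0 <= (n%:R + 1) * (1 - s) ^+ 2 by rewrite mulr_ge0 ?sqr_ge0.
  nra.
have bnd n : n%:R * r ^+ n <= (1 - s)^-1 * s ^+ n.
  rewrite rE exprMn mulrA ler_wpM2r ?exprn_ge0// -[leRHS]mul1r ler_pdivlMr//.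
  apply: le_trans (key n); have := exprn_ge0 n s0; nra.
apply: (@squeeze_cvgr _ _ _ _ (fun=> 0) (geometric (1 - s)^-1 s)).
- by apply: nearW => n; rewrite mulr_ge0 ?exprn_ge0//=; exact: bnd.
- exact: cvg_cst.
- by apply: cvg_geometric; rewrite ger0_norm.
Qed.

(* The exponent n 2^n rather than 2^n makes the limit at t = 1/2 equal to 0. *)
Definition threshold (t : R) (n : nat) : R := (1 - t ^+ n) ^+ (n * 2 ^ n).

Lemma threshold_ge0_le1 t n : 0 <= t <= 1 -> 0 <= threshold t n <= 1.
Proof.
move=> /andP[t0 t1]; have h0 := exprn_ge0 n t0; have h1 := exprn_ile1 n t0 t1.
by rewrite exprn_ge0 ?exprn_ile1 ?subr_ge0 ?gerBl.
Qed.

(** Below $1/2$, Bernoulli's inequality bounds the threshold from below by $1-n(2t)^n$. Otherwise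
    $(1-x)(1+x)\le 1$ with $x=t^n$ bounds it by the inverse of $(1+x)^{n2^n}\ge 1+n(2t)^n\ge n+1$;
    the factor $n$ is what makes this work at $t=1/2$. *)
Lemma cvg_threshold t : 0 <= t <= 1 ->
  threshold t @ \oo --> (if t < 2^-1 then 1 else 0 : R).
Proof.
move=> t01; have /andP[t0 t1] := t01; case: ltP => t2.
  apply: (@squeeze_cvgr _ _ _ _ (fun n => 1 - n%:R * (2 * t) ^+ n) (fun=> 1)).
  - apply: nearW => n; have /andP[_ ->] := threshold_ge0_le1 n t01; rewrite andbT.
    have := @bernoulli_ineq (- t ^+ n) (n * 2 ^ n); rewrite lerN2 exprn_ile1// => /(_ isT).
    by rewrite mulrN natrM natrX -mulrA -exprMn.
  - rewrite -[X in _ --> X]subr0; apply: cvgB; first exact: cvg_cst.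
    by apply: cvg_natM_exp; lra.
  - exact: cvg_cst.
apply: (@squeeze_cvgr _ _ _ _ (fun=> 0) (fun n => n.+1%:R^-1)).
- apply: nearW => n; have /andP[-> _] := threshold_ge0_le1 n t01; rewrite andTb.
  have h0 := exprn_ge0 n t0; have h1 := exprn_ile1 n t0 t1.
  set m := (n * 2 ^ n)%N.
  have A : threshold t n * (1 + t ^+ n) ^+ m <= 1.
    rewrite /threshold -exprMn exprn_ile1//; first by rewrite mulr_ge0; lra.
    by have := sqr_ge0 (t ^+ n); nra.
  have B : n.+1%:R <= (1 + t ^+ n) ^+ m.
    have := @bernoulli_ineq (t ^+ n) m; have -> : -1 <= t ^+ n by lra.
    move=> /(_ isT); apply: le_trans; rewrite -natr1 addrC lerD2l.
    rewrite /m natrM natrX -mulrA -exprMn -[leLHS]mulr1 ler_wpM2l//.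
    by rewrite exprn_ege1//; lra.
  have /andP[th0 _] := threshold_ge0_le1 n t01.
  rewrite -[leRHS]mul1r ler_pdivlMr ?ltr0Sn//.
  by apply: le_trans A; rewrite ler_wpM2l.
- exact: cvg_cst.
- exact: cvg_harmonic.
Qed.
End Threshold.

(** * Trigonometric polynomials and their completeness *)

Section TrigPoly.
Variable R : realType.
Local Notation plane := (measurableTypeR R * measurableTypeR R)%type.
Implicit Types f g p q : R * R -> R.

Lemma dotkD k l (x : R * R) : dotk (k + l) x = dotk k x + dotk l x.
Proof. by rewrite /dotk/= !intrD; ring. Qed.

Lemma dotkN k (x : R * R) : dotk (- k) x = - dotk k x.
Proof. by rewrite /dotk/= !mulrNz; ring. Qed.

Lemma dotk0 (x : R * R) : dotk 0 x = 0.
Proof. by rewrite /dotk/= !mul0r addr0. Qed.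

Lemma dotk_line k (x w : R * R) (t : R) :
  dotk k (x + t *: w) = dotk k x + t * dotk k w.
Proof. by rewrite /dotk/= /GRing.scale/=; ring. Qed.

Lemma continuous_dotk k : continuous (@dotk R k).
Proof.
move=> x; apply: cvgD; apply: cvgM; try exact: cvg_cst.
- exact: cvg_fst.
- exact: cvg_snd.
Qed.

Lemma continuous_cosk k : continuous (fun x : R * R => cos (dotk k x)).
Proof. by move=> x; apply: continuous_comp; [exact: continuous_dotk|exact: continuous_cos]. Qed.

Lemma continuous_sink k : continuous (fun x : R * R => sin (dotk k x)).
Proof. by move=> x; apply: continuous_comp; [exact: continuous_dotk|exact: continuous_sin]. Qed.

Lemma integrable2M f g : (mu2 R).-integrable (@fund R) (EFin \o f) ->
  continuous g -> (mu2 R).-integrable (@fund R) (EFin \o (fun x => f x * g x)).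
Proof.
move=> intf cg.
have : (mu2 R).-integrable (@fund R) ((EFin \o f) \* (EFin \o g))%E.
  apply: integrableMl => //; first exact: measurable_fund.
    exact: measurable_funTS (continuous_measurable2 cg).
  have [M [Mr h]] :=
    compact_bounded (continuous_compact (continuous_subspaceT cg) (@compact_fund R)).
  by exists M; split=> // N MN x fx; apply: (h N MN); exists x.
by [].
Qed.

Inductive trigpoly : (R * R -> R) -> Prop :=
| trigpoly_cos k : trigpoly (fun x => cos (dotk k x))
| trigpoly_sin k : trigpoly (fun x => sin (dotk k x))
| trigpolyD p q : trigpoly p -> trigpoly q -> trigpoly (fun x => p x + q x)
| trigpolyZ c p : trigpoly p -> trigpoly (fun x => c * p x).

Lemma trigpoly_cst c : trigpoly (fun=> c).
Proof.
have -> : (fun=> c) = (fun x : R * R => c * cos (dotk 0 x)).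
  by apply/funext => x; rewrite dotk0 cos0 mulr1.
by apply: trigpolyZ; exact: trigpoly_cos.
Qed.

Lemma trigpolyM p q : trigpoly p -> trigpoly q -> trigpoly (fun x => p x * q x).
Proof.
have ext f g : trigpoly f -> f =1 g -> trigpoly g by move=> tf /funext <-.
move=> tp tq; elim: tp => [k|k|f g _ IHf _ IHg|c f _ IHf]; last 2 first.
- by apply: (ext _ _ (trigpolyD IHf IHg)) => x; rewrite mulrDl.
- by apply: (ext _ _ (trigpolyZ c IHf)) => x; rewrite mulrA.
- elim: tq => [l|l|f g _ IHf _ IHg|c f _ IHf].
  + apply: (ext _ _ (trigpolyZ 2^-1
      (trigpolyD (trigpoly_cos (k + l)) (trigpoly_cos (k - l))))) => x.
    by rewrite !dotkD dotkN cosB cosD; field.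
  + apply: (ext _ _ (trigpolyZ 2^-1
      (trigpolyD (trigpoly_sin (k + l)) (trigpolyZ (-1) (trigpoly_sin (k - l)))))) => x.
    by rewrite !dotkD dotkN sinB sinD; field.
  + by apply: (ext _ _ (trigpolyD IHf IHg)) => x; rewrite mulrDr.
  + by apply: (ext _ _ (trigpolyZ c IHf)) => x; ring.
- elim: tq => [l|l|f g _ IHf _ IHg|c f _ IHf].
  + apply: (ext _ _ (trigpolyZ 2^-1
      (trigpolyD (trigpoly_sin (k + l)) (trigpoly_sin (k - l))))) => x.
    by rewrite !dotkD dotkN sinB sinD; field.
  + apply: (ext _ _ (trigpolyZ 2^-1
      (trigpolyD (trigpoly_cos (k - l)) (trigpolyZ (-1) (trigpoly_cos (k + l)))))) => x.
    by rewrite !dotkD dotkN cosB cosD; field.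
  + by apply: (ext _ _ (trigpolyD IHf IHg)) => x; rewrite mulrDr.
  + by apply: (ext _ _ (trigpolyZ c IHf)) => x; ring.
Qed.

Lemma trigpolyX p n : trigpoly p -> trigpoly (fun x => p x ^+ n).
Proof.
move=> tp; elim: n => [|n IH]; first exact: trigpoly_cst 1.
have -> : (fun x => p x ^+ n.+1) = (fun x => p x * p x ^+ n).
  by apply/funext => x; rewrite exprS.
exact: trigpolyM.
Qed.

(** The threshold is a polynomial in its argument, so these approximations of indicator functions
    stay inside the algebra of trigonometric polynomials. *)
Lemma trigpoly_threshold p n : trigpoly p -> trigpoly (fun x => threshold (p x) n).
Proof.
move=> tp; rewrite /threshold; apply: trigpolyX.
have -> : (fun x => 1 - p x ^+ n) = (fun x => 1 + -1 * p x ^+ n).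
  by apply/funext => x; rewrite mulN1r.
by apply: trigpolyD; [exact: trigpoly_cst|apply: trigpolyZ; exact: trigpolyX].
Qed.

Lemma continuous_trigpoly p : trigpoly p -> continuous p.
Proof.
elim => [k|k|f g _ IHf _ IHg|c f _ IHf] x.
- exact: continuous_cosk.
- exact: continuous_sink.
- by apply: cvgD; [exact: IHf|exact: IHg].
- by apply: cvgM; [exact: cvg_cst|exact: IHf].
Qed.

Section Uniqueness.
Variable f : R * R -> R.
Hypothesis intf : (mu2 R).-integrable (@fund R) (EFin \o f).
Hypothesis fcos : forall k, (\int[mu2 R]_(x in @fund R) (f x * cos (dotk k x)))%R = 0.
Hypothesis fsin : forall k, (\int[mu2 R]_(x in @fund R) (f x * sin (dotk k x)))%R = 0.

(** The open square is used because periodic functions cannot separate opposite sides of the closed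
    one; the boundary is negligible. *)
Let Q : set plane := `]0, 2 * pi[ `*` `]0, 2 * pi[.
Let mQ : measurable Q. Proof. by apply: measurableX; exact: measurable_itv. Qed.
Let mfund := @measurable_fund R.
Let QS : Q `<=` @fund R.
Proof. by move=> x [/= h1 h2]; split; apply: subset_itv_oo_cc. Qed.

Lemma trigpoly_orth p : trigpoly p -> (\int[mu2 R]_(x in @fund R) (f x * p x))%R = 0.
Proof.
move=> tp; elim: tp => [k|k|g h tg IHg th IHh|c g tg IHg].
- exact: fcos.
- exact: fsin.
- under eq_Rintegral do rewrite mulrDr.
  rewrite RintegralD ?IHg ?IHh ?addr0 //; apply: integrable2M => //;
  exact: continuous_trigpoly.
- under eq_Rintegral do rewrite mulrCA.
  rewrite RintegralZl ?IHg ?mulr0 //; apply: integrable2M => //.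
  exact: continuous_trigpoly.
Qed.

Lemma null_line : mu2 R (@fund R `\` Q) = 0%E.
Proof.
have m1 (r : R) : measurable ([set r] : set (measurableTypeR R)) by exact: measurable_set1.
pose I : set (measurableTypeR R) := [set` `[0, 2 * pi]].
have mI : measurable I by exact: measurable_itv.
pose L : set plane := ([set 0] `*` I) `|` ([set 2 * pi] `*` I) `|`
   ((I `*` [set 0]) `|` (I `*` [set 2 * pi])).
have mL : measurable L.
  by apply: measurableU; apply: measurableU; apply: measurableX.
have L0 : mu2 R L = 0%E.
  have z1 r : mu2 R ([set r] `*` I) = 0%E.
    by rewrite mu2X // lebesgue_measure_set1 mul0e.
  have z2 r : mu2 R (I `*` [set r]) = 0%E.
    by rewrite mu2X // lebesgue_measure_set1 mule0.
  by apply: null_set_setU; try apply: null_set_setU; try (apply: measurableU);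
    try apply: measurableX.
apply: (@subset_measure0 _ _ _ (mu2 R) _ L) => //; first exact: measurableD.
move=> [x y] [[/= xI yI] nQ]; have [x0|x0] := eqVneq x 0.
  by left; left; split.
have [x1|x1] := eqVneq x (2 * pi); first by left; right; split.
have [y0|y0] := eqVneq y 0; first by right; left; split.
have [y1|y1] := eqVneq y (2 * pi); first by right; right; split.
exfalso; apply: nQ; move: xI yI; rewrite !in_itv/= => /andP[a b] /andP[c d].
by split; rewrite /= in_itv/= !lt_neqAle eq_sym ?a ?b ?c ?d ?x0 ?x1 ?y0 ?y1.
Qed.

Lemma integral_fundQ g : (mu2 R).-integrable (@fund R) (EFin \o g) ->
  (\int[mu2 R]_(x in @fund R) (g x)%:E = \int[mu2 R]_(x in Q) (g x)%:E)%E.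
Proof.
move=> intg.
rewrite (@negligible_integral _ _ _ (mu2 R) _ (@fund R `\` Q))//.
- by congr (integral _ _ _); rewrite setDD setIidr.
- exact: measurableD.
- exact: null_line.
Qed.

(** Dominated convergence with majorant [|f|]: orthogonality survives bounded pointwise limits,
    which is how indicator functions become accessible. *)
Lemma trigpoly_limit (p : nat -> R * R -> R) (g : R * R -> R) :
  (forall n, trigpoly (p n)) -> (forall n x, Q x -> `|p n x| <= 1) ->
  (forall x, Q x -> p ^~ x @ \oo --> g x) ->
  (\int[mu2 R]_(x in Q) (f x * g x)%:E = 0)%E.
Proof.
move=> tp bp pg.
have intfQ : (mu2 R).-integrable Q (EFin \o f) by exact: integrableS intf.
have mf : measurable_fun Q f.
  by apply/measurable_EFinP; exact: measurable_int intfQ.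
have mp n : measurable_fun Q (fun x => (f x * p n x)%:E).
  apply/measurable_EFinP; apply: measurable_funM; first exact: mf.
  exact: measurable_funTS (continuous_measurable2 (continuous_trigpoly (tp n))).
have cv x : Q x -> (f x * p n x)%:E @[n --> \oo] --> (f x * g x)%:E.
  move=> Qx; apply: cvg_EFin; first exact: nearW.
  by apply: cvgM; [exact: cvg_cst|exact: pg].
have mg : measurable_fun Q (fun x => (f x * g x)%:E).
  by apply: (emeasurable_fun_cvg _ _ mp).
have bd : {ae mu2 R, forall x n, Q x -> (`|(f x * p n x)%:E| <= (`|f x|)%:E)%E}.
  apply: aeW => x n Qx; rewrite lee_fin normrM -[leRHS]mulr1.
  by rewrite ler_wpM2l //; exact: bp.
have [_ _] := dominated_convergence mQ mp mg (aeW _ cv) (integrable_norm intfQ) bd.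
have E n : (\int[mu2 R]_(x in Q) (f x * p n x)%:E = 0)%E.
  have ip : (mu2 R).-integrable (@fund R) (EFin \o (fun x => f x * p n x)).
    by apply: integrable2M => //; exact: continuous_trigpoly.
  rewrite -(integral_fundQ ip).
  by rewrite -[LHS]fineK; [rewrite [X in X%:E](trigpoly_orth (tp n))|exact: integrable_fin_num].
have -> : [sequence (\int[mu2 R]_(x in Q) (f x * p n x)%:E)%E]_n = (fun=> 0%E).
  by apply/funext => n; exact: E.
by move=> /cvg_lim <- //; rewrite lim_cst.
Qed.

(** For an angle $y\in(0,2\pi)$, the condition $y<b$ describes an arc centred at $b/2$, that is, a
    superlevel set of $\cos(y-b/2)$. Thresholding an affine function of this cosine yields the
    indicator. *)
Lemma arc_approx k (b : R) : (forall x, Q x -> 0 < dotk k x < 2 * pi) ->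
  exists p : nat -> R * R -> R, [/\ forall n, trigpoly (p n),
    forall n x, Q x -> `|p n x| <= 1 &
    forall x, Q x -> p ^~ x @ \oo --> ((dotk k x < b)%R%:R : R)].
Proof.
move=> kQ; have [b0|b0] := leP b 0.
  exists (fun _ _ => 0); split => [n|n x _|x Qx]; first exact: trigpoly_cst.
    by rewrite normr0.
  have /andP[h _] := kQ x Qx; rewrite ltNge (ltW (le_lt_trans b0 h)); exact: cvg_cst.
have [b1|b1] := leP (2 * pi) b.
  exists (fun _ _ => 1); split => [n|n x _|x Qx]; first exact: trigpoly_cst.
    by rewrite normr1.
  have /andP[_ h] := kQ x Qx; rewrite (lt_le_trans h b1); exact: cvg_cst.
(* The factor $1/4$ keeps [t] in $[0,1]$, since a difference of cosines lies in $[-2,2]$; the value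
   $1/2$ is taken at the ends of the arc. *)
pose t (x : R * R) := 2^-1 + 4^-1 * (cos (b / 2) +
  -1 * (cos (b / 2) * cos (dotk k x) + sin (b / 2) * sin (dotk k x))).
have tE x : t x = 2^-1 - 4^-1 * (cos (dotk k x - b / 2) - cos (b / 2)).
  by rewrite /t cosB; ring.
have t01 x : 0 <= t x <= 1.
  rewrite tE; have := cos_geN1 (b / 2); have := cos_le1 (b / 2).
  have := cos_geN1 (dotk k x - b / 2); have := cos_le1 (dotk k x - b / 2).
  by move=> *; apply/andP; split; lra.
have tt : trigpoly t.
  apply: trigpolyD; first exact: trigpoly_cst.
  apply: trigpolyZ; apply: trigpolyD; first exact: trigpoly_cst.
  apply: trigpolyZ; apply: trigpolyD; apply: trigpolyZ.
    exact: trigpoly_cos.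
  exact: trigpoly_sin.
exists (fun n x => threshold (t x) n); split => [n|n x _|x Qx].
- exact: trigpoly_threshold.
- by have /andP[h0 h1] := threshold_ge0_le1 n (t01 x); rewrite ger0_norm.
- suff -> : (dotk k x < b) = (t x < 2^-1).
    by have := cvg_threshold (t01 x); case: ifP.
  have /andP[y0 y1] := kQ x Qx; set y := dotk k x in y0 y1 *.
  (* In product form the sign is visible: the first sine is positive, and the second has the sign of
     $b-y$ because $|b-y|<2\pi$. *)
  have -> : t x = 2^-1 - 2^-1 * (sin (y / 2) * sin ((b - y) / 2)).
    rewrite tE -/y.
    have -> : y - b / 2 = y / 2 - (b - y) / 2 by field.
    have -> : b / 2 = y / 2 + (b - y) / 2 by field.
    by rewrite cosB cosD; field.
  have s0 : 0 < sin (y / 2) by apply: sin_gt0_pi; lra.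
  rewrite gtrBl pmulr_rgt0 ?invr_gt0// pmulr_rgt0 //.
  apply/idP/idP => [yb|]; first by apply: sin_gt0_pi; lra.
  apply: contraTT; rewrite -!leNgt => yb.
  have -> : (b - y) / 2 = - ((y - b) / 2) by field.
  by rewrite sinN oppr_le0; apply: sin_ge0_pi; lra.
Qed.

Lemma integral_rect (b d : R) :
  (\int[mu2 R]_(x in Q `&` (`]-oo, b[ `*` `]-oo, d[)) (f x)%:E = 0)%E.
Proof.
have d1 (x : R * R) : dotk (1, 0) x = x.1 by rewrite /dotk/= mul1r mul0r addr0.
have d2 (x : R * R) : dotk (0, 1) x = x.2 by rewrite /dotk/= mul1r mul0r add0r.
have [|p [tp bp cp]] := @arc_approx (1, 0) b.
  by move=> x [/=]; rewrite d1 in_itv.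
have [|q [tq bq cq]] := @arc_approx (0, 1) d.
  by move=> x [/= _]; rewrite d2 in_itv.
rewrite integral_mkcondr.
rewrite -[RHS](@trigpoly_limit (fun n x => p n x * q n x)
  (fun x => (x.1 < b)%R%:R * (x.2 < d)%R%:R)).
- apply: eq_integral => x _; rewrite patchE; case: ifPn => [/set_mem[/=]|].
    by rewrite !in_itv/= => -> ->; rewrite !mulr1.
  move=> /negP nx; case: ltP => xb; last by rewrite mul0r mulr0.
  case: ltP => xd; last by rewrite !mulr0.
  by exfalso; apply: nx; apply/mem_set; split; rewrite /= in_itv.
- by move=> n; exact: trigpolyM.
- by move=> n x Qx; rewrite normrM -[leRHS]mulr1 ler_pM ?bp ?bq.
- by move=> x Qx; apply: cvgM; [rewrite -d1; exact: cp|rewrite -d2; exact: cq].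
Qed.

(* Dynkin's lemma for the charge [A |-> int_(D /\ phi^-1 A) f]. *)
Lemma charge_dynkin d' (T : measurableType d') (phi : plane -> T) (G : set (set T))
    (D : set plane) :
  measurable D -> D `<=` @fund R -> measurable_fun setT phi ->
  @measurable _ T = <<s G >> -> setI_closed G ->
  (\int[mu2 R]_(x in D) (f x)%:E = 0)%E ->
  (forall A, G A -> \int[mu2 R]_(x in D `&` phi @^-1` A) (f x)%:E = 0)%E ->
  forall A, measurable A -> (\int[mu2 R]_(x in D `&` phi @^-1` A) (f x)%:E = 0)%E.
Proof.
move=> mD DS mphi GE GI D0 GA A mA.
have mpre B : measurable B -> measurable (D `&` phi @^-1` B).
  by move=> mB; apply: measurableI => //; rewrite -[X in measurable X]setTI; exact: mphi.
have intD B : measurable B -> B `<=` D -> (mu2 R).-integrable B (EFin \o f).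
  by move=> mB BD; apply: integrableS intf => //; apply: subset_trans DS.
pose P B := (\int[mu2 R]_(x in D `&` phi @^-1` B) (f x)%:E = 0)%E.
apply: (@dynkin_induction _ T G P) => //.
- by rewrite /P preimage_setT setIT.
- move=> B mB PB; rewrite /P.
  have mf : measurable_fun D (EFin \o f) by exact: measurable_int (intD D mD _).
  have DE : D = (D `&` phi @^-1` B) `|` (D `&` phi @^-1` (~` B)).
    by rewrite preimage_setC -setIUr setUv setIT.
  move: D0; rewrite [in X in X -> _]DE integral_setU //.
  + by rewrite [X in (X + _)%E]PB add0e.
  + exact: mpre.
  + by apply: mpre; exact: measurableC.
  + by rewrite -DE.
  + by apply/disj_setPS => x [[_ h1] [_ h2]]; exact: h2.
- move=> F mF tF PF; rewrite /P preimage_bigcup setI_bigcupr integral_bigcup.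
  + by apply: eseries0 => n _ _; exact: PF.
  + apply/trivIsetP => i j _ _ ij; rewrite -subset0 => x [[_ xi] [_ xj]].
    by move/trivIsetP: tF => /(_ i j I I ij); rewrite -subset0; apply; split; [exact: xi|exact: xj].
  + by move=> n; exact: mpre.
  + apply: intD; last by move=> x [n _ []].
    by apply: bigcupT_measurable => n; exact: mpre.
- by rewrite -GE.
Qed.

Lemma rayI : setI_closed (@RGenInftyO.G R).
Proof.
move=> _ _ [x ->] [y ->]; exists (Order.min x y).
by apply/seteqP; split => z /=; rewrite !in_itv/= lt_min; [move=> [-> ->]|move=> /andP[]].
Qed.

Lemma measurable_rayE : @measurable _ (measurableTypeR R) = <<s @RGenInftyO.G R >>.
Proof. exact: RGenInftyO.measurableE. Qed.

Lemma integral_measurable0 A : measurable A ->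
  (\int[mu2 R]_(x in Q `&` A) (f x)%:E = 0)%E.
Proof.
have int0 : (\int[mu2 R]_(x in Q) (f x)%:E = 0)%E.
  have := @trigpoly_limit (fun _ _ => 1) (fun=> 1).
  under eq_integral do rewrite mulr1; apply => [n|n x _|x _]; first exact: trigpoly_cst.
    by rewrite normr1.
  exact: cvg_cst.
have mray b : measurable ([set` `]-oo, b[] : set (measurableTypeR R)) by exact: measurable_itv.
have Qlt x : Q x -> x.1 < 2 * pi /\ x.2 < 2 * pi.
  by move=> [/=]; rewrite !in_itv/= => /andP[_ ?] /andP[_ ?].
have mT : measurable (setT : set (measurableTypeR R)) by exact: measurableT.
have mI (C D : set plane) : measurable C -> measurable D -> measurable (C `&` D).
  by move=> *; exact: measurableI.
have step1 (b : R) (B : set (measurableTypeR R)) : measurable B ->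
  (\int[mu2 R]_(x in Q `&` (B `*` `]-oo, b[)) (f x)%:E = 0)%E.
  move=> mB.
  have E C : (Q `&` (setT `*` `]-oo, b[)) `&` fst @^-1` C = Q `&` (C `*` `]-oo, b[).
    by apply/seteqP; split => x [] => [[Qx [_ xb]] xC|Qx [xC xb]].
  rewrite -E; apply: (@charge_dynkin _ (measurableTypeR R) fst (@RGenInftyO.G R)) => //.
  - by apply: mI => //; exact: measurableX.
  - by move=> x [/QS].
  - exact: measurable_rayE.
  - exact: rayI.
  (* On [Q] the coordinates stay below $2\pi$, so the ray ending there plays the role of the whole
     line. *)
  - rewrite -[RHS](integral_rect (2 * pi) b); congr (integral _ _ _).
    apply/seteqP; split => x [Qx [/= x1 x2]]; split=> //; split=> //=.
    by rewrite in_itv/=; case: (Qlt _ Qx).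
  - by move=> _ [c ->]; rewrite E; exact: integral_rect.
have step2 (B C : set (measurableTypeR R)) : measurable B -> measurable C ->
  (\int[mu2 R]_(x in Q `&` (B `*` C)) (f x)%:E = 0)%E.
  move=> mB mC.
  have E C' : (Q `&` (B `*` setT)) `&` snd @^-1` C' = Q `&` (B `*` C').
    by apply/seteqP; split => x [] => [[Qx [xB _]] xC|Qx [xB xC]].
  rewrite -E; apply: (@charge_dynkin _ (measurableTypeR R) snd (@RGenInftyO.G R)) => //.
  - by apply: mI => //; exact: measurableX.
  - by move=> x [/QS].
  - exact: measurable_rayE.
  - exact: rayI.
  - rewrite -[RHS](step1 (2 * pi) B mB); congr (integral _ _ _).
    apply/seteqP; split => x [Qx [/= x1 x2]]; split=> //; split=> //=.
    by rewrite in_itv/=; case: (Qlt _ Qx).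
  - by move=> _ [c ->]; rewrite E; exact: step1.
move=> mA; rewrite -[A]/(id @^-1` A).
apply: (@charge_dynkin _ plane id [set B `*` C | B in measurable & C in measurable]) => //.
- exact: measurable_prod_measurableType.
- move=> _ _ [B mB [C mC <-]] [B' mB' [C' mC' <-]].
  by exists (B `&` B'); [exact: measurableI|exists (C `&` C'); [exact: measurableI|rewrite setXI]].
- by move=> _ [B mB [C mC <-]]; exact: step2.
Qed.

Theorem fourier_uniqueness : ae_eq (mu2 R) (@fund R) f (fun=> 0).
Proof.
suff : ae_eq (mu2 R) (@fund R) (EFin \o f) (fun=> 0%E).
  by apply: filterS => x h /h [].
apply: integral_ae_eq => // E ES mE; rewrite integral0.
have intE : (mu2 R).-integrable E (EFin \o f) by exact: integrableS intf.
rewrite (@negligible_integral _ _ _ (mu2 R) _ (@fund R `\` Q))//.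
- rewrite -[RHS](integral_measurable0 mE); congr (integral _ _ _).
  apply/seteqP; split => x [xE xQ]; split => //.
    by apply: contrapT => nQ; apply: xQ; split => //; exact: ES.
  by move=> [].
- exact: measurableD.
- exact: null_line.
Qed.
End Uniqueness.
End TrigPoly.

(** * Trigonometric series *)

Section RealSeries.
Variable R : realType.
Implicit Types (u v M : nat -> R).

Definition sumr u : R := limn (series u).

Lemma dominated_series u M : (forall n, `|u n| <= M n) -> cvgn (series M) ->
  cvgn (series u) /\ `|sumr u| <= sumr M.
Proof.
move=> uM cM.
have cn : cvgn [normed series u].
  apply: series_le_cvg cM => n; [exact: normr_ge0|exact: le_trans (uM n)|exact: uM].
split; first exact: normed_cvg.
apply: le_trans (lim_series_norm cn) _.
by apply: lim_series_le => // n; exact: uM.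
Qed.

Lemma sumr_sub u v : cvgn (series u) -> cvgn (series v) ->
  sumr (fun n => u n - v n) = sumr u - sumr v.
Proof. by move=> cu cv; rewrite /sumr -lim_seriesB. Qed.

Lemma sumr_scale c u : cvgn (series u) -> sumr (fun n => c * u n) = c * sumr u.
Proof. by move=> cu; have := @lim_seriesZ _ u c cu. Qed.

Lemma cvg_seriesMl c u : cvgn (series u) -> cvgn (series (fun n => c * u n)).
Proof. by move=> cu; have := @is_cvg_seriesZ _ u c cu. Qed.

Lemma cvg_seriesB u v : cvgn (series u) -> cvgn (series v) ->
  cvgn (series (fun n => u n - v n)).
Proof. by move=> cu cv; have := is_cvg_seriesB cu cv. Qed.

(** Covers both signs of [t]. Keeping [z] within [|t|] of [y] allows a Lipschitz bound on [dg] to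
    turn the identity into a quadratic Taylor estimate. *)
Lemma mvt_dist (g dg : R -> R) : (forall x : R, is_derive x 1 g (dg x)) ->
  forall y t, exists2 z, `|z - y| <= `|t| & g (y + t) - g y = t * dg z.
Proof.
move=> dgP.
have cg : continuous g.
  by move=> t; apply: differentiable_continuous; apply/derivable1_diffP; case: (dgP t).
move=> y t; have [t0|t0] := leP 0 t.
  have [||z] := @MVT_segment _ g dg y (y + t); first by rewrite lerDl.
  - exact: continuous_subspaceT.
  rewrite in_itv/= => /andP[z1 z2] e; exists z; last by rewrite e mulrC addrC addKr.
  by rewrite !ger0_norm ?subr_ge0// lerBlDl.
have [||z] := @MVT_segment _ g dg (y + t) y; first by rewrite gerDl ltW.
- exact: continuous_subspaceT.
rewrite in_itv/= => /andP[z1 z2] e; exists z; last first.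
  by rewrite -opprB e opprD addrA subrr sub0r mulrN opprK mulrC.
by rewrite distrC ger0_norm ?subr_ge0// ltr0_norm// lerBlDl -lerBlDr opprK.
Qed.

Lemma lipschitz_cos (y t : R) : `|cos (y + t) - cos y| <= `|t|.
Proof.
have [z _ ->] := mvt_dist (@is_derive_cos R) y t.
by rewrite normrM normrN -[leRHS]mulr1 ler_wpM2l// sin_max.
Qed.

Lemma lipschitz_sin (y t : R) : `|sin (y + t) - sin y| <= `|t|.
Proof.
have [z _ ->] := mvt_dist (@is_derive_sin R) y t.
by rewrite normrM -[leRHS]mulr1 ler_wpM2l// cos_max.
Qed.

Lemma taylor1_cos (y t : R) : `|cos (y + t) - cos y - t * - sin y| <= t ^+ 2.
Proof.
have [z zy ->] := mvt_dist (@is_derive_cos R) y t.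
rewrite -mulrBr normrM -[t ^+ 2]ger0_norm ?sqr_ge0// expr2 normrM ler_wpM2l//.
rewrite -opprD normrN -[z](subrKC y).
by apply: le_trans zy; apply: lipschitz_sin.
Qed.

Lemma taylor1_sin (y t : R) : `|sin (y + t) - sin y - t * cos y| <= t ^+ 2.
Proof.
have [z zy ->] := mvt_dist (@is_derive_sin R) y t.
rewrite -mulrBr normrM -[t ^+ 2]ger0_norm ?sqr_ge0// expr2 normrM ler_wpM2l//.
rewrite -[z](subrKC y).
by apply: le_trans zy; apply: lipschitz_cos.
Qed.

Lemma is_derive_of_taylor (f : R * R -> R) (x w : R * R) (d C : R) :
  (forall h : R, `|f (x + h *: w) - f x - h * d| <= C * h ^+ 2) -> is_derive x w f d.
Proof.
move=> H.
have C0 : 0 <= C by have := H 1; rewrite expr1n mulr1; exact: le_trans.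
suff L : h^-1 *: ((f \o shift x) (h *: w) - f x) @[h --> 0^'] --> d.
  by split; [apply/cvg_ex; exists d|exact: cvg_lim L].
apply/cvgrPdist_le => e e0; near=> h.
have h0 : h != 0 by near: h; exact: nbhs_dnbhs_neq.
rewrite /= [X in f X]addrC /GRing.scale/=.
have -> : d - h^-1 * (f (x + h *: w) - f x) =
  - (h^-1 * (f (x + h *: w) - f x - h * d)) by field.
rewrite normrN normrM normfV ler_pdivrMl ?normr_gt0//.
apply: le_trans (H h) _; rewrite -[h ^+ 2]ger0_norm ?sqr_ge0// expr2 normrM mulrCA.
rewrite ler_wpM2l// -[C * _]mulrC; apply: (@le_trans _ _ (`|h| * (C + 1))).
  by rewrite ler_wpM2l// lerDl.
rewrite -ler_pdivlMr ?ltr_wpDl//; near: h.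
apply: dnbhs0_le; rewrite divr_gt0// ltr_wpDl//.
Unshelve. all: by end_near.
Qed.

Lemma lipschitz_continuous2 (f : R * R -> R) (C : R) :
  (forall x w : R * R, `|f (x + w) - f x| <= C * (`|w.1| + `|w.2|)) -> continuous f.
Proof.
move=> H x; apply/cvgrPdist_le => e e0.
have C0 : 0 < `|C| + 1 by rewrite ltr_wpDl.
have d0 : 0 < e / ((`|C| + 1) * 2) by rewrite divr_gt0 ?mulr_gt0.
apply: filterS (nbhsx_ballx x _ d0) => y [/= y1 y2].
have := H x (y - x); rewrite subrKC distrC => /le_trans; apply.
rewrite /= (distrC y.1) (distrC y.2).
move: y1 y2; rewrite /ball/= !ltr_pdivlMr ?mulr_gt0// => y1 y2.
apply: (@le_trans _ _ ((`|C| + 1) * (`|x.1 - y.1| + `|x.2 - y.2|))).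
  by rewrite ler_wpM2r ?addr_ge0//; have := ler_norm C; lra.
lra.
Qed.
End RealSeries.

(** * Termwise differentiation of trigonometric series *)

Section TrigSeries.
Variable R : realType.
Variable k : nat -> int * int.
Implicit Types (c : nat -> R * R) (x w : R * R).

(** Comparable to $|l|$ away from the origin, but at least 1 everywhere, so that its powers increase
    with the exponent even at $l=0$. *)
Definition wt (l : int * int) : R := 1 + `|l.1%:~R| + `|l.2%:~R|.

Lemma wt_ge1 l : 1 <= wt l.
Proof. by rewrite /wt -addrA lerDl addr_ge0. Qed.

Lemma wt_ge0 l : 0 <= wt l.
Proof. exact: le_trans ler01 (wt_ge1 l). Qed.

Lemma dotk_le_wt l w : `|dotk l w| <= wt l * (`|w.1| + `|w.2|).
Proof.
apply: le_trans (ler_normD _ _) _; rewrite !normrM /wt.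
by rewrite mulrDr lerD// ler_wpM2r//;
  have := normr_ge0 (l.1%:~R : R); have := normr_ge0 (l.2%:~R : R); lra.
Qed.

Definition size_coef c n : R := `|(c n).1| + `|(c n).2|.

Lemma size_coef_ge0 c n : 0 <= size_coef c n.
Proof. exact: addr_ge0. Qed.

(** Each derivative costs one power of the weight. The sequence [k] of frequencies turns a sum over
    the lattice into a series over [nat]. *)
Definition summable_coef m c := cvgn (series (fun n => wt (k n) ^+ m * size_coef c n)).

Lemma summable_coefS m c : summable_coef m.+1 c -> summable_coef m c.
Proof.
apply: series_le_cvg => n.
- by rewrite mulr_ge0 ?exprn_ge0 ?wt_ge0 ?size_coef_ge0.
- by rewrite mulr_ge0 ?exprn_ge0 ?wt_ge0 ?size_coef_ge0.
- by rewrite ler_wpM2r ?size_coef_ge0// exprS ler_peMl ?wt_ge1 // exprn_ge0 ?wt_ge0.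
Qed.

Definition trigterm c n x := (c n).1 * cos (dotk (k n) x) + (c n).2 * sin (dotk (k n) x).

Definition trigser c x := sumr (fun n => trigterm c n x).

(* The coefficients of the derivative of [trigser c] in the direction [w]. *)
Definition dcoef w c n := ((c n).2 * dotk (k n) w, - (c n).1 * dotk (k n) w).

Lemma dcoefC w w' c : dcoef w (dcoef w' c) = dcoef w' (dcoef w c).
Proof. by apply/funext => n; rewrite /dcoef/=; congr pair; ring. Qed.

Lemma summable_dcoef m w c : summable_coef m.+1 c -> summable_coef m (dcoef w c).
Proof.
move=> sc; have h : cvgn (series (fun n => (`|w.1| + `|w.2|) *
    (wt (k n) ^+ m.+1 * size_coef c n))) by exact: cvg_seriesMl.
apply: series_le_cvg h => n.
- by rewrite mulr_ge0 ?exprn_ge0 ?wt_ge0 ?size_coef_ge0.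
- by rewrite mulr_ge0 ?addr_ge0// mulr_ge0 ?exprn_ge0 ?wt_ge0 ?size_coef_ge0.
- rewrite {1}/size_coef/= !normrM normrN -mulrDl exprS [size_coef c n]addrC.
  have := dotk_le_wt (k n) w; have := size_coef_ge0 c n; rewrite /size_coef addrC.
  have := exprn_ge0 m (wt_ge0 (k n)).
  set P := _ ^+ m; set S := _ + _; set d := `|dotk _ _|; set T := `|w.1| + _ => P0 S0 dl.
  rewrite [leRHS](_ : _ = P * S * (wt (k n) * T)); last by ring.
  by rewrite mulrA ler_wpM2l // mulr_ge0.
Qed.

Lemma trigterm_le c n x : `|trigterm c n x| <= size_coef c n.
Proof.
apply: le_trans (ler_normD _ _) _; rewrite !normrM /size_coef.
by rewrite lerD // -[leRHS]mulr1 ler_wpM2l// ?cos_max ?sin_max.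
Qed.

Lemma cvg_trigser c x : summable_coef 0 c -> cvgn (series (fun n => trigterm c n x)).
Proof.
move=> sc; have [] // := @dominated_series _ (fun n => trigterm c n x)
  (fun n => wt (k n) ^+ 0 * size_coef c n).
by move=> n; rewrite expr0 mul1r trigterm_le.
Qed.

Lemma trigser_lipschitz c : summable_coef 1 c -> exists C, forall x w,
  `|trigser c (x + w) - trigser c x| <= C * (`|w.1| + `|w.2|).
Proof.
move=> sc; have sc0 := summable_coefS sc.
exists (sumr (fun n => wt (k n) ^+ 1 * size_coef c n)) => x w.
rewrite /trigser -sumr_sub; [|exact: cvg_trigser..].
rewrite mulrC -sumr_scale //; apply: (dominated_series _ _).2; last exact: cvg_seriesMl.
move=> n; rewrite expr1 /trigterm.
have E : dotk (k n) (x + w) = dotk (k n) x + dotk (k n) w by rewrite /dotk/=; ring.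
rewrite E; set y := dotk _ x; set t := dotk _ w.
have -> : forall a b, a * cos (y + t) + b * sin (y + t) - (a * cos y + b * sin y) =
   a * (cos (y + t) - cos y) + b * (sin (y + t) - sin y) :> R by move=> a b; ring.
apply: le_trans (ler_normD _ _) _; rewrite !normrM.
apply: (@le_trans _ _ (size_coef c n * `|t|)).
  by rewrite mulrDl lerD// ler_wpM2l// ?lipschitz_cos ?lipschitz_sin.
rewrite mulrA [leRHS]mulrC ler_wpM2l ?size_coef_ge0// mulrC; exact: dotk_le_wt.
Qed.

Lemma continuous_trigser c : summable_coef 1 c -> continuous (trigser c).
Proof. by move=> /trigser_lipschitz[C]; exact: lipschitz_continuous2. Qed.

(** The first-order Taylor remainder of each term is at most its size times $(h\,k\cdot w)^2$. The
    second power of the weight makes these remainders summable, so the whole remainder is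
    $O(h^2)$. *)
Lemma is_derive_trigser c x w : summable_coef 2 c ->
  is_derive x w (trigser c) (trigser (dcoef w c) x).
Proof.
move=> sc; have sc1 := summable_coefS sc; have sc0 := summable_coefS sc1.
have sd := summable_dcoef (w:=w) sc1.
pose W := `|w.1| + `|w.2|.
apply: (@is_derive_of_taylor _ _ _ _ _
  (W ^+ 2 * sumr (fun n => wt (k n) ^+ 2 * size_coef c n))) => h.
rewrite /trigser -sumr_scale; last exact: cvg_trigser.
rewrite -sumr_sub; [|exact: cvg_trigser..].
rewrite -sumr_sub; [|by apply: cvg_seriesB; exact: cvg_trigser|by apply: cvg_seriesMl; exact: cvg_trigser].
rewrite mulrAC -sumr_scale //; apply: (dominated_series _ _).2; last exact: cvg_seriesMl.
move=> n; rewrite /trigterm/= dotk_line; set y := dotk _ x; set t := dotk _ w.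
have -> : forall a b, a * cos (y + h * t) + b * sin (y + h * t) - (a * cos y + b * sin y) -
   h * (b * t * cos y + - a * t * sin y) =
   a * (cos (y + h * t) - cos y - (h * t) * - sin y) +
   b * (sin (y + h * t) - sin y - (h * t) * cos y) :> R by move=> a b; ring.
apply: le_trans (ler_normD _ _) _; rewrite !normrM.
apply: (@le_trans _ _ (size_coef c n * (h * t) ^+ 2)).
  by rewrite mulrDl lerD// ler_wpM2l// ?taylor1_cos ?taylor1_sin.
have B : t ^+ 2 <= wt (k n) ^+ 2 * W ^+ 2.
  rewrite -exprMn -[t ^+ 2]real_normK ?num_real// ler_sqr ?nnegrE ?mulr_ge0 ?wt_ge0 ?addr_ge0//.
  exact: dotk_le_wt.
rewrite [leRHS](_ : _ = size_coef c n * (h ^+ 2 * (wt (k n) ^+ 2 * W ^+ 2))); last by ring.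
by rewrite ler_wpM2l ?size_coef_ge0// exprMn ler_wpM2l ?sqr_ge0.
Qed.

Lemma periodic_trig l x : forall g : R -> R, (forall y, g (y + pi *+ 2) = g y) ->
  g (dotk l (x.1 + 2 * pi, x.2)) = g (dotk l x) /\
  g (dotk l (x.1, x.2 + 2 * pi)) = g (dotk l x).
Proof.
move=> g gP.
have gn n y : g (y + (pi *+ 2) *+ n) = g y by exact: (periodicn gP).
have gz (m : int) y : g (y + m%:~R * (2 * pi)) = g y.
  have -> : m%:~R * (2 * pi) = (pi *+ 2) *~ m :> R by rewrite mulrzl mulr_natl.
  case: m => m; first exact: gn.
  by rewrite NegzE mulrNz -pmulrn -[LHS](gn m.+1) subrK.
move: gz; set T := 2 * pi => gz.
rewrite /dotk/= !mulrDr; split; first by rewrite addrAC gz.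
by rewrite addrA gz.
Qed.

Lemma periodic_trigser c : periodic2 (trigser c).
Proof.
move=> x; rewrite /trigser /trigterm.
have cP y : cos (y + pi *+ 2) = cos y :> R by exact: cosD2pi.
have sP y : sin (y + pi *+ 2) = sin y :> R by exact: sinD2pi.
split; congr sumr; apply/funext => n.
  by rewrite (periodic_trig _ _ cP).1 (periodic_trig _ _ sP).1.
by rewrite (periodic_trig _ _ cP).2 (periodic_trig _ _ sP).2.
Qed.
End TrigSeries.

(** * Sobolev functions as trigonometric series *)

HB.instance Definition _ := isPointed.Build int 0.

Section Lattice.
Variable R : realType.

(** A discrete integral test for $\sum n^{-(1+e)}$ with a telescoping majorant. It follows from
    $1/y\le\ln y-\ln x$ for $y=x+1$, and from $\exp a\ge 1+a$. *)
Lemma powR_telescope (e : R) (n : nat) : 0 < e ->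
  e * n.+2%:R `^ (- (1 + e)) <= n.+1%:R `^ (- e) - n.+2%:R `^ (- e).
Proof.
move=> e0; set x : R := n.+1%:R; set y : R := n.+2%:R.
have x0 : 0 < x by rewrite ltr0Sn.
have y0 : 0 < y by rewrite ltr0Sn.
have yx : y = x + 1 by rewrite /x /y -[in LHS]natr1.
have lnxy : y^-1 <= ln y - ln x.
  have xyE : ln x - ln y = ln (1 + - y^-1).
    rewrite -ln_div ?posrE//; congr ln; have -> : x = y - 1 by rewrite yx addrK.
    by rewrite mulrBl divff ?gt_eqF// mul1r.
  rewrite -lerN2 opprB xyE; apply: le_ln1Dx.
  by rewrite ltrN2 invf_lt1// yx ltrDr.
have -> : y `^ (- (1 + e)) = y `^ (- e) * y^-1.
  rewrite opprD addrC powRD ?powR_inv1 ?ltW//.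
  by apply/implyP => _; rewrite gt_eqF.
have -> : x `^ (- e) = y `^ (- e) * expR (e * (ln y - ln x)).
  rewrite /powR !gt_eqF// -expRD; congr expR; ring.
have P0 : 0 < y `^ (- e) by exact: powR_gt0.
have := expR_ge1Dx (e * (ln y - ln x)).
have : e * y^-1 <= e * (ln y - ln x) by rewrite ler_wpM2l// ltW.
set E := expR _; set u := y^-1; set L := ln y - ln x; set P := y `^ _ in P0 *.
move=> h1 h2; have h3 : 0 <= E - 1 - e * u by lra.
by have := mulr_ge0 (ltW P0) h3; lra.
Qed.

Lemma nneseries_powR (q : R) : 1 < q ->
  (\sum_(n <oo) (n.+1%:R `^ (- q))%:E < +oo :> \bar R)%E.
Proof.
move=> q1; pose e := q - 1; have e0 : 0 < e by rewrite subr_gt0.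
have bnd n : \sum_(0 <= i < n) (i.+1%:R `^ (- q) : R) <= 1 + e^-1.
  case: n => [|n]; first by rewrite big_geq// addr_ge0// invr_ge0 ltW.
  apply: (@le_trans _ _ (1 + e^-1 * (1 - n.+1%:R `^ (- e)))); last first.
    by rewrite lerD2l -[leRHS]mulr1 ler_wpM2l ?invr_ge0 ?(ltW e0)// gerBl powR_ge0.
  elim: n => [|n IH]; first by rewrite big_nat1 !powR1 subrr mulr0 addr0.
  rewrite big_nat_recr//=; apply: le_trans (lerD IH (lexx _)) _.
  have := @powR_telescope e n e0; have -> : 1 + e = q by rewrite /e subrKC.
  rewrite -ler_pdivlMl //; set V := _ `^ (- q); set A := _ `^ (- e); set B := _ `^ (- e).
  by move=> h; lra.
apply: (@le_lt_trans _ _ (1 + e^-1)%:E); last exact: ltry.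
apply: lime_le; first by apply: is_cvg_nneseries => n _ _; rewrite lee_fin powR_ge0.
by apply: nearW => n; rewrite sumEFin lee_fin; exact: bnd.
Qed.

Lemma nat_bij (T : pointedType) : countable [set: T] -> infinite_set [set: T] ->
  exists e : nat -> T, set_bij setT setT e.
Proof.
move=> cT iT; have /card_esym : ([set: T] #= [set: nat])%card by exact: eq_card_nat.
by move=> /card_set_bijP.
Qed.

Lemma infinite_int : infinite_set [set: int].
Proof.
by apply/infiniteP/pcard_leTP/injPex; exists Posz => // m n _ _ [].
Qed.

Lemma infinite_int2 : infinite_set [set: int * int].
Proof. by rewrite -setXTT; apply: infinite_setX; exact: infinite_int. Qed.

Lemma nat_int2_bij : exists e : nat -> int * int, set_bij setT setT e.
Proof. by apply: (@nat_bij (int * int)%type); [exact: countableP|exact: infinite_int2]. Qed.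

(** A product of two such weights majorizes a negative power of $|k|^2$ up to a constant, and its
    lattice sum factors into one-dimensional sums. *)
Let A (q : R) (m : int) : R := (1 + `|m%:~R|) `^ (- q).

Lemma esum_int q : 1 < q -> (\esum_(m in [set: int]) (A q m)%:E < +oo)%E.
Proof.
move=> q1; have A0 m : (0 <= (A q m)%:E)%E by rewrite lee_fin powR_ge0.
rewrite (esumID (range Posz)) //; apply: lte_add_pinfty.
- rewrite setTI.
  rewrite (_ : range Posz = Posz @` [set n | xpredT n]); last first.
    by apply/seteqP; split => m [n _ <-]; exists n.
  rewrite (esum_pred_image (fun m => (A q m)%:E)) //; last by move=> m n _ _ [].
  apply: le_lt_trans (nneseries_powR q1); apply: lee_nneseries => [n *|n *]; first exact: A0.
  by rewrite lee_fin /A ger0_norm// -pmulrn nat1r.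
- rewrite setTI (_ : ~` range Posz = Negz @` [set n | xpredT n]); last first.
    apply/seteqP; split => [[n|n] /= h|_ [n _ <-] [m _]] //; last by exists n.
    by exfalso; apply: h; exists n.
  rewrite (esum_pred_image (fun m => (A q m)%:E)) //; last by move=> m n _ _ [].
  apply: le_lt_trans (nneseries_powR q1); apply: lee_nneseries => [n *|n *]; first exact: A0.
  rewrite lee_fin /A NegzE mulrNz normrN ger0_norm// -pmulrn nat1r.
  (* [Negz n] is $-(n+1)$, so the base is $n+2$ here; it is compared with $n+1$. *)
  rewrite !powRN lef_pV2 ?posrE ?powR_gt0// ge0_ler_powR ?nnegrE ?ler_nat//.
  by apply: le_trans (ltW q1).
Qed.

Lemma esum_int2 q : 1 < q ->
  (\esum_(k in [set: int * int]) (A q k.1 * A q k.2)%:E < +oo)%E.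
Proof.
move=> q1; have A0 m : 0 <= A q m by exact: powR_ge0.
have [e eb] : exists e : nat -> int, set_bij setT setT e.
  by apply: (@nat_bij int); [exact: countableP|exact: infinite_int].
have := esum_int q1; rewrite (reindex_esum setT _ e) // -nneseries_esumT; last first.
  by move=> n; rewrite lee_fin.
set S := (\sum_(i <oo) _)%E => Soo.
have S0 : (0 <= S)%E by apply: nneseries_ge0 => n _ _; rewrite lee_fin.
rewrite -setXTT (_ : [set: int] `*` [set: int] = [set: int] `*`` (fun=> [set: int])); last first.
  by apply/seteqP; split.
rewrite -(@esum_esum _ _ _ setT (fun=> setT) (fun i j => (A q i * A q j)%:E)); last first.
  by move=> i j _ _; rewrite lee_fin mulr_ge0.
rewrite (eq_esum (b := fun i => (A q i)%:E * S)%E); last first.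
  move=> i _; rewrite (reindex_esum setT _ e) // -nneseries_esumT; last first.
    by move=> n; rewrite lee_fin mulr_ge0.
  rewrite /S -nneseriesZl; last by move=> n _; rewrite lee_fin.
  by apply: eq_eseriesr.
rewrite (reindex_esum setT _ e) // -nneseries_esumT; last first.
  by move=> n; rewrite mule_ge0 // lee_fin.
rewrite -[S]fineK; last by rewrite ge0_fin_numE.
under eq_eseriesr do rewrite muleC.
rewrite nneseriesZl; last by move=> n _; rewrite lee_fin.
by rewrite lte_mul_pinfty// lee_fin fine_ge0.
Qed.

Lemma esum_series (W : int * int -> R) (e : nat -> int * int) :
  set_bij setT setT e -> (forall k, 0 <= W k) ->
  (\esum_(k in [set: int * int]) (W k)%:E < +oo)%E -> cvgn (series (W \o e)).
Proof.
move=> eb W0; rewrite (reindex_esum setT _ e) // -nneseries_esumT; last first.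
  by move=> n; rewrite lee_fin.
by move=> h; apply: nnseries_is_cvg => // n; exact: W0.
Qed.

Lemma normk2_ge1 (k : int * int) : k != 0 -> 1 <= normk2 R k.
Proof.
move=> k0; rewrite /normk2 -!rmorphXn -rmorphD ler1z -gtz0_ge1.
rewrite lt_neqAle addr_ge0 ?sqr_ge0// andbT eq_sym paddr_eq0 ?sqr_ge0// !sqrf_eq0.
by apply: contra k0 => /andP[/eqP a /eqP b]; case: k a b => ? ? /= -> ->.
Qed.

Lemma abs_le_sqr_int (m : int) : `|m%:~R| <= m%:~R ^+ 2 :> R.
Proof.
rewrite -intr_norm -rmorphXn ler_int -[m ^+ 2]real_normK ?num_real// expr2.
have [->|m0] := eqVneq m 0; first by rewrite normr0.
by rewrite ler_peMr// -gtz0_ge1 normr_gt0.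
Qed.

Lemma wt_sqr_le (k : int * int) : k != 0 -> wt R k ^+ 2 <= 6 * normk2 R k.
Proof.
move=> k0; have := normk2_ge1 k0; rewrite /wt /normk2.
have := abs_le_sqr_int k.1; have := abs_le_sqr_int k.2.
set a := _%:~R; set b := _%:~R.
rewrite -[a ^+ 2]real_normK ?num_real// -[b ^+ 2]real_normK ?num_real//.
set x := `|a|; set y := `|b| => h1 h2 h3.
have := sqr_ge0 (x - y); have := sqr_ge0 (1 - x); have := sqr_ge0 (1 - y); nra.
Qed.

Lemma prod_le_normk2 (k : int * int) : k != 0 ->
  (1 + `|k.1%:~R|) * (1 + `|k.2%:~R|) <= 3 * normk2 R k.
Proof.
move=> k0; have := normk2_ge1 k0; rewrite /normk2.
have := abs_le_sqr_int k.1; have := abs_le_sqr_int k.2.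
set a := _%:~R; set b := _%:~R.
rewrite -[a ^+ 2]real_normK ?num_real// -[b ^+ 2]real_normK ?num_real//.
set x := `|a|; set y := `|b| => h1 h2 h3; have := sqr_ge0 (x - y); nra.
Qed.

(** With $P=|k|^{2s}$, the inequality between means trades $w^3|c|$ for $Pc^2+w^6/(2P)$, and $w^6/P$
    is at most a constant times $(|k|^2)^{3-s}$. The product majorant with exponent $s-3$ is
    summable once $s-3>1$. *)
Lemma wt_summand_le (s : R) (k : int * int) (a b : R) : 3 < s -> k != 0 ->
  wt R k ^+ 3 * (`|a| + `|b|) <= normk2 R k `^ s * (a ^+ 2 + b ^+ 2) +
    6 ^+ 3 * 3 `^ (s - 3) * (A (s - 3) k.1 * A (s - 3) k.2).
Proof.
move=> s3 k0; have N1 := normk2_ge1 k0; have N0 := lt_le_trans ltr01 N1.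
set N := normk2 R k in N1 N0 *; set w := wt R k.
pose P := N `^ s; have P0 : 0 < P by exact: powR_gt0.
have AG (c : R) : w ^+ 3 * `|c| <= P * c ^+ 2 + w ^+ 6 / P / 2.
  have -> : c ^+ 2 = `|c| ^+ 2 by rewrite real_normK ?num_real.
  set x := `|c|; set u := w ^+ 3.
  have -> : w ^+ 6 = u ^+ 2 by rewrite /u -exprM.
  have := sqr_ge0 (P * x - u / 2) => h.
  (* The square alone would give $u^2/(4P)$; the added quarter makes it $u^2/(2P)$, so that the
     estimates for [a] and [b] add up to exactly $w^6/P$. *)
  have : 0 <= (P * x - u / 2) ^+ 2 / P + u ^+ 2 / P / 4.
    by rewrite addr_ge0// divr_ge0 ?divr_ge0 ?sqr_ge0// ltW.
  rewrite (_ : _ + _ = P * x ^+ 2 + u ^+ 2 / P / 2 - u * x); first by rewrite subr_ge0.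
  by field; rewrite gt_eqF.
have W6 : w ^+ 6 / P <= 6 ^+ 3 * N `^ (- (s - 3)).
  have -> : N `^ (- (s - 3)) = N ^+ 3 / P.
    rewrite opprB powRB; last by apply/implyP => _; rewrite gt_eqF.
    by rewrite powR_mulrn ?ltW.
  rewrite mulrA ler_wpM2r ?invr_ge0 ?(ltW P0)//.
  have := wt_sqr_le k0; rewrite -/w -/N => h.
  rewrite (_ : w ^+ 6 = (w ^+ 2) ^+ 3); last by rewrite -exprM.
  rewrite -exprMn lerXn2r ?nnegrE ?sqr_ge0 ?mulr_ge0 ?(ltW N0)//.
have NA : N `^ (- (s - 3)) <= 3 `^ (s - 3) * (A (s - 3) k.1 * A (s - 3) k.2).
  have p0 : 0 < (1 + `|k.1%:~R|) * (1 + `|k.2%:~R|) :> R by rewrite mulr_gt0 ?ltr_pwDl.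
  rewrite /A -powRM ?addr_ge0// !powRN -ler_pdivrMl ?powR_gt0//.
  rewrite -invfM -powRM ?(ltW N0)// lef_pV2 ?posrE ?powR_gt0 ?mulr_gt0//.
  rewrite ge0_ler_powR ?nnegrE ?subr_ge0 ?(ltW p0) ?(ltW s3) ?mulr_ge0 ?(ltW N0)//.
  exact: prod_le_normk2.
have := AG a; have := AG b; rewrite -/P mulrDr [P * (_ + _)]mulrDr.
have : 6 ^+ 3 * N `^ (- (s - 3)) <=
  6 ^+ 3 * (3 `^ (s - 3) * (A (s - 3) k.1 * A (s - 3) k.2)).
  by rewrite ler_wpM2l.
set z2 := 6 ^+ 3 * (_ * _); set z1 := 6 ^+ 3 * N `^ _ => h1 h2 h3.
rewrite -[6 ^+ 3 * _ * _]mulrA -/z2.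
move: W6 h2 h3; rewrite -/z1; set z3 := w ^+ 6 / P => h4 h2 h3.
lra.
Qed.
End Lattice.

(** * Sobolev functions are sums of their Fourier series *)

Section Identification.
Variable R : realType.
Local Notation plane := (measurableTypeR R * measurableTypeR R)%type.
Local Notation tintegral f := (\int[mu2 R]_(x in @fund R) f x)%R.

(** The real part and minus the imaginary part of [fourier f k]. Since $k$ and $-k$ both occur in
    the series, the factor 2 of real Fourier series is absent. *)
Definition coef (f : R * R -> R) (k : int * int) : R * R :=
  ((2 * pi) ^- 2 * tintegral (fun x => f x * cos (dotk k x)),
   (2 * pi) ^- 2 * tintegral (fun x => f x * sin (dotk k x))).

Lemma RintegralN f : (mu2 R).-integrable (@fund R) (EFin \o f) ->
  tintegral (fun x => - f x) = - tintegral f.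
Proof.
move=> intf; rewrite -mulN1r -RintegralZl//; last exact: measurable_fund.
by apply: eq_Rintegral => x _; rewrite mulN1r.
Qed.

Lemma coefN f k : (mu2 R).-integrable (@fund R) (EFin \o f) ->
  coef f (- k) = ((coef f k).1, - (coef f k).2).
Proof.
move=> intf; rewrite /coef; congr pair.
  by congr (_ * _); apply: eq_Rintegral => x _; rewrite dotkN cosN.
rewrite -mulrN; congr (_ * _); rewrite -RintegralN; last first.
  by apply: integrable2M => //; exact: continuous_sink.
by apply: eq_Rintegral => x _; rewrite dotkN sinN mulrN.
Qed.

Lemma re_norm_fourier f k : (mu2 R).-integrable (@fund R) (EFin \o f) ->
  (complex.Re `|fourier f k|) ^+ 2 = (coef f k).1 ^+ 2 + (coef f k).2 ^+ 2.
Proof.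
move=> intf; have E : fourier f k = ((coef f k).1 +i* - (coef f k).2)%C.
  rewrite /fourier /inner /tint /coef /=; set T := 2 * pi.
  have -> : tintegral (re_part (fun x => (f x)%:C%C * ek (- k) x)) =
      tintegral (fun x => f x * cos (dotk k x)).
    by apply: eq_Rintegral => x _; rewrite /re_part/= dotkN cosN mul0r subr0.
  have -> : tintegral (im_part (fun x => (f x)%:C%C * ek (- k) x)) =
      - tintegral (fun x => f x * sin (dotk k x)).
    rewrite -RintegralN; last by apply: integrable2M => //; exact: continuous_sink.
    by apply: eq_Rintegral => x _; rewrite /im_part/= dotkN sinN mul0r addr0 mulrN.
  by apply/eqP; rewrite eq_complex/= !mul0r subr0 addr0 mulrN !eqxx.
rewrite E normc_def /= sqr_sqrtr ?addr_ge0 ?sqr_ge0// sqrrN //.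
Qed.

Lemma integrable_cst2 (r : R) : (mu2 R).-integrable (@fund R) (EFin \o (fun=> r)).
Proof. by apply: continuous_integrable2; exact: cst_continuous. Qed.

Lemma L2_integrable (f : R * R -> R) : L2 f -> (mu2 R).-integrable (@fund R) (EFin \o f).
Proof.
move=> [_ mf f2].
have h : (mu2 R).-integrable (@fund R) (fun x => (1 + (f x) ^+ 2)%:E).
  have := integrableD (@measurable_fund R) (integrable_cst2 1) f2.
  by apply: eq_integrable => //; exact: measurable_fund.
apply: le_integrable h => //; first exact: measurable_fund.
  by apply/measurable_EFinP; exact: measurable_funTS mf.
move=> x _ /=; rewrite lee_fin [leRHS]ger0_norm ?addr_ge0 ?sqr_ge0//.
have := real_normK (num_real (f x)); have := normr_ge0 (f x).
by set y := `|f x| => y0 <-; have := sqr_ge0 (y - 1); nra.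
Qed.

Lemma coef0 s f : Hs s f -> coef f 0 = (0, 0).
Proof.
move=> [_ f0 _]; rewrite /coef; congr pair.
  under eq_Rintegral do rewrite dotk0 cos0 mulr1.
  by rewrite f0 mulr0.
under eq_Rintegral do rewrite dotk0 sin0 mulr0.
by rewrite Rintegral_cst ?mul0r ?mulr0//; exact: measurable_fund.
Qed.

Lemma Hs_summable s f (e : nat -> int * int) : 4 < s -> Hs s f ->
  set_bij setT setT e -> summable_coef e 3 (fun n => coef f (e n)).
Proof.
move=> s4 hf eb; have f0 := coef0 hf; have [fL _ fs] := hf.
have intf := L2_integrable fL.
pose W1 (k : int * int) : R := if k != 0 then
  normk2 R k `^ s * ((coef f k).1 ^+ 2 + (coef f k).2 ^+ 2) else 0.
have W1_ge0 k : 0 <= W1 k.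
  by rewrite /W1; case: ifP => // _; rewrite mulr_ge0 ?powR_ge0 ?addr_ge0 ?sqr_ge0.
have c1 : cvgn (series (W1 \o e)).
  apply: esum_series => //; rewrite (le_lt_trans _ fs)// [leRHS]esum_mkcond.
  apply: le_esum => k _; rewrite /W1; case: ifPn => k0.
    by rewrite re_norm_fourier // mem_set.
  by rewrite memNset //; exact/negP.
have s31 : 1 < s - 3 by lra.
pose W2 (k : int * int) : R :=
  (1 + `|k.1%:~R|) `^ (- (s - 3)) * (1 + `|k.2%:~R|) `^ (- (s - 3)).
have W2_ge0 k : 0 <= W2 k by rewrite mulr_ge0 ?powR_ge0.
have c2 := cvg_seriesMl (c := 6 ^+ 3 * 3 `^ (s - 3))
  (esum_series eb W2_ge0 (esum_int2 s31)).
have c3 := is_cvg_seriesD c1 c2.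
apply: series_le_cvg c3 => n.
- by rewrite mulr_ge0 ?size_coef_ge0// exprn_ge0 ?wt_ge0.
- apply: addr_ge0; first exact: W1_ge0.
  by rewrite /= mulr_ge0 ?mulr_ge0 ?powR_ge0.
(* The Sobolev sum does not control the frequency 0; there the coefficient vanishes because [f] has
   mean zero. *)
- have [en0|en0] := eqVneq (e n) 0.
    rewrite en0 /size_coef en0 f0/= normr0 addr0 mulr0 addr_ge0 //; first exact: W1_ge0.
    by rewrite /= mulr_ge0 ?mulr_ge0 ?powR_ge0.
  have := @wt_summand_le R s (e n) (coef f (e n)).1 (coef f (e n)).2 _ en0.
  have -> : 3 < s by lra.
  move=> /(_ isT) /le_trans; apply.
  by rewrite lerD //= /W1 en0.
Qed.

Lemma integral_trig0 k : k != 0 ->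
  tintegral (fun x => cos (dotk k x)) = 0 /\ tintegral (fun x => sin (dotk k x)) = 0.
Proof.
move=> k0; have [j kj] : exists j : bool, dotk k (dir R j) != 0.
  have [k1|k1] := eqVneq k.1 0.
    exists false; rewrite /dotk/= mulr0 add0r mulr1 intr_eq0.
    by apply: contra k0 => /eqP k2; case: k k1 k2 => ? ? /= -> ->.
  by exists true; rewrite /dotk/= mulr0 addr0 mulr1 intr_eq0.
set d := dotk k (dir R j) in kj.
have per (g : R -> R) : (forall y, g (y + pi *+ 2) = g y) ->
    periodic2 (fun x => d^-1 * g (dotk k x)).
  by move=> gP x; have [h1 h2] := periodic_trig k x gP; rewrite h1 h2.
have line (g dg : R -> R) : (forall y : R, is_derive y 1 g (dg y)) ->
    forall x, is_derive x (dir R j) (fun x => d^-1 * g (dotk k x)) (dg (dotk k x)).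
  move=> gP x; rewrite -[x in is_derive x](addr0 x) -(scale0r (dir R j)).
  apply/is_derive_line; under eq_fun do rewrite dotk_line -/d.
  have h : is_derive (0 : R) 1 (fun t : R => dotk k x + t * d) d.
    by apply: is_derive_eq; rewrite add0r mul1r scaler0 add0r /GRing.scale/= mulr1.
  have gx : is_derive (dotk k x + 0 * d) 1 g (dg (dotk k x)) by rewrite mul0r addr0.
  have := is_deriveZ d^-1 (@is_derive1_comp _ g (fun t : R => dotk k x + t * d) _ _ _ gx h).
  by rewrite /GRing.scale/= mulrCA mulVf // mulr1.
split.
- apply: (@integral_dir _ j (fun x => d^-1 * sin (dotk k x))).
  + exact: continuous_cosk.
  + by apply: per; exact: sinD2pi.
- suff : tintegral (fun x => - sin (dotk k x)) = 0.
    rewrite RintegralN; last by apply: continuous_integrable2; exact: continuous_sink.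
    by move/eqP; rewrite oppr_eq0 => /eqP.
  apply: (@integral_dir _ j (fun x => d^-1 * cos (dotk k x))).
  + by move=> x; apply: cvgN; exact: continuous_sink.
  + by apply: per; exact: cosD2pi.
  + exact: (line _ _ (@is_derive_cos R)).
Qed.

Lemma integral_cosk k : tintegral (fun x => cos (dotk k x)) = (2 * pi) ^+ 2 * (k == 0)%:R.
Proof.
have [->|k0] := eqVneq k 0; last by rewrite (integral_trig0 k0).1 mulr0.
under eq_Rintegral do rewrite dotk0 cos0.
by rewrite Rintegral_cst ?mul1r ?mulr1 ?mu2_fund//; exact: measurable_fund.
Qed.

Lemma integral_sink k : tintegral (fun x => sin (dotk k x)) = 0.
Proof.
have [->|k0] := eqVneq k 0; last by rewrite (integral_trig0 k0).2.
under eq_Rintegral do rewrite dotk0 sin0.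
by rewrite Rintegral_cst ?mul0r//; exact: measurable_fund.
Qed.

Lemma integral_lincomb (a b : R) (f g : R * R -> R) : continuous f -> continuous g ->
  tintegral (fun x => a * f x + b * g x) = a * tintegral f + b * tintegral g.
Proof.
move=> cf cg; have mf := @measurable_fund R.
have cZ (c : R) (h : R * R -> R) : continuous h -> continuous (fun x => c * h x).
  by move=> ch x; apply: cvgM; [exact: cvg_cst|exact: ch].
rewrite RintegralD//; last 2 first.
- by apply: continuous_integrable2; exact: cZ.
- by apply: continuous_integrable2; exact: cZ.
by rewrite !RintegralZl//; apply: continuous_integrable2.
Qed.

Lemma continuous_trigterm (e : nat -> int * int) c n : continuous (@trigterm R e c n).
Proof.
apply: continuous_trigpoly; apply: trigpolyD; apply: trigpolyZ.
  exact: trigpoly_cos.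
exact: trigpoly_sin.
Qed.

(** The frequencies $l$ and $-l$ both correlate with $\cos(l\cdot x)$, each with weight one half.
    For $l=0$ the two indicators coincide and add up to the right value, so no case distinction is
    needed. *)
Lemma integral_trigterm_cos (e : nat -> int * int) c n l :
  tintegral (fun x => trigterm e c n x * cos (dotk l x)) =
  (2 * pi) ^+ 2 / 2 * ((c n).1 * (e n == l)%:R + (c n).1 * (e n == - l)%:R).
Proof.
transitivity (tintegral (fun x => 1 * ((c n).1 / 2 * cos (dotk (e n - l) x) +
   (c n).1 / 2 * cos (dotk (e n + l) x)) + 1 * ((c n).2 / 2 * sin (dotk (e n - l) x) +
   (c n).2 / 2 * sin (dotk (e n + l) x)))).
  by apply: eq_Rintegral => x _; rewrite /trigterm !dotkD !dotkN cosB cosD sinB sinD; field.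
rewrite integral_lincomb; last 2 first.
- by apply: continuous_trigpoly; do ![apply: trigpolyD|apply: trigpolyZ|apply: trigpoly_cos].
- by apply: continuous_trigpoly; do ![apply: trigpolyD|apply: trigpolyZ|apply: trigpoly_sin].
rewrite !integral_lincomb; try exact: continuous_cosk; try exact: continuous_sink.
rewrite !integral_cosk !integral_sink subr_eq0 addr_eq0; set T := 2 * pi.
by field.
Qed.

Lemma integral_trigterm_sin (e : nat -> int * int) c n l :
  tintegral (fun x => trigterm e c n x * sin (dotk l x)) =
  (2 * pi) ^+ 2 / 2 * ((c n).2 * (e n == l)%:R + -1 * ((c n).2 * (e n == - l)%:R)).
Proof.
transitivity (tintegral (fun x => 1 * ((c n).2 / 2 * cos (dotk (e n - l) x) +
   - (c n).2 / 2 * cos (dotk (e n + l) x)) + 1 * ((c n).1 / 2 * sin (dotk (e n + l) x) +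
   - (c n).1 / 2 * sin (dotk (e n - l) x)))).
  by apply: eq_Rintegral => x _; rewrite /trigterm !dotkD !dotkN cosB cosD sinB sinD; field.
rewrite integral_lincomb; last 2 first.
- by apply: continuous_trigpoly; do ![apply: trigpolyD|apply: trigpolyZ|apply: trigpoly_cos].
- by apply: continuous_trigpoly; do ![apply: trigpolyD|apply: trigpolyZ|apply: trigpoly_sin].
rewrite !integral_lincomb; try exact: continuous_cosk; try exact: continuous_sink.
rewrite !integral_cosk !integral_sink subr_eq0 addr_eq0; set T := 2 * pi.
by field.
Qed.

Lemma series_delta (e : nat -> int * int) (g : nat -> R) n :
  set_bij setT setT e -> series (fun i => g i * (e i == e n)%:R) @ \oo --> g n.
Proof.
move=> [_ ei _]; apply: cvg_near_cst; exists n.+1 => // m /= nm.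
rewrite /series/= (bigD1_seq n) ?iota_uniq ?mem_iota ?subn0//= eqxx mulr1.
rewrite big1 ?addr0// => i /negP inn; case: eqP => [E|]; last by rewrite mulr0.
by exfalso; apply: inn; apply/eqP; apply: ei => //; rewrite in_setT.
Qed.

Lemma integral_sum (u : nat -> R * R -> R) N : (forall n, continuous (u n)) ->
  continuous (fun x => \sum_(0 <= n < N) u n x) /\
  tintegral (fun x => \sum_(0 <= n < N) u n x) = \sum_(0 <= n < N) tintegral (u n).
Proof.
move=> cu; elim: N => [|N [IH1 IH2]].
  under eq_fun do rewrite big_geq//; rewrite big_geq //; split; first exact: cst_continuous.
  by rewrite Rintegral_cst ?mul0r//; exact: measurable_fund.
under eq_fun do rewrite big_nat_recr//=; rewrite big_nat_recr//=; split.
  by move=> x; apply: cvgD; [exact: IH1|exact: cu].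
rewrite -IH2 RintegralD//; first exact: measurable_fund.
  exact: continuous_integrable2.
exact: continuous_integrable2.
Qed.

Lemma integral_trigser (e : nat -> int * int) c (g : R * R -> R) : summable_coef e 0 c -> continuous g ->
  series (fun n => tintegral (fun x => trigterm e c n x * g x)) @ \oo -->
  tintegral (fun x => trigser e c x * g x).
Proof.
move=> sc cg; have mf := @measurable_fund R.
have ct n : continuous (fun x => trigterm e c n x * g x).
  by move=> x; apply: cvgM; [exact: continuous_trigterm|exact: cg].
have sc' : cvgn (series (size_coef c)).
  by move: sc; rewrite /summable_coef; under eq_fun do rewrite expr0 mul1r.
pose F N x := \sum_(0 <= n < N) (trigterm e c n x * g x).
have cF N : continuous (F N).
  exact: (integral_sum N ct).1.
have [M M0 gM] : exists2 M, 0 <= M & forall x, @fund R x -> `|g x| <= M.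
  have [M [Mr h]] :=
    compact_bounded (continuous_compact (continuous_subspaceT cg) (@compact_fund R)).
  exists (`|M| + 1) => [|x fx]; first exact: addr_ge0.
  by apply: (h (`|M| + 1)); [rewrite ltr_pwDr// ler_norm|exists x].
have FE N x : F N x = series (fun n => trigterm e c n x) N * g x by rewrite /F mulr_suml.
have cv x : (F^~ x) @ \oo --> trigser e c x * g x.
  under eq_fun do rewrite FE.
  by apply: cvgM; [exact: cvg_trigser|exact: cvg_cst].
have bd N x : @fund R x -> `|F N x| <= sumr (size_coef c) * M.
  move=> fx; rewrite FE normrM ler_pM// ?gM//.
  apply: (@le_trans _ _ (series (size_coef c) N)).
    by apply: le_trans (ler_norm_sum _ _ _) _; apply: ler_sum => n _; exact: trigterm_le.
  apply: nondecreasing_cvgn_le => //; apply: nondecreasing_series => n _ _.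
  exact: size_coef_ge0.
have mF N : measurable_fun (@fund R : set plane) (EFin \o F N).
  by apply/measurable_EFinP; exact: measurable_funTS (continuous_measurable2 (cF N)).
have cv' : {ae mu2 R, forall x, @fund R x -> (EFin \o F n) x @[n --> \oo] --> (trigser e c x * g x)%:E}.
  by apply: aeW => x _; apply: cvg_EFin; [exact: nearW|exact: cv].
have bd' : {ae mu2 R, forall x n, @fund R x -> (`|(EFin \o F n) x| <= (sumr (size_coef c) * M)%:E)%E}.
  by apply: aeW => x n fx; rewrite lee_fin; exact: bd.
have mS : measurable_fun (@fund R : set plane) (fun x => (trigser e c x * g x)%:E).
  apply: (emeasurable_fun_cvg _ _ mF) => x _.
  by apply: cvg_EFin; [exact: nearW|exact: cv].
have [iS _ ] := dominated_convergence mf mF mS cv' (integrable_cst2 _) bd'.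
rewrite -[X in _ --> X](fineK (integrable_fin_num mf iS)) => /fine_cvgP[_] H.
apply: cvg_trans H; apply: near_eq_cvg; apply: nearW => N /=.
exact: (integral_sum N ct).2.
Qed.

(** Termwise integration gives the series the same Fourier coefficients as [f]; uniqueness then
    applies to the difference. *)
Theorem trigser_coef f (e : nat -> int * int) :
  (mu2 R).-integrable (@fund R) (EFin \o f) -> set_bij setT setT e ->
  summable_coef e 1 (fun n => coef f (e n)) ->
  ae_eq (mu2 R) (@fund R) f (trigser e (fun n => coef f (e n))).
Proof.
move=> intf eb sc1; have sc0 := summable_coefS sc1.
set c := (fun n => _) in sc1 sc0 *.
have mf := @measurable_fund R.
have iS : (mu2 R).-integrable (@fund R) (EFin \o trigser e c).
  by apply: continuous_integrable2; exact: continuous_trigser.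
have iD : (mu2 R).-integrable (@fund R) (EFin \o (fun x => f x - trigser e c x)).
  have := integrableB mf intf iS.
  by apply: eq_integrable => // x _ /=; rewrite EFinB.
have T0 : (2 * pi) ^+ 2 != 0 :> R by rewrite sqrf_eq0 gt_eqF// pi2_gt0.
have onto l : exists n, e n = l by have [_ _ /(_ l I)[n _ <-]] := eb; exists n.
have mulB (g : R * R -> R) : continuous g ->
  tintegral (fun x => (f x - trigser e c x) * g x) =
  tintegral (fun x => f x * g x) - tintegral (fun x => trigser e c x * g x).
  move=> cg; rewrite -RintegralB//; [|exact: integrable2M..].
  by apply: eq_Rintegral => x _; rewrite mulrBl.
have scal (u : nat -> R) (l a : R) : series u @ \oo --> l ->
    series (fun n => a * u n) @ \oo --> a * l.
  move=> h; have -> : series (fun n => a * u n) = (fun N => a * series u N).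
    by apply/funext => N; rewrite /series/= mulr_sumr.
  by apply: cvgM; [exact: cvg_cst|].
have addc (u v : nat -> R) (l m : R) : series u @ \oo --> l -> series v @ \oo --> m ->
    series (fun n => u n + v n) @ \oo --> l + m.
  move=> h1 h2; have -> : series (fun n => u n + v n) = series u + series v.
    by apply/funext => N; rewrite /series/= big_split.
  exact: cvgD.
have C (l : int * int) : tintegral (fun x => f x * cos (dotk l x)) =
      (2 * pi) ^+ 2 * (coef f l).1 /\
    tintegral (fun x => f x * sin (dotk l x)) = (2 * pi) ^+ 2 * (coef f l).2.
  by rewrite /coef; split; rewrite mulVKf.
have H : ae_eq (mu2 R) (@fund R) (fun x => f x - trigser e c x) (fun=> 0).
  apply: fourier_uniqueness iD _ _ => l.
  - rewrite mulB; last exact: continuous_cosk.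
    have := integral_trigser sc0 (@continuous_cosk R l).
    under eq_fun do rewrite integral_trigterm_cos.
    have [n1 n1E] := onto l; have [n2 n2E] := onto (- l).
    have := scal _ _ ((2 * pi) ^+ 2 / 2) (addc _ _ _ _
      (series_delta (g := fun n => (c n).1) (n := n1) eb) (series_delta (g := fun n => (c n).1) (n := n2) eb)).
    rewrite n1E n2E => h1 h2; rewrite -(cvg_unique (@Rhausdorff R) h1 h2).
    (* The index of $-l$ supplies the other half of the coefficient, by parity. *)
    have -> : (c n2).1 = (c n1).1 by rewrite /c n1E n2E coefN.
    by rewrite (C l).1 /c n1E; move: (coef f l).1 T0; move: (2 * pi) => T a T0; field.
  - rewrite mulB; last exact: continuous_sink.
    have := integral_trigser sc0 (@continuous_sink R l).
    under eq_fun do rewrite integral_trigterm_sin.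
    have [n1 n1E] := onto l; have [n2 n2E] := onto (- l).
    have := scal _ _ ((2 * pi) ^+ 2 / 2) (addc _ _ _ _
      (series_delta (g := fun n => (c n).2) (n := n1) eb)
      (scal _ _ (-1) (series_delta (g := fun n => (c n).2) (n := n2) eb))).
    rewrite n1E n2E => h1 h2; rewrite -(cvg_unique (@Rhausdorff R) h1 h2).
    have -> : (c n2).2 = - (c n1).2 by rewrite /c n1E n2E coefN.
    by rewrite (C l).2 /c n1E; move: (coef f l).2 T0; move: (2 * pi) => T a T0; field.
by apply: filterS H => x h /h /eqP; rewrite subr_eq0 => /eqP.
Qed.
End Identification.

(** * Translation invariance and continuous representatives *)

Section Translation.
Variable R : realType.
Local Notation plane := (measurableTypeR R * measurableTypeR R)%type.
Local Notation line := (measurableTypeR R).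

Definition shift1 (c : R) (x : line) : line := x + c.

Lemma measurable_shift1 c : measurable_fun setT (shift1 c).
Proof. by apply: continuous_measurable_fun => x; apply: cvgD; [exact: cvg_id|exact: cvg_cst]. Qed.

HB.instance Definition _ c :=
  isMeasurableFun.Build _ _ _ _ (shift1 c) (measurable_shift1 c).

(** The pushforward under a shift is a measure that gives half-open intervals their length, and
    Lebesgue measure is the only one. *)
Lemma lebesgue_shift1 c (A : set line) : measurable A ->
  lebesgue_measure (shift1 c @^-1` A) = lebesgue_measure A.
Proof.
move=> mA; apply/esym.
apply: (@lebesgue_measure_unique R (pushforward lebesgue_measure (shift1 c))) => // X [[a b] _ <-].
rewrite -[RHS]/(lebesgue_measure (shift1 c @^-1` [set` `]a, b]])).
have -> : shift1 c @^-1` [set` `]a, b]] = [set` `]a - c, b - c]].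
  by apply/seteqP; split => x /=; rewrite !in_itv/= /shift1 ltrBlDr lerBrDr.
rewrite !lebesgue_measure_itv/= !lte_fin ltrD2r; case: ifP => // _.
by rewrite -!EFinB; congr EFin; ring.
Qed.

Definition shift2 (c : R * R) (x : plane) : plane := (shift1 c.1 x.1, shift1 c.2 x.2).

Lemma measurable_shift2 c : measurable_fun setT (shift2 c).
Proof.
apply: measurable_fun_pair.
  by apply: measurableT_comp => //; exact: measurable_shift1.
by apply: measurableT_comp => //; exact: measurable_shift1.
Qed.

HB.instance Definition _ c :=
  isMeasurableFun.Build _ _ _ _ (shift2 c) (measurable_shift2 c).

Lemma mu2_shift2 c (A : set plane) : measurable A -> mu2 R (shift2 c @^-1` A) = mu2 R A.
Proof.
move=> mA; apply/esym.
apply: (@product_measure_unique _ _ _ _ _ lebesgue_measure lebesgue_measure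
  (pushforward (mu2 R) (shift2 c))) => // B C mB mC.
rewrite -[LHS]/(mu2 R ((shift1 c.1 @^-1` B) `*` (shift1 c.2 @^-1` C))).
rewrite mu2X ?lebesgue_shift1//.
  by rewrite -[X in measurable X]setTI; exact: measurable_shift1.
by rewrite -[X in measurable X]setTI; exact: measurable_shift1.
Qed.

Lemma periodic2_int T (f : R * R -> T) (x : R * R) (m n : int) : periodic2 f ->
  f (x.1 + m%:~R * (2 * pi), x.2 + n%:~R * (2 * pi)) = f x.
Proof.
move=> pf; move: pf; rewrite /periodic2; set P := 2 * pi => pf.
have nat1 k y z : f (y + k%:R * P, z) = f (y, z).
  elim: k => [|k IH]; first by rewrite mul0r addr0.
  by rewrite -natr1 mulrDl mul1r addrA (pf (_, _)).1.
have nat2 k y z : f (y, z + k%:R * P) = f (y, z).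
  elim: k => [|k IH]; first by rewrite mul0r addr0.
  by rewrite -natr1 mulrDl mul1r addrA (pf (_, _)).2.
have int1 k y z : f (y + k%:~R * P, z) = f (y, z).
  case: k => k; first exact: nat1.
  by rewrite NegzE mulrNz mulNr -(nat1 k.+1) subrK.
have int2 k y z : f (y, z + k%:~R * P) = f (y, z).
  case: k => k; first exact: nat2.
  by rewrite NegzE mulrNz mulNr -(nat2 k.+1) subrK.
by rewrite int1 int2 -surjective_pairing.
Qed.

(** Countably many lattice translates of a null set in the fundamental domain cover the exceptional
    set in the plane. *)
Lemma periodic_ae0 (f : R * R -> R) : periodic2 f ->
  ae_eq (mu2 R) (@fund R) f (fun=> 0) -> {ae mu2 R, forall x, f x = 0}.
Proof.
move=> pf [N [mN N0 sub]].
pose F i : set plane := if unpickle i is Some k then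
  shift2 ((k : int * int).1%:~R * (2 * pi), k.2%:~R * (2 * pi)) @^-1` N else set0.
have mF i : measurable (F i) /\ mu2 R (F i) = 0%E.
  rewrite /F; case: unpickle => [k|]; last by split; [exact: measurable0|exact: measure0].
  split; last by rewrite mu2_shift2.
  by rewrite -[X in measurable X]setTI; exact: measurable_shift2.
have : (mu2 R).-negligible (\bigcup_i F i).
  by apply: negligible_bigcup => i; exists (F i); have [? ?] := mF i; split.
apply: negligibleS => x /= fx.
(* The number of periods by which [y] must be moved to land in $[0,2\pi]$. *)
pose m (y : R) : int := - Num.floor (y / (2 * pi)).
have my (y : R) : 0 <= y + (m y)%:~R * (2 * pi) <= 2 * pi.
  have T0 := pi2_gt0 R; rewrite /m; move: (2 * pi) T0 => T T0.
  have h1 := floor_le_tmp (y / T); have h2 := floorD1_gt (y / T).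
  rewrite ler_pdivlMr // in h1; rewrite ltr_pdivrMr // intrD mulrDl mul1r in h2.
  by rewrite mulrNz mulNr; apply/andP; split; lra.
have [i iE] : exists i, unpickle i = Some (m x.1, m x.2).
  by exists (pickle (m x.1, m x.2)); exact: pickleK.
exists i; first exact: I.
rewrite /F iE; apply: sub => /= h; apply: fx.
rewrite -(periodic2_int x (m x.1) (m x.2) pf); apply: h.
by split; rewrite /= in_itv/=; exact: my.
Qed.

Lemma continuous_ae0 (f : R * R -> R) : continuous f ->
  {ae mu2 R, forall x, f x = 0} -> forall x, f x = 0.
Proof.
move=> cf [N [mN N0 sub]] x; apply/eqP/negPn/negP => fx0.
have : nbhs x [set y | f y != 0].
  exact: (cf x) (open_nbhs_nbhs (conj (@open_neq R 0) fx0)).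
rewrite -nbhs_ballE => -[e /= e0 xe].
have : (mu2 R (ball x e) <= mu2 R N)%E.
  apply: le_measure; rewrite ?inE.
  - by apply: measurableX; apply: open_measurable; exact: ball_open.
  - exact: mN.
  - by move=> y /xe /= fy; apply: sub => /= h; move: fy; rewrite h eqxx.
rewrite N0 leNgt => /negP; apply.
rewrite (_ : mu2 R (ball x e) = (lebesgue_measure (ball x.1 e) * lebesgue_measure (ball x.2 e))%E).
  by rewrite !lebesgue_measure_ball ?(ltW e0)// mule_gt0// lte_fin mulrn_wgt0.
by apply: mu2X; apply: open_measurable; exact: ball_open.
Qed.
End Translation.

(** * The bracket of two functions *)

Section Bracket.
Variable R : realType.
Local Notation tintegral f := (\int[mu2 R]_(x in @fund R) f x)%R.
Implicit Types (f g : R * R -> R) (df dg : bool -> R * R -> R).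

(** The partial derivatives are carried as explicit functions, so that Leibniz sums and termwise
    derived series serve directly as integrands. *)
Definition C1 f df := [/\ periodic2 f, continuous f,
  forall j, periodic2 (df j) /\ continuous (df j) &
  forall j x, is_derive x (dir R j) f (df j x)].

Lemma C1_continuous f df : C1 f df -> continuous f. Proof. by case. Qed.

Lemma C1_dcontinuous f df j : C1 f df -> continuous (df j).
Proof. by case=> _ _ /(_ j)[]. Qed.

Lemma continuousM2 f g : continuous f -> continuous g -> continuous (fun x => f x * g x).
Proof. by move=> cf cg x; apply: cvgM; [exact: cf|exact: cg]. Qed.

Lemma continuousD2 f g : continuous f -> continuous g -> continuous (fun x => f x + g x).
Proof. by move=> cf cg x; apply: cvgD; [exact: cf|exact: cg]. Qed.

Lemma continuousB2 f g : continuous f -> continuous g -> continuous (fun x => f x - g x).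
Proof. by move=> cf cg x; apply: cvgB; [exact: cf|exact: cg]. Qed.

Lemma periodic2_op2 T1 T2 T3 (op : T1 -> T2 -> T3) (f : R * R -> T1) (g : R * R -> T2) :
  periodic2 f -> periodic2 g -> periodic2 (fun x => op (f x) (g x)).
Proof. by move=> pf pg x; rewrite (pf x).1 (pf x).2 (pg x).1 (pg x).2. Qed.

Lemma C1M f df g dg : C1 f df -> C1 g dg ->
  C1 (fun x => f x * g x) (fun j x => f x * dg j x + g x * df j x).
Proof.
move=> [pf cf pdf dfP] [pg cg pdg dgP]; split.
- exact: periodic2_op2.
- exact: continuousM2.
- move=> j; have [pdfj cdfj] := pdf j; have [pdgj cdgj] := pdg j; split.
    by apply: (periodic2_op2 +%R); exact: periodic2_op2.
  by apply: continuousD2; exact: continuousM2.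
- by move=> j x; have := is_deriveM (dfP j x) (dgP j x).
Qed.

Lemma C1_integral f df j : C1 f df -> tintegral (df j) = 0.
Proof.
by move=> [pf cf /(_ j)[_ cdf] dfP]; apply: integral_dir (cdf) pf (dfP j).
Qed.

Lemma C1_trigser e c : summable_coef e 2 c ->
  C1 (trigser e c) (fun j => trigser e (dcoef e (dir R j) c)).
Proof.
move=> sc; split.
- exact: periodic_trigser.
- by apply: continuous_trigser; exact: summable_coefS.
- move=> j; split; first exact: periodic_trigser.
  by apply: continuous_trigser; exact: summable_dcoef.
- by move=> j x; exact: is_derive_trigser.
Qed.

(** A single wave is encoded as a trigonometric series with one nonzero coefficient, so that its
    regularity and its derivatives come from the general results on series. *)
Definition single (k : int * int) (a b : R) (n : nat) : R * R := if n is 0 then (a, b) else (0, 0).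

Lemma summable_single m k a b : summable_coef (fun=> k) m (single k a b).
Proof.
apply/cvg_ex; exists (wt R k ^+ m * (`|a| + `|b|)); apply: cvg_near_cst.
exists 1%N => // n /= n0; rewrite /series/= big_ltn// big1_seq ?addr0// => i.
by rewrite mem_index_iota => /andP[_ /andP[i0 _]]; case: i i0 => // i _; rewrite /size_coef/= normr0 addr0 mulr0.
Qed.

Lemma trigser_single k a b x :
  trigser (fun=> k) (single k a b) x = a * cos (dotk k x) + b * sin (dotk k x).
Proof.
apply: (@cvg_lim R); first exact: Rhausdorff.
apply: cvg_near_cst; exists 1%N => // n /= n0; rewrite /series/= big_ltn// big1_seq ?addr0// => i.
by rewrite mem_index_iota => /andP[_ /andP[i0 _]]; case: i i0 => // i _; rewrite /trigterm/= !mul0r addr0.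
Qed.

(* [d2f j i] is the derivative of [df j] in direction [i]. *)
Lemma integral_bracket f df (d2f : bool -> bool -> R * R -> R) g dg :
  C1 f df -> (forall j, C1 (df j) (d2f j)) -> d2f true false = d2f false true ->
  C1 g dg ->
  tintegral (fun x => df false x * dg true x - df true x * dg false x) = 0.
Proof.
move=> Cf Cdf d2fC Cg; have mf := @measurable_fund R.
(* The bracket is the divergence $\partial_1(g\,\partial_2 f)-\partial_2(g\,\partial_1 f)$: the
   second derivatives of [f] cancel by symmetry. *)
have I1 := C1_integral true (C1M Cg (Cdf false)).
have I2 := C1_integral false (C1M Cg (Cdf true)).
have c1 : continuous (fun x => g x * d2f false true x + df false x * dg true x).
  by have [_ _ /(_ true)[]] := C1M Cg (Cdf false).
have c2 : continuous (fun x => g x * d2f true false x + df true x * dg false x).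
  by have [_ _ /(_ false)[]] := C1M Cg (Cdf true).
rewrite -[RHS](subrr (0 : R)) -{1}I1 -I2 -RintegralB//; [|exact: continuous_integrable2..].
by apply: eq_Rintegral => x _; rewrite d2fC; ring.
Qed.

(** For a wave [c] of frequency [k], Leibniz's rule gives $c\{v,g\}=\{v,cg\}+\{c,vg\}-v\{c,g\}$. The
    first two terms have integral zero and the hypothesis disposes of the third. Second derivatives
    fall only on [v] and [c], so [g] may itself be a first derivative of [zeta]. *)
Lemma bracket_eq0 v dv (d2v : bool -> bool -> R * R -> R) g dg :
  C1 v dv -> (forall j, C1 (dv j) (d2v j)) -> d2v true false = d2v false true ->
  C1 g dg ->
  (forall k, tintegral (fun x => v x * (cos (dotk k x) *
     (dotk k (dir R false) * dg true x - dotk k (dir R true) * dg false x))) = 0 /\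
   tintegral (fun x => v x * (sin (dotk k x) *
     (dotk k (dir R false) * dg true x - dotk k (dir R true) * dg false x))) = 0) ->
  forall x, dv false x * dg true x - dv true x * dg false x = 0.
Proof.
move=> Cv Cdv d2vC Cg H; have mf := @measurable_fund R.
pose w x := dv false x * dg true x - dv true x * dg false x.
have cw : continuous w.
  by apply: continuousB2; apply: continuousM2; apply: C1_dcontinuous; eassumption.
have pw : periodic2 w.
  have pd f df j : C1 f df -> periodic2 (df j) by case=> _ _ /(_ j)[].
  by apply: (periodic2_op2 (fun a b : R => a - b)); apply: periodic2_op2; apply: pd; eassumption.
have key k a b : tintegral (fun x => w x * (a * cos (dotk k x) + b * sin (dotk k x))) = 0.
  have s3 := @summable_single 3 k a b; have s2 := summable_coefS s3.
  pose c := trigser (fun=> k) (single k a b).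
  pose dc j := trigser (fun=> k) (dcoef (fun=> k) (dir R j) (single k a b)).
  have Cc : C1 c dc by exact: C1_trigser.
  have Cdc j : C1 (dc j) (fun i => trigser (fun=> k) (dcoef (fun=> k) (dir R i)
      (dcoef (fun=> k) (dir R j) (single k a b)))).
    by apply: C1_trigser; exact: summable_dcoef.
  have dcE j x : dc j x = dotk k (dir R j) * (b * cos (dotk k x) - a * sin (dotk k x)).
    have -> : dc j = trigser (fun=> k) (single k (b * dotk k (dir R j)) (- a * dotk k (dir R j))).
      rewrite /dc; congr trigser; apply/funext => -[|n]; rewrite /dcoef/single//=.
      by rewrite oppr0 mul0r.
    by rewrite trigser_single; ring.
  have J1 := integral_bracket Cv Cdv d2vC (C1M Cc Cg).
  have J2 := integral_bracket Cc Cdc _ (C1M Cv Cg).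
  have {}J2 := J2 (f_equal (trigser _) (@dcoefC _ _ _ _ _)).
  have [H1 H2] := H k.
  pose L x := dotk k (dir R false) * dg true x - dotk k (dir R true) * dg false x.
  have cL : continuous L.
    by apply: continuousB2; apply: continuousM2; try exact: cst_continuous;
      apply: C1_dcontinuous; eassumption.
  have cv := C1_continuous Cv.
  have J3 : tintegral (fun x => b * (v x * (cos (dotk k x) * L x)) +
      - a * (v x * (sin (dotk k x) * L x))) = 0.
    rewrite integral_lincomb; [by rewrite H1 H2 !mulr0 addr0|..].
      apply: continuousM2 => //; apply: continuousM2 => //; exact: continuous_cosk.
    apply: continuousM2 => //; apply: continuousM2 => //; exact: continuous_sink.
  have cJ f df g' dg' : C1 f df -> C1 g' dg' ->
      continuous (fun x => df false x * dg' true x - df true x * dg' false x).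
    by move=> C D; apply: continuousB2; apply: continuousM2; apply: C1_dcontinuous; eassumption.
  have c1 := cJ _ _ _ _ Cv (C1M Cc Cg).
  have c2 := cJ _ _ _ _ Cc (C1M Cv Cg).
  have c3 : continuous (fun x => b * (v x * (cos (dotk k x) * L x)) +
      - a * (v x * (sin (dotk k x) * L x))).
    apply: continuousD2; apply: continuousM2; try exact: cst_continuous;
      apply: continuousM2 => //; apply: continuousM2 => //.
      exact: continuous_cosk.
    exact: continuous_sink.
  rewrite -[RHS](_ : 0 + 0 - 0 = 0); last by rewrite addr0 subr0.
  rewrite -{1}J1 -{1}J2 -J3.
  rewrite -RintegralD//; [|exact: continuous_integrable2..].
  rewrite -RintegralB//; [|apply: continuous_integrable2; exact: continuousD2|exact: continuous_integrable2].
  apply: eq_Rintegral => x _; rewrite !dcE /c trigser_single /w /L; ring.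
have : ae_eq (mu2 R) (@fund R) w (fun=> 0).
  apply: fourier_uniqueness; first exact: continuous_integrable2.
  - move=> k; rewrite -[RHS](key k 1 0); apply: eq_Rintegral => x _.
    by rewrite mul1r mul0r addr0.
  - move=> k; rewrite -[RHS](key k 0 1); apply: eq_Rintegral => x _.
    by rewrite mul1r mul0r add0r.
by move=> /(periodic_ae0 pw) /(continuous_ae0 cw).
Qed.
End Bracket.

(** * Functions with a gradient of constant direction *)

Section Local.
Variable R : realType.
Implicit Types (z : R * R -> R) (dz : bool -> R * R -> R) (x y w : R * R).

(** Moving along arbitrary segments requires derivatives in all directions, not only the two of
    [C1]. *)
Definition gradient z dz := forall x w,
  is_derive x w z (w.1 * dz true x + w.2 * dz false x).

Lemma gradient_line z dz x w (t : R) : gradient z dz ->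
  is_derive t 1 (fun t : R => z (x + t *: w))
    (w.1 * dz true (x + t *: w) + w.2 * dz false (x + t *: w)).
Proof. by move=> gz; apply/is_derive_line; exact: gz. Qed.

Lemma gradient_trigser e (c : nat -> R * R) : summable_coef e 2 c ->
  gradient (trigser e c) (fun j => trigser e (dcoef e (dir R j) c)).
Proof.
move=> sc x w; rewrite [X in is_derive _ _ _ X](_ : _ = trigser e (dcoef e w c) x).
  exact: is_derive_trigser.
apply/esym.
have s1 := summable_coefS sc.
have cv j : cvgn (series (fun n => trigterm e (dcoef e (dir R j) c) n x)).
  by apply: cvg_trigser; exact: summable_dcoef.
rewrite /trigser -!sumr_scale // /sumr -lim_seriesD; [|exact: cvg_seriesMl..].
congr (limn (series _)); apply/funext => n /=.
rewrite -[RHS]/(w.1 * trigterm e (dcoef e (dir R true) c) n x +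
  w.2 * trigterm e (dcoef e (dir R false) c) n x) /trigterm/=.
have -> : dotk (e n) w = w.1 * dotk (e n) (1, 0) + w.2 * dotk (e n) (0, 1).
  by rewrite /dotk/=; ring.
by ring.
Qed.

Lemma const_segment (g dg : R -> R) :
  (forall t : R, 0 <= t <= 1 -> is_derive t 1 g (dg t)) -> (forall t, 0 <= t <= 1 -> dg t = 0) ->
  g 1 = g 0.
Proof.
move=> gP dg0.
have cg : {within `[(0 : R), 1], continuous g}.
  apply: derivable_within_continuous => t; rewrite in_itv/= => t01.
  by case: (gP t t01).
have [t|t + e] := @MVT_segment _ g dg 0 1 ler01 _ cg.
  by rewrite in_itv/= => /andP[t0 t1]; apply: gP; rewrite !ltW.
by rewrite in_itv/= => t01; apply/eqP; rewrite -subr_eq0 e dg0 ?mul0r.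
Qed.

Lemma ball_segment (x0 : R * R) (r : R) x y (t : R) : ball x0 r x -> ball x0 r y ->
  0 <= t <= 1 -> ball x0 r (x + t *: (y - x)).
Proof.
have key (a b c : R) : 0 <= t <= 1 -> ball a r b -> ball a r c -> ball a r (b + t * (c - b)).
  rewrite /ball/= => /andP[t0 t1] h1 h2.
  have -> : a - (b + t * (c - b)) = (1 - t) * (a - b) + t * (a - c) by ring.
  apply: le_lt_trans (ler_normD _ _) _; rewrite !normrM (ger0_norm t0) ger0_norm ?subr_ge0//.
  have [->|tn0] := eqVneq t 0; first by rewrite subr0 mul1r mul0r addr0.
  have t0' : 0 < t by rewrite lt_neqAle eq_sym tn0.
  have h3 : t * `|a - c| < t * r by rewrite ltr_pM2l.
  have h4 : (1 - t) * `|a - b| <= (1 - t) * r by rewrite ler_wpM2l ?subr_ge0// ltW.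
  lra.
by move=> [x1 x2] [y1 y2] t01; split; exact: key.
Qed.

(** The gradient is parallel to [l], so [z] is constant on each segment orthogonal to [l]; by
    convexity, any two points of the ball on the same line are joined by such a segment inside the
    ball. *)
Lemma one_dim_ball z dz (x0 : R * R) (r : R) (l : R * R) : gradient z dz -> 0 < r -> l != 0 ->
  (forall x, ball x0 r x -> l.2 * dz true x = l.1 * dz false x) ->
  one_dim_on (ball x0 r) z.
Proof.
move=> gz r0 l0 H.
(* The profile at [t] is the value of [z] at any point of the ball on the line $l\cdot x=t$; [x0] is
   a default for lines that miss the ball. *)
exists (fun t => z (xget x0 [set x | ball x0 r x /\ l.1 * x.1 + l.2 * x.2 = t])), l.
split => // x Bx.
case: xgetP => [y _ [/= By lyx]|/(_ x)]; last by move=> /(_ (conj Bx erefl)).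
pose w := y - x.
have lw : l.1 * w.1 + l.2 * w.2 = 0 by rewrite /w/= !mulrBr; lra.
have l2 : l.1 ^+ 2 + l.2 ^+ 2 != 0.
  rewrite paddr_eq0 ?sqr_ge0// !sqrf_eq0; apply: contra l0.
  by case: (l) => a b /= /andP[/eqP-> /eqP->].
have := @const_segment (fun t : R => z (x + t *: w))
  (fun t => w.1 * dz true (x + t *: w) + w.2 * dz false (x + t *: w)).
rewrite scale1r scale0r addr0 {1}/w subrKC => E.
apply/esym; apply: E => t t01; first exact: gradient_line.
have := H _ (ball_segment Bx By t01); rewrite -/w.
set a := dz true _; set b := dz false _ => lab.
apply: (mulfI l2); rewrite mulr0.
(* Inner product times inner product plus cross product times cross product: [w] is orthogonal to
   [l] and the gradient is parallel to it, so one factor vanishes in each term. *)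
have -> : (l.1 ^+ 2 + l.2 ^+ 2) * (w.1 * a + w.2 * b) =
  (l.1 * w.1 + l.2 * w.2) * (l.1 * a + l.2 * b) +
  (l.2 * w.1 - l.1 * w.2) * (l.2 * a - l.1 * b) by ring.
by rewrite lw lab subrr mul0r mulr0 addr0.
Qed.

(** Let [l] be the gradient at [x0]. The tangent of the angle between [l] and the gradient at $x$
    has as derivative $|l|^2$ times the cross product of the gradient with its own derivative,
    divided by a square; by hypothesis this is zero, so the direction stays that of [l]. *)
Lemma one_dim_parallel z dz (d2z : bool -> bool -> R * R -> R) (U : set (R * R)) (x0 : R * R) :
  gradient z dz -> (forall j, gradient (dz j) (d2z j)) -> (forall j, continuous (dz j)) ->
  open U -> U x0 -> (dz true x0, dz false x0) != 0 ->
  (forall x i, U x -> d2z true i x * dz false x = d2z false i x * dz true x) ->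
  exists W : set (R * R), [/\ open W, W !=set0 & one_dim_on W z].
Proof.
move=> gz gdz cdz oU Ux0; set l := (_, _) => l0 H.
pose P x := l.1 * dz true x + l.2 * dz false x.
have cP : continuous P.
  by apply: continuousD2; apply: continuousM2; try exact: cst_continuous; exact: cdz.
have P0 : 0 < P x0.
  rewrite /P /l/= -!expr2 lt_neqAle addr_ge0 ?sqr_ge0// andbT eq_sym paddr_eq0 ?sqr_ge0//.
  by rewrite !sqrf_eq0; apply: contra l0 => /andP[/eqP a /eqP b]; rewrite /l a b.
have : nbhs x0 (U `&` [set x | 0 < P x]).
  apply: filterI; first exact: open_nbhs_nbhs.
  exact: (cP x0) (open_nbhs_nbhs (conj (@open_gt R 0) P0)).
rewrite -nbhs_ballE => -[r /= r0 rU].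
exists (ball x0 r); split; [exact: ball_open|by exists x0; exact: ballxx|].
apply: (one_dim_ball gz r0 l0) => x Bx.
(* [th] is the cross product and [P] the inner product of [l] with the gradient; [P] stays positive
   on the ball, so [th / P] is differentiable there. *)
pose th y := l.2 * dz true y + - l.1 * dz false y.
pose w := x - x0.
have Bt t : 0 <= t <= 1 -> ball x0 r (x0 + t *: w).
  by move=> t01; apply: ball_segment => //; exact: ballxx.
pose D (a b : R) (t : R) := a * (w.1 * d2z true true (x0 + t *: w) + w.2 * d2z true false (x0 + t *: w))
  + b * (w.1 * d2z false true (x0 + t *: w) + w.2 * d2z false false (x0 + t *: w)).
have lin (a b t : R) : is_derive t 1
    (fun t : R => a * dz true (x0 + t *: w) + b * dz false (x0 + t *: w)) (D a b t).
  exact: is_deriveD (is_deriveZ a (gradient_line x0 w t (gdz true)))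
    (is_deriveZ b (gradient_line x0 w t (gdz false))).
have := @const_segment (fun t : R => th (x0 + t *: w) * (P (x0 + t *: w))^-1)
  (fun t => th (x0 + t *: w) * (- P (x0 + t *: w) ^- 2 * D l.1 l.2 t) +
     (P (x0 + t *: w))^-1 * D l.2 (- l.1) t).
have xE : x0 + w = x by rewrite /w subrKC.
rewrite scale1r scale0r addr0 xE.
have th0 : th x0 = 0 by rewrite /th /l/=; ring.
rewrite th0 mul0r => E.
have Px : 0 < P x by have [] := rU x Bx.
have : th x * (P x)^-1 = 0.
  apply: E => t t01; have [Ut Pt] := rU _ (Bt t t01); rewrite /= in Pt.
    have Pn : P (x0 + t *: w) != 0 by rewrite gt_eqF.
    have h1 := @is_deriveV _ (fun t : R => P (x0 + t *: w)) t _ 1 Pn (lin l.1 l.2 t).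
    have h2 : is_derive t 1 (fun t : R => th (x0 + t *: w)) (D l.2 (- l.1) t) := lin l.2 (- l.1) t.
    exact: is_deriveM h2 h1.
  have := H _ true Ut; have := H _ false Ut.
  rewrite /th /D -/w; move: Pt; rewrite /P.
  set p := x0 + t *: w; move: (dz true p) (dz false p) (d2z true true p) (d2z true false p)
    (d2z false true p) (d2z false false p) => a b a1 a2 b1 b2 Pt e2 e1.
  have Pn : l.1 * a + l.2 * b != 0 by rewrite gt_eqF.
  apply: (mulfI (expf_neq0 2 Pn)); rewrite mulr0.
  rewrite [LHS](_ : _ = (l.1 ^+ 2 + l.2 ^+ 2) *
    (w.1 * (a1 * b - b1 * a) + w.2 * (a2 * b - b2 * a))); last by field.
  by rewrite e1 e2 !subrr !mulr0 addr0 mulr0.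
move/eqP; rewrite mulf_eq0 invr_eq0 [P x == 0]gt_eqF// orbF /th mulNr subr_eq0 => /eqP.
exact.
Qed.
End Local.

(** * Test functions *)

Section TestFunctions.
Variable R : realType.
Local Open Scope complex_scope.
Local Notation tintegral f := (\int[mu2 R]_(x in @fund R) f x)%R.
Implicit Types (f g phi psi : R * R -> R[i]).

Definition diffble f := forall x, differentiable (re_part f) x /\ differentiable (im_part f) x.

(** Recursion on the order instead of on words of partial derivatives: stability under products
    becomes an induction with Leibniz's rule. *)
Fixpoint diffn n f := diffble f /\ if n is m.+1 then forall j, diffn m (pd j f) else True.

Lemma diffnW n f : diffn n.+1 f -> diffn n f.
Proof.
elim: n f => [|n IH] f [df dn]; first by split.
by split => // j; apply: IH; exact: dn.
Qed.

Lemma diffn_diffble n f : diffn n f -> diffble f. Proof. by case: n => [|n] []. Qed.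

Lemma test_diffn f :
  (forall js, diffble (foldr (@pd R) f js)) <-> (forall n, diffn n f).
Proof.
split => [H n|H js].
  elim: n f H => [|n IH] f H; first by split => //; exact: (H [::]).
  by split => [|j]; [exact: (H [::])|apply: IH => js; rewrite -foldr_rcons].
(* The last letter of the word is the derivative applied first. *)
elim/last_ind: js f H => [|js j IH] f H; first exact: diffn_diffble (H 0%N).
by rewrite foldr_rcons; apply: IH => n; have [_] := H n.+1; exact.
Qed.

Lemma is_derive_re j f x : diffble f ->
  is_derive x (dir R j) (re_part f) (complex.Re (pd j f x)).
Proof. by move=> df; have [d1 _] := df x; exact/derivableP/diff_derivable. Qed.

Lemma is_derive_im j f x : diffble f ->
  is_derive x (dir R j) (im_part f) (complex.Im (pd j f x)).
Proof. by move=> df; have [_ d1] := df x; exact/derivableP/diff_derivable. Qed.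

Lemma pd_val j f x a b : is_derive x (dir R j) (re_part f) a ->
  is_derive x (dir R j) (im_part f) b -> pd j f x = a +i* b.
Proof. by move=> h1 h2; rewrite /pd !derive_val. Qed.

Lemma re_partD f g : re_part (fun x => f x + g x) = re_part f + re_part g.
Proof. by apply/funext => y; rewrite /re_part raddfD. Qed.

Lemma im_partD f g : im_part (fun x => f x + g x) = im_part f + im_part g.
Proof. by apply/funext => y; rewrite /im_part raddfD. Qed.

Lemma pdD j f g : diffble f -> diffble g ->
  pd j (fun x => f x + g x) = (fun x => pd j f x + pd j g x).
Proof.
move=> df dg; apply/funext => x.
have h1 := is_deriveD (is_derive_re j x df) (is_derive_re j x dg).
have h2 := is_deriveD (is_derive_im j x df) (is_derive_im j x dg).
rewrite -re_partD in h1; rewrite -im_partD in h2; rewrite (pd_val h1 h2).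
by case: (pd j f x) (pd j g x) => ? ? [].
Qed.

Lemma diffbleD f g : diffble f -> diffble g -> diffble (fun x => f x + g x).
Proof.
move=> df dg x; have [f1 f2] := df x; have [g1 g2] := dg x; rewrite re_partD im_partD.
by split; exact: differentiableD.
Qed.

Lemma re_partM f g : re_part (fun x => f x * g x) =
  re_part f * re_part g - im_part f * im_part g.
Proof. by apply/funext => x; rewrite !fctE /re_part /im_part; case: (f x) (g x) => ? ? []. Qed.

Lemma im_partM f g : im_part (fun x => f x * g x) =
  re_part f * im_part g + im_part f * re_part g.
Proof. by apply/funext => x; rewrite !fctE /re_part /im_part; case: (f x) (g x) => ? ? []. Qed.

Lemma diffbleM f g : diffble f -> diffble g -> diffble (fun x => f x * g x).
Proof.
move=> df dg x; have [f1 f2] := df x; have [g1 g2] := dg x; rewrite re_partM im_partM; split.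
  by apply: differentiableB; apply: differentiableM.
by apply: differentiableD; apply: differentiableM.
Qed.

Lemma pdM j f g : diffble f -> diffble g ->
  pd j (fun x => f x * g x) = (fun x => pd j f x * g x + f x * pd j g x).
Proof.
move=> df dg; apply/funext => x.
have f1 := is_derive_re j x df; have f2 := is_derive_im j x df.
have g1 := is_derive_re j x dg; have g2 := is_derive_im j x dg.
have h1 := is_deriveB (is_deriveM f1 g1) (is_deriveM f2 g2).
have h2 := is_deriveD (is_deriveM f1 g2) (is_deriveM f2 g1).
rewrite -re_partM in h1; rewrite -im_partM in h2; rewrite (pd_val h1 h2).
move: (pd j f x) (pd j g x); rewrite /re_part /im_part; case: (f x) => a b; case: (g x) => c d.
move=> [a' b'] [c' d']; apply/eqP; rewrite eq_complex/= /GRing.scale/=.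
by apply/andP; split; apply/eqP; ring.
Qed.

Lemma diffble_cst (a : R[i]) : diffble (fun=> a).
Proof. by move=> x; split; exact: differentiable_cst. Qed.

Lemma pd_cst j (a : R[i]) : pd j (fun=> a) = (fun=> 0).
Proof.
apply/funext => x.
have h1 : is_derive x (dir R j) (re_part (fun=> a)) 0 by exact: is_derive_cst.
have h2 : is_derive x (dir R j) (im_part (fun=> a)) 0 by exact: is_derive_cst.
exact: pd_val h1 h2.
Qed.

Lemma differentiable_dotk k x : differentiable (@dotk R k) x.
Proof.
rewrite (_ : @dotk R k = (k.1%:~R \*: fst) + (k.2%:~R \*: snd)); last exact/funext.
apply: differentiableD; apply: differentiableZ; apply: linear_differentiable => y.
  exact: cvg_fst.
exact: cvg_snd.
Qed.

Lemma diffble_ek k : diffble (@ek R k).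
Proof.
move=> x; split.
  apply: (differentiable_comp (differentiable_dotk k x)).
  by apply/derivable1_diffP; exact: ex_derive.
apply: (differentiable_comp (differentiable_dotk k x)).
by apply/derivable1_diffP; exact: ex_derive.
Qed.

Lemma is_derive_dotk k x w (g : R -> R) d :
  is_derive (dotk k x) 1 g d -> is_derive x w (fun x => g (dotk k x)) (dotk k w * d).
Proof.
move=> gP; rewrite -[x in is_derive x](addr0 x) -(scale0r w).
apply/is_derive_line; under eq_fun do rewrite dotk_line.
have h : is_derive (0 : R) 1 (fun t : R => dotk k x + t * dotk k w) (dotk k w).
  by apply: is_derive_eq; rewrite add0r mul1r scaler0 add0r /GRing.scale/= mulr1.
rewrite mulrC; apply: (@is_derive1_comp _ g (fun t : R => dotk k x + t * dotk k w)) => //.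
by rewrite mul0r addr0.
Qed.

Definition cdir (q : int * int) (j : bool) : R[i] := (if j then q.1 else q.2)%:~R.

Lemma cdirE q j : cdir q j = (dotk q (dir R j))%:C.
Proof. by rewrite /cdir; case: j; rewrite /dotk/= mulr1 mulr0 ?addr0 ?add0r rmorph_int. Qed.

Lemma pd_ek j k : pd j (@ek R k) = (fun x => (0 +i* 1) * cdir k j * ek k x).
Proof.
apply/funext => x; rewrite cdirE.
have h1 : is_derive x (dir R j) (re_part (ek k)) (dotk k (dir R j) * - sin (dotk k x)).
  exact: is_derive_dotk.
have h2 : is_derive x (dir R j) (im_part (ek k)) (dotk k (dir R j) * cos (dotk k x)).
  exact: is_derive_dotk.
rewrite (pd_val h1 h2) /ek; apply/eqP; rewrite eq_complex/=.
by apply/andP; split; apply/eqP; ring.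
Qed.

Lemma diffnD n f g : diffn n f -> diffn n g -> diffn n (fun x => f x + g x).
Proof.
elim: n f g => [|n IH] f g [df dnf] [dg dng]; split; try exact: diffbleD; first by [].
by move=> j; rewrite pdD//; apply: IH; [exact: dnf|exact: dng].
Qed.

Lemma diffnM n f g : diffn n f -> diffn n g -> diffn n (fun x => f x * g x).
Proof.
elim: n f g => [|n IH] f g fn gn.
  by have [df _] := fn; have [dg _] := gn; split; first exact: diffbleM.
have [df dnf] := fn; have [dg dng] := gn; split; first exact: diffbleM.
move=> j; rewrite pdM//; apply: diffnD; apply: IH.
- exact: dnf.
- exact: diffnW.
- exact: diffnW.
- exact: dng.
Qed.

Lemma diffn_cst n a : diffn n (fun=> a).
Proof.
elim: n a => [|n IH] a; split=> //; try exact: diffble_cst.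
by move=> j; rewrite pd_cst.
Qed.

Lemma diffn_ek n k : diffn n (@ek R k).
Proof.
elim: n => [|n IH]; split=> //; try exact: diffble_ek.
by move=> j; rewrite pd_ek; apply: diffnM; [exact: diffn_cst|].
Qed.

Lemma testP f : test_function f <-> periodic2 f /\ forall n, diffn n f.
Proof.
split => [[pf df]|[pf /test_diffn df]]; split => //.
by apply/test_diffn => js x; exact: df.
Qed.

Lemma test_diffble f : test_function f -> diffble f.
Proof. by move=> /testP[_ /(_ 0%N)[]]. Qed.

Lemma testD f g : test_function f -> test_function g -> test_function (fun x => f x + g x).
Proof.
move=> /testP[pf df] /testP[pg dg]; apply/testP; split; first exact: (periodic2_op2 +%R).
by move=> n; exact: diffnD.
Qed.

Lemma testZ (a : R[i]) f : test_function f -> test_function (fun x => a * f x).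
Proof.
move=> /testP[pf df]; apply/testP; split; first by move=> x; rewrite !(pf x).1 !(pf x).2.
by move=> n; apply: diffnM; [exact: diffn_cst|].
Qed.

Lemma periodic2_ek k : periodic2 (@ek R k).
Proof.
move=> x; have [c1 c2] := periodic_trig k x (@cosD2pi R).
have [s1 s2] := periodic_trig k x (@sinD2pi R).
by rewrite /ek c1 c2 s1 s2.
Qed.

Lemma test_ekM k f : test_function f -> test_function (fun x => ek k x * f x).
Proof.
move=> /testP[pf df]; apply/testP; split.
  by apply: (periodic2_op2 *%R) => //; exact: periodic2_ek.
by move=> n; apply: diffnM; [exact: diffn_ek|].
Qed.

Lemma periodic2_derive (f : R * R -> R) v : periodic2 f -> periodic2 (fun x => 'D_v f x).
Proof.
move=> pf x; have sh (c : R * R) : (forall y, f (y + c) = f y) -> 'D_v f (x + c) = 'D_v f x.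
  move=> fc; have E : (fun h : R => h^-1 *: ((f \o shift (x + c)) (h *: v) - f (x + c))) =
      (fun h : R => h^-1 *: ((f \o shift x) (h *: v) - f x)).
    by apply/funext => h /=; rewrite addrA !fc.
  exact: (f_equal (fun g : R -> R => lim (g h @[h --> 0^'])) E).
split.
  have -> : (x.1 + 2 * pi, x.2) = x + (2 * pi, 0).
    by rewrite [RHS]surjective_pairing/= addr0.
  apply: sh => y; have -> : y + (2 * pi, 0) = (y.1 + 2 * pi, y.2).
    by rewrite [LHS]surjective_pairing/= addr0.
  exact: (pf y).1.
have -> : (x.1, x.2 + 2 * pi) = x + (0, 2 * pi).
  by rewrite [RHS]surjective_pairing/= addr0.
apply: sh => y; have -> : y + (0, 2 * pi) = (y.1, y.2 + 2 * pi).
  by rewrite [LHS]surjective_pairing/= addr0.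
exact: (pf y).2.
Qed.

Lemma periodic2_pd j f : periodic2 f -> periodic2 (pd j f).
Proof.
move=> pf; have pre : periodic2 (re_part f) by move=> x; rewrite /re_part !(pf x).1 !(pf x).2.
have pim : periodic2 (im_part f) by move=> x; rewrite /im_part !(pf x).1 !(pf x).2.
by apply: (periodic2_op2 (fun a b => a +i* b)); exact: periodic2_derive.
Qed.

Lemma test_pd j f : test_function f -> test_function (pd j f).
Proof.
move=> /testP[pf df]; apply/testP; split; first exact: periodic2_pd.
by move=> n; have [_] := df n.+1; exact.
Qed.

Lemma C1_re f : test_function f -> C1 (re_part f) (fun j => re_part (pd j f)).
Proof.
move=> tf; have [pf _] := tf; split.
- by move=> x; rewrite /re_part (pf x).1 (pf x).2.
- by move=> x; apply: differentiable_continuous; have [] := test_diffble tf x.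
- move=> j; have tfj := test_pd j tf; split.
    by move=> x; have [pfj _] := tfj; rewrite /re_part (pfj x).1 (pfj x).2.
  by move=> x; apply: differentiable_continuous; have [] := test_diffble tfj x.
- by move=> j x; apply: is_derive_re; exact: test_diffble.
Qed.

Lemma C1_im f : test_function f -> C1 (im_part f) (fun j => im_part (pd j f)).
Proof.
move=> tf; have [pf _] := tf; split.
- by move=> x; rewrite /im_part (pf x).1 (pf x).2.
- by move=> x; apply: differentiable_continuous; have [] := test_diffble tf x.
- move=> j; have tfj := test_pd j tf; split.
    by move=> x; have [pfj _] := tfj; rewrite /im_part (pfj x).1 (pfj x).2.
  by move=> x; apply: differentiable_continuous; have [] := test_diffble tfj x.
- by move=> j x; apply: is_derive_im; exact: test_diffble.
Qed.
End TestFunctions.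

(** * Commutators on distributions *)

Section MixedPartials.
Variable R : realType.
Local Notation tintegral f := (\int[mu2 R]_(x in @fund R) f x)%R.

(* Both sides have the same Fourier coefficients. *)
Lemma mixed_partials (f : R * R -> R) df (d2f : bool -> bool -> R * R -> R) :
  C1 f df -> (forall j, C1 (df j) (d2f j)) -> forall i j, d2f i j = d2f j i.
Proof.
move=> Cf Cdf i j; have mf := @measurable_fund R.
pose w x := d2f i j x - d2f j i x.
have cw : continuous w by apply: continuousB2; apply: C1_dcontinuous; exact: Cdf.
have pw : periodic2 w.
  apply: (periodic2_op2 (fun a b : R => a - b)).
    by have [_ _ /(_ j)[]] := Cdf i.
  by have [_ _ /(_ i)[]] := Cdf j.
have key k a b : tintegral (fun x => w x * (a * cos (dotk k x) + b * sin (dotk k x))) = 0.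
  have s3 := @summable_single _ 3 k a b; have s2 := summable_coefS s3.
  pose c := trigser (fun=> k) (single k a b).
  pose dc j := trigser (fun=> k) (dcoef (fun=> k) (dir R j) (single k a b)).
  pose d2c j i := trigser (fun=> k) (dcoef (fun=> k) (dir R i)
      (dcoef (fun=> k) (dir R j) (single k a b))).
  have Cc : C1 c dc by exact: C1_trigser.
  have Cdc j' : C1 (dc j') (d2c j').
    by apply: C1_trigser; exact: summable_dcoef.
  have C2 i' j' : d2c i' j' = d2c j' i' by rewrite /d2c dcoefC.
  have CI f1 df1 i1 : C1 f1 df1 -> (mu2 R).-integrable (@fund R) (EFin \o df1 i1).
    by move=> h; apply: continuous_integrable2; exact: C1_dcontinuous h.
  (* Two integrations by parts move all derivatives to [c], whose second derivatives commute by
     inspection of the coefficients. *)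
  have I1 := C1_integral j (C1M (Cdf i) Cc); have N1 := CI _ _ j (C1M (Cdf i) Cc).
  have I2 := C1_integral i (C1M (Cdf j) Cc); have N2 := CI _ _ i (C1M (Cdf j) Cc).
  have I3 := C1_integral i (C1M Cf (Cdc j)); have N3 := CI _ _ i (C1M Cf (Cdc j)).
  have I4 := C1_integral j (C1M Cf (Cdc i)); have N4 := CI _ _ j (C1M Cf (Cdc i)).
  rewrite -[RHS](_ : (0 - 0) - (0 - 0) = 0); last by rewrite !subr0.
  rewrite -{1}I1 -{1}I2 -{1}I3 -I4 -!RintegralB//; last 2 first.
  - by have := integrableB mf N1 N2; apply: eq_integrable => // x _ /=; rewrite EFinB.
  - by have := integrableB mf N3 N4; apply: eq_integrable => // x _ /=; rewrite EFinB.
  apply: eq_Rintegral => x _; rewrite (C2 j i) /w -trigser_single -/c; ring.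
have : ae_eq (mu2 R) (@fund R) w (fun=> 0).
  apply: fourier_uniqueness; first exact: continuous_integrable2.
  - move=> k; rewrite -[RHS](key k 1 0); apply: eq_Rintegral => x _.
    by rewrite mul1r mul0r addr0.
  - move=> k; rewrite -[RHS](key k 0 1); apply: eq_Rintegral => x _.
    by rewrite mul1r mul0r add0r.
move=> /(periodic_ae0 pw) /(continuous_ae0 cw) H; apply/funext => x.
by apply/eqP; rewrite -subr_eq0 -/(w x) H.
Qed.
End MixedPartials.

(** * Transposing the operators onto test functions *)

Section Operators.
Variable R : realType.
Local Open Scope complex_scope.
Local Notation tintegral f := (\int[mu2 R]_(x in @fund R) f x)%R.
Local Notation II := (0 +i* 1 : R[i]).
Implicit Types (phi psi : R * R -> R[i]) (T : distribution2 R).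

Local Opaque pd ek.

Lemma sqrII : II * II = -1.
Proof. by apply/eqP; rewrite eq_complex/= !mul0r !mulr0 mul1r sub0r addr0 oppr0 !eqxx. Qed.

Lemma pd_comm i j phi : test_function phi -> pd i (pd j phi) = pd j (pd i phi).
Proof.
move=> tphi; apply/funext => x; apply/eqP; rewrite eq_complex; apply/andP; split; apply/eqP.
  exact: (f_equal (fun g => g x) (mixed_partials (C1_re tphi) (fun j => C1_re (test_pd j tphi)) j i)).
exact: (f_equal (fun g => g x) (mixed_partials (C1_im tphi) (fun j => C1_im (test_pd j tphi)) j i)).
Qed.

Definition cdot (q k : int * int) : R[i] :=
  cdir R q true * cdir R k true + cdir R q false * cdir R k false.

Definition Dq (q : int * int) phi x :=
  cdir R q true * pd true phi x + cdir R q false * pd false phi x.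

Lemma test_lin a b phi psi : test_function phi -> test_function psi ->
  test_function (fun x => a * phi x + b * psi x).
Proof. by move=> t1 t2; apply: testD; exact: testZ. Qed.

Lemma test_Dq q phi : test_function phi -> test_function (Dq q phi).
Proof. by move=> t; apply: test_lin; exact: test_pd. Qed.

Lemma pd_lin j a b phi psi : test_function phi -> test_function psi ->
  pd j (fun x => a * phi x + b * psi x) = (fun x => a * pd j phi x + b * pd j psi x).
Proof.
move=> t1 t2; rewrite pdD; [|exact: test_diffble (testZ _ _)..].
apply/funext => x; rewrite !pdM ?pd_cst; try exact: diffble_cst; try exact: test_diffble.
by rewrite !mul0r !add0r.
Qed.

Lemma Dq_lin q a b phi psi : test_function phi -> test_function psi ->
  Dq q (fun x => a * phi x + b * psi x) = (fun x => a * Dq q phi x + b * Dq q psi x).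
Proof.
move=> t1 t2; apply/funext => x; rewrite /Dq !pd_lin//.
move: (pd true phi x) (pd false phi x) (pd true psi x) (pd false psi x).
by move: (cdir R q true) (cdir R q false) => *; ring.
Qed.

Lemma Dq_ek q k phi : test_function phi ->
  Dq q (fun x => ek k x * phi x) =
  (fun x => ek k x * (1 * Dq q phi x + II * cdot q k * phi x)).
Proof.
move=> t; apply/funext => x.
rewrite /Dq /cdot !pdM ?pd_ek; try exact: diffble_ek; try exact: test_diffble.
move: (pd true phi x) (pd false phi x) (ek k x) (phi x).
by move: (cdir R q true) (cdir R q false) (cdir R k true) (cdir R k false) => *; ring.
Qed.

Lemma DqC q r phi : test_function phi -> Dq q (Dq r phi) = Dq r (Dq q phi).
Proof.
move=> t; apply/funext => x; rewrite /Dq !pd_lin; try exact: test_pd.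
rewrite (pd_comm false true t).
move: (cdir R q true) (cdir R q false) (cdir R r true) (cdir R r false).
move: (pd true (pd true phi) x) (pd true (pd false phi) x) (pd false (pd false phi) x).
by move=> a b c d e f g; ring.
Qed.

(** A [distribution2] is an arbitrary functional, whereas the commutator identities need linearity
    on test functions. The operators considered here preserve this property. *)
Definition good T := forall a b phi psi, test_function phi -> test_function psi ->
  T (fun x => a * phi x + b * psi x) = a * T phi + b * T psi.

Lemma good_dpd j T : good T -> good (dpd j T).
Proof.
move=> gT a b phi psi t1 t2; rewrite /dpd pd_lin// gT; try exact: test_pd.
by ring.
Qed.

Lemma good_ek k T : good T -> good (dmul (ek k) T).
Proof.
move=> gT a b phi psi t1 t2; rewrite /dmul.
rewrite -gT; try exact: test_ekM.
by congr T; apply/funext => x; ring.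
Qed.

Lemma good_lin T S c d : good T -> good S -> good (fun phi => c * T phi + d * S phi).
Proof. by move=> gT gS a b phi psi t1 t2; rewrite gT// gS//; ring. Qed.

Lemma good_ext T S : good T -> (forall phi, S phi = T phi) -> good S.
Proof. by move=> gT E a b phi psi t1 t2; rewrite !E gT. Qed.

Lemma good_lap T : good T -> good (lap T).
Proof.
move=> gT; apply: (good_ext (good_lin 1 1 (good_dpd true (good_dpd true gT))
  (good_dpd false (good_dpd false gT)))) => phi.
by rewrite [X in _ = X + _]mul1r [X in _ = _ + X]mul1r.
Qed.

Lemma good_kgrad q T : good T -> good (kgrad q T).
Proof.
move=> gT; exact: (good_lin q.1%:~R q.2%:~R (good_dpd true gT) (good_dpd false gT)).
Qed.

Definition cH (k : int * int) : R[i] := II / (normk2 R k)%:C.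

Lemma good_HH k T : good T -> good (HH k T).
Proof.
move=> gT; have g1 := good_ek k (good_kgrad (perpk k) gT).
by apply: (good_ext (good_lin (cH k) 0 g1 g1)) => phi; rewrite /HH mul0r addr0.
Qed.

Definition preserves_good (A : operator R) := forall T, good T -> good (A T).

Lemma good_comm A B : preserves_good A -> preserves_good B -> preserves_good (comm A B).
Proof.
move=> gA gB T gT; apply: (good_ext (good_lin 1 (-1) (gA _ (gB _ gT)) (gB _ (gA _ gT)))) => phi.
by rewrite /comm mul1r mulN1r.
Qed.

Lemma kgradE q T phi : good T -> test_function phi -> kgrad q T phi = - T (Dq q phi).
Proof.
move=> gT t; have -> : T (Dq q phi) = cdir R q true * T (pd true phi) +
    cdir R q false * T (pd false phi) by apply: gT; exact: test_pd.
rewrite /kgrad /dpd /cdir; move: (T _) (T _) => a b.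
by rewrite opprD !mulrN.
Qed.

Lemma lapE T phi : good T -> test_function phi ->
  lap T phi = T (fun x => 1 * pd true (pd true phi) x + 1 * pd false (pd false phi) x).
Proof.
move=> gT t; have tt j : test_function (pd j (pd j phi)) by do 2 apply: test_pd.
rewrite [RHS](gT 1 1 _ _ (tt true) (tt false)).
rewrite -[LHS]/(- - T (pd true (pd true phi)) + - - T (pd false (pd false phi))).
generalize (T (pd true (pd true phi))), (T (pd false (pd false phi))) => a b; ring.
Qed.

Lemma cdot_perp k : cdot (perpk k) k = 0.
Proof. by rewrite /cdot /cdir/= mulrNz; ring. Qed.

Lemma Dperp_ek k phi : test_function phi ->
  Dq (perpk k) (fun x => ek k x * phi x) = (fun x => ek k x * Dq (perpk k) phi x).
Proof. by move=> t; rewrite Dq_ek// cdot_perp; apply/funext => x; ring. Qed.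

(** Since $k^\perp\cdot k=0$, multiplication by $e_k$ commutes with $P_k$. The reversal of factors
    caused by transposition is thus invisible, and only the sign of one derivative remains. *)
Lemma HHE k T phi : good T -> test_function phi ->
  HH k T phi = - cH k * T (fun x => ek k x * Dq (perpk k) phi x).
Proof.
move=> gT t; rewrite /HH /dmul kgradE//; last exact: test_ekM.
by rewrite Dperp_ek// mulrN mulNr.
Qed.

Lemma Dq_opp q phi x : Dq (- q) phi x = - Dq q phi x.
Proof. by rewrite /Dq /cdir/= !mulrNz; ring. Qed.

Lemma HHNE k T phi : good T -> test_function phi ->
  HH (- k) T phi = cH k * T (fun x => ek (- k) x * Dq (perpk k) phi x).
Proof.
move=> gT t; rewrite HHE//.
have -> : cH (- k) = cH k by rewrite /cH /normk2/= !mulrNz !sqrrN.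
have tt : test_function (fun x => ek (- k) x * Dq (perpk k) phi x).
  by apply: test_ekM; exact: test_Dq.
(* [good] speaks of combinations of two functions; a summand with coefficient 0 expresses a scalar
   multiple. *)
have -> : (fun x => ek (- k) x * Dq (perpk (- k)) phi x) =
   (fun x => -1 * (ek (- k) x * Dq (perpk k) phi x) + 0 * (ek (- k) x * Dq (perpk k) phi x)).
  by apply/funext => x; rewrite (_ : perpk (- k) = - perpk k) // Dq_opp; ring.
by rewrite gT//; ring.
Qed.
End Operators.

(** * The iterated commutators *)

Section Commutators.
Variable R : realType.
Local Open Scope complex_scope.
Local Notation II := (0 +i* 1 : R[i]).
Implicit Types (phi psi : R * R -> R[i]) (T : distribution2 R).
Local Opaque pd ek.

Lemma cdotE q k : cdot R q k =
  cdir R q true * cdir R k true + cdir R q false * cdir R k false.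
Proof. by []. Qed.

Lemma cdir_opp k j : cdir R (- k) j = - cdir R k j.
Proof. by rewrite /cdir; case: j; rewrite /= mulrNz. Qed.

Lemma cdot_oppr q k : cdot R q (- k) = - cdot R q k.
Proof. by rewrite !cdotE !cdir_opp; ring. Qed.

Lemma cdot_self k : cdot R k k = (normk2 R k)%:C.
Proof.
rewrite cdotE !cdirE -!rmorphM -rmorphD /= /normk2 /dotk/=; congr (_%:C).
by ring.
Qed.

Lemma ek_oppM k (x : R * R) : ek (- k) x * ek k x = 1.
Proof.
Local Transparent ek.
rewrite /ek dotkN cosN sinN; apply/eqP; rewrite eq_complex/=; apply/andP; split; apply/eqP.
  by rewrite mulNr opprK -!expr2 cos2Dsin2.
by ring.
Qed.
Local Opaque ek.

Lemma pdDq phi : pd true phi = Dq (1, 0) phi /\ pd false phi = Dq (0, 1) phi.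
Proof.
split; apply/funext => x; rewrite /Dq /cdir /=; generalize (pd true phi x), (pd false phi x) => a b; ring.
Qed.

(** The Laplacian as a sum of squared directional derivatives, so that its passage through an
    exponential reduces to [Dq2_ek]. *)
Definition Lop phi x := 1 * Dq (1, 0) (Dq (1, 0) phi) x + 1 * Dq (0, 1) (Dq (0, 1) phi) x.

Lemma test_Lop phi : test_function phi -> test_function (Lop phi).
Proof. by move=> t; apply: test_lin; do 2 apply: test_Dq. Qed.

Lemma lapE' T phi : good T -> test_function phi -> lap T phi = T (Lop phi).
Proof.
move=> gT t; rewrite lapE //; congr T; apply/funext => x; rewrite /Lop.
by rewrite !(pdDq _).1 !(pdDq _).2.
Qed.

Lemma Dq_coords q phi x :
  Dq q phi x = cdir R q true * Dq (1, 0) phi x + cdir R q false * Dq (0, 1) phi x.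
Proof. by rewrite -(pdDq _).1 -(pdDq _).2. Qed.

Lemma cdot_e1 k : cdot R (1, 0) k = cdir R k true.
Proof. by rewrite cdotE /cdir/=; ring. Qed.

Lemma cdot_e2 k : cdot R (0, 1) k = cdir R k false.
Proof. by rewrite cdotE /cdir/=; ring. Qed.
Local Opaque Dq cdot cdir.

Lemma Dq2_ek q k psi : test_function psi ->
  Dq q (Dq q (fun x => ek k x * psi x)) = (fun x => ek k x *
    (Dq q (Dq q psi) x + 2 * II * cdot R q k * Dq q psi x - cdot R q k ^+ 2 * psi x)).
Proof.
move=> t; have t1 := test_Dq q t.
rewrite Dq_ek// Dq_ek; last exact: test_lin.
rewrite Dq_lin//; apply/funext => x.
have := @sqrII R; generalize II, (ek k x), (psi x), (Dq q psi x), (Dq q (Dq q psi) x), (cdot R q k).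
move=> i a b c d e ii; rewrite [X in _ = a * X](_ : _ = d + 2 * i * e * c + i * i * e ^+ 2 * b); first by ring.
by rewrite ii; ring.
Qed.

Lemma Lop_ek k psi : test_function psi ->
  Lop (fun x => ek k x * psi x) = (fun x => ek k x *
    (Lop psi x + (2 * II * Dq k psi x + - cdot R k k * psi x))).
Proof.
move=> t; apply/funext => x; rewrite /Lop (Dq2_ek (1, 0) k t) (Dq2_ek (0, 1) k t).
rewrite cdot_e1 cdot_e2 (cdotE k k) (Dq_coords k psi x).
generalize (cdir R k true), (cdir R k false), (ek k x), (psi x), (Dq (1, 0) psi x).
generalize (Dq (0, 1) psi x), (Dq (1, 0) (Dq (1, 0) psi) x), (Dq (0, 1) (Dq (0, 1) psi) x), II.
by move=> a b c d e f g h i; ring.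
Qed.

Lemma Dq_Lop q phi : test_function phi -> Dq q (Lop phi) = Lop (Dq q phi).
Proof.
move=> t; have t1 := test_Dq (1, 0) t; have t2 := test_Dq (0, 1) t.
rewrite /Lop Dq_lin; try (by apply: test_Dq).
by rewrite (DqC q _ t1) (DqC q _ t2) (DqC q _ t) (DqC q (0, 1) t).
Qed.

(** The transpose of $[\Delta,\mathsf H^k]$ without the scalar $c_k$: the Laplacians of $P_k\varphi$
    cancel and $e_k(2\iota\,k\cdot\nabla-|k|^2)P_k$ is left. *)
Definition Gop (k : int * int) phi x := ek k x *
  (2 * II * Dq k (Dq (perpk k) phi) x + - cdot R k k * Dq (perpk k) phi x).

Lemma test_Gop k phi : test_function phi -> test_function (Gop k phi).
Proof.
move=> t; apply: test_ekM; apply: test_lin; last exact: test_Dq.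
by do 2 apply: test_Dq.
Qed.

Lemma commE (A B : operator R) T phi : comm A B T phi = A (B T) phi - B (A T) phi.
Proof. by []. Qed.

Lemma comm_lapE k T phi : good T -> test_function phi ->
  comm (@lap R) (HH k) T phi = cH R k * T (Gop k phi).
Proof.
move=> gT t; have tP := test_Dq (perpk k) t; have te := test_ekM k tP.
rewrite commE (lapE' (good_HH k gT) t) (HHE k gT (test_Lop t)) (HHE k (good_lap gT) t).
rewrite (lapE' gT te) (Dq_Lop _ t).
have -> : T (Gop k phi) = 1 * T (Lop (fun x => ek k x * Dq (perpk k) phi x)) +
    (-1) * T (fun x => ek k x * Lop (Dq (perpk k) phi) x).
  rewrite -gT; [|exact: test_Lop|by apply: test_ekM; exact: test_Lop].
  congr T; apply/funext => x; rewrite Lop_ek// /Gop.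
  generalize (ek k x), (Lop (Dq (perpk k) phi) x), (2 * II * Dq k (Dq (perpk k) phi) x).
  by move=> a b c; ring.
generalize (T (Lop (fun x => ek k x * Dq (perpk k) phi x))), (T (fun x => ek k x * Lop (Dq (perpk k) phi) x)), (cH R k).
by move=> a b c; ring.
Qed.

Definition Eop (k : int * int) phi x := ek (- k) x * Dq (perpk k) phi x.

(** The exponentials cancel and so do the third-order terms. What survives comes from $k\cdot\nabla$
    differentiating $e_{-k}$, which contributes $2|k|^2$ to the subtracted term. *)
Lemma Eop_Gop k phi : test_function phi -> forall x,
  1 * Eop k (Gop k phi) x + (-1) * Gop k (Eop k phi) x =
  - 2 * cdot R k k * Dq (perpk k) (Dq (perpk k) phi) x.
Proof.
move=> t x; set P := Dq (perpk k).
have tP : test_function (P phi) by exact: test_Dq.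
have tPP : test_function (P (P phi)) by exact: test_Dq.
have tQP : test_function (Dq k (P phi)) by exact: test_Dq.
have E1 : P (Gop k phi) = (fun x => ek k x *
    (2 * II * P (Dq k (P phi)) x + - cdot R k k * P (P phi) x)).
  rewrite /P /Gop (Dperp_ek k (test_lin _ _ tQP tP)).
  by rewrite (Dq_lin (perpk k) _ _ tQP tP).
have E2 : P (Eop k phi) = (fun x => ek (- k) x * P (P phi) x).
  rewrite /P /Eop (Dq_ek (perpk k) (- k) tP) cdot_oppr (cdot_perp R k) oppr0; apply/funext => y.
  rewrite -/P; generalize (ek (- k) y), (P (P phi) y), (P phi y) => a b c.
  by ring.
rewrite {1}/Eop -/P E1 /Gop -/P E2 (Dq_ek k (- k) tPP) cdot_oppr.
have -> : P (Dq k (P phi)) = Dq k (P (P phi)) by exact: DqC.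
have := ek_oppM k x; have := @sqrII R.
generalize (ek k x), (ek (- k) x), (Dq k (P (P phi)) x), (P (P phi) x), (cdot R k k), II.
move=> a b c d e i ii ab.
rewrite [LHS](_ : _ = (b * a) * (2 * (i * i) * e * d)); last by ring.
by rewrite ab ii; ring.
Qed.

Lemma preserves_lap : preserves_good (@lap R). Proof. by move=> T; exact: good_lap. Qed.
Lemma preserves_HH k : preserves_good (@HH R k). Proof. by move=> T; exact: good_HH. Qed.

(** The scalars combine to $c_k^2\cdot(-2|k|^2)=2/|k|^2$, because $c_k^2=-1/|k|^4$. *)
Lemma comm2E k T phi : k != 0 -> good T -> test_function phi ->
  comm (comm (@lap R) (HH k)) (HH (- k)) T phi =
  2 / (normk2 R k)%:C * T (Dq (perpk k) (Dq (perpk k) phi)).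
Proof.
move=> k0 gT t.
have tE psi : test_function psi -> test_function (Eop k psi).
  by move=> tp; apply: test_ekM; exact: test_Dq.
have tPP : test_function (Dq (perpk k) (Dq (perpk k) phi)) by do 2 apply: test_Dq.
have gD := good_comm preserves_lap (preserves_HH k).
rewrite [LHS]commE.
rewrite (comm_lapE k (good_HH (- k) gT) t) (HHNE k gT (test_Gop k t)).
rewrite (HHNE k (gD _ gT) t) -/(Eop k (Gop k phi)) -/(Eop k phi) (comm_lapE k gT (tE _ t)).
have E : 1 * T (Eop k (Gop k phi)) + (-1) * T (Gop k (Eop k phi)) =
    - 2 * cdot R k k * T (Dq (perpk k) (Dq (perpk k) phi)).
  rewrite -(gT 1 (-1) _ _ (tE _ (test_Gop k t)) (test_Gop k (tE _ t))).
  have -> : - 2 * cdot R k k * T (Dq (perpk k) (Dq (perpk k) phi)) =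
     T (fun x => (- 2 * cdot R k k) * Dq (perpk k) (Dq (perpk k) phi) x +
        0 * Dq (perpk k) (Dq (perpk k) phi) x).
    rewrite [RHS](gT _ 0 _ _ tPP tPP).
    generalize (T (Dq (perpk k) (Dq (perpk k) phi))), (- 2 * cdot R k k) => a b.
    by ring.
  congr T; apply/funext => x; rewrite (Eop_Gop k t).
  generalize (Dq (perpk k) (Dq (perpk k) phi) x), (- 2 * cdot R k k) => a b.
  by ring.
have N0 : (normk2 R k)%:C != 0.
  by rewrite (inj_eq (@complexI R)) gt_eqF// (lt_le_trans ltr01 (normk2_ge1 R k0)).
move: E; rewrite cdot_self /cH; have := @sqrII R.
generalize (T (Eop k (Gop k phi))), (T (Gop k (Eop k phi))), (T (Dq (perpk k) (Dq (perpk k) phi))).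
move: N0; generalize (normk2 R k)%:C, II => N i N0 a b c ii E.
rewrite [LHS](_ : _ = (i * i) / N ^+ 2 * (1 * a + -1 * b)); last by field.
by rewrite E ii; field.
Qed.

Lemma comm3E k l T phi : k != 0 -> good T -> test_function phi ->
  comm (comm (comm (@lap R) (HH k)) (HH (- k))) (HH l) T phi =
  cH R l * (2 / (normk2 R k)%:C) * T (fun x => ek l x *
    (2 * II * cdot R (perpk k) l * Dq (perpk k) (Dq (perpk l) phi) x +
     - cdot R (perpk k) l ^+ 2 * Dq (perpk l) phi x)).
Proof.
move=> k0 gT t.
have gD := good_comm preserves_lap (preserves_HH k).
have gK := good_comm gD (preserves_HH (- k)).
set P := Dq (perpk k); set L := Dq (perpk l).
have tL : test_function (L phi) by exact: test_Dq.
have tPL : test_function (P (L phi)) by exact: test_Dq.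
have tPP : test_function (P (P phi)) by do 2 apply: test_Dq.
have te : test_function (fun x => ek l x * L phi x) by exact: test_ekM.
rewrite [LHS]commE (comm2E k0 (good_HH l gT) t) -/P (HHE l gT tPP) (HHE l (gK _ gT) t) -/L.
rewrite (comm2E k0 gT te) -/P.
have -> : L (P (P phi)) = P (P (L phi)).
  have tP : test_function (P phi) by exact: test_Dq.
  by rewrite /L (DqC (perpk l) (perpk k) tP) /P (DqC (perpk l) (perpk k) t).
have E : T (fun x => ek l x * (2 * II * cdot R (perpk k) l * P (L phi) x +
     - cdot R (perpk k) l ^+ 2 * L phi x)) =
  1 * T (P (P (fun x => ek l x * L phi x))) + (-1) * T (fun x => ek l x * P (P (L phi)) x).
  rewrite -gT; [|by do 2 apply: test_Dq|by apply: test_ekM; exact: test_Dq].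
  congr T; apply/funext => x; rewrite /P (Dq2_ek (perpk k) l tL) -/P.
  generalize (ek l x), (P (L phi) x), (P (P (L phi)) x), (L phi x), (cdot R (perpk k) l), II.
  by move=> a b c d e i; ring.
rewrite E.
generalize (T (P (P (fun x => ek l x * L phi x)))), (T (fun x => ek l x * P (P (L phi)) x)).
by generalize (cH R l), (2 / (normk2 R k)%:C) => a b c d; ring.
Qed.
End Commutators.

(** * The orthogonality conditions *)

Section ActsTo.
Variable R : realType.
Local Open Scope complex_scope.
Local Notation plane := (measurableTypeR R * measurableTypeR R)%type.
Local Notation tintegral f := (\int[mu2 R]_(x in @fund R) f x)%R.
Local Notation II := (0 +i* 1 : R[i]).
Implicit Types (phi psi : R * R -> R[i]) (u w v : R * R -> R) (du : bool -> R * R -> R).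

Definition dist u : distribution2 R := dist_of (fun x => (u x)%:C).

Lemma distE u phi : dist u phi =
  tintegral (fun x => u x * re_part phi x) +i* tintegral (fun x => u x * im_part phi x).
Proof.
rewrite /dist /dist_of /tint; congr (_ +i* _); apply: eq_Rintegral => x _;
  rewrite /re_part /im_part; case: (phi x) => a b /=; ring.
Qed.

Lemma test_continuous phi : test_function phi ->
  continuous (re_part phi) /\ continuous (im_part phi).
Proof. by move=> t; split; [exact: C1_continuous (C1_re t)|exact: C1_continuous (C1_im t)]. Qed.

Lemma dist_lin a b u w phi : continuous u -> continuous w -> test_function phi ->
  dist (fun x => a * u x + b * w x) phi = a%:C * dist u phi + b%:C * dist w phi.
Proof.
move=> cu cw t; have [cr ci] := test_continuous t.
have key (g : R * R -> R) : continuous g -> tintegral (fun x => (a * u x + b * w x) * g x) =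
    a * tintegral (fun x => u x * g x) + b * tintegral (fun x => w x * g x).
  move=> cg; rewrite -integral_lincomb; [|exact: continuousM2..].
  by apply: eq_Rintegral => x _; ring.
rewrite !distE !key//; apply/eqP; rewrite eq_complex/=.
by apply/andP; split; apply/eqP; ring.
Qed.

Lemma good_dist u : continuous u -> good (dist u).
Proof.
move=> cu a b phi psi t1 t2.
have [cr1 ci1] := test_continuous t1; have [cr2 ci2] := test_continuous t2.
have key (p q r s : R) (f1 f2 f3 f4 : R * R -> R) : continuous f1 -> continuous f2 ->
    continuous f3 -> continuous f4 ->
    tintegral (fun x => u x * (p * f1 x + q * f2 x + (r * f3 x + s * f4 x))) =
    p * tintegral (fun x => u x * f1 x) + q * tintegral (fun x => u x * f2 x) +
    (r * tintegral (fun x => u x * f3 x) + s * tintegral (fun x => u x * f4 x)).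
  move=> c1 c2 c3 c4.
  have cl (p' q' : R) (g h : R * R -> R) : continuous g -> continuous h ->
      continuous (fun x => p' * (u x * g x) + q' * (u x * h x)).
    by move=> cg ch; apply: continuousD2; apply: continuousM2;
      try exact: cst_continuous; exact: continuousM2.
  transitivity (tintegral (fun x => 1 * (p * (u x * f1 x) + q * (u x * f2 x)) +
      1 * (r * (u x * f3 x) + s * (u x * f4 x)))).
    by apply: eq_Rintegral => x _; ring.
  rewrite integral_lincomb; [|exact: cl..].
  by rewrite !integral_lincomb; try exact: continuousM2; ring.
rewrite !distE.
have -> : re_part (fun x => a * phi x + b * psi x) = (fun x =>
    complex.Re a * re_part phi x + - complex.Im a * im_part phi x +
    (complex.Re b * re_part psi x + - complex.Im b * im_part psi x)).
  apply/funext => x; rewrite /re_part /im_part.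
  by case: (phi x) (psi x) => ? ? [? ?]; case: (a) (b) => ? ? [? ?] /=; ring.
have -> : im_part (fun x => a * phi x + b * psi x) = (fun x =>
    complex.Re a * im_part phi x + complex.Im a * re_part phi x +
    (complex.Re b * im_part psi x + complex.Im b * re_part psi x)).
  apply/funext => x; rewrite /re_part /im_part.
  by case: (phi x) (psi x) => ? ? [? ?]; case: (a) (b) => ? ? [? ?] /=; ring.
rewrite !key//; case: (a) (b) => ? ? [? ?]; apply/eqP; rewrite eq_complex/=.
by apply/andP; split; apply/eqP; ring.
Qed.

Lemma dist_pd u du j phi : C1 u du -> test_function phi ->
  dist u (pd j phi) = - dist (du j) phi.
Proof.
move=> Cu t; have mf := @measurable_fund R.
have key f df : C1 f df -> tintegral (fun x => u x * df j x) = - tintegral (fun x => du j x * f x).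
  move=> Cf; apply/eqP; rewrite -addr_eq0 -RintegralD//.
  - rewrite -(C1_integral j (C1M Cu Cf)); apply/eqP.
    by apply: eq_Rintegral => x _; ring.
  - apply: continuous_integrable2; apply: continuousM2; first exact: C1_continuous Cu.
    exact: C1_dcontinuous Cf.
  - apply: continuous_integrable2; apply: continuousM2; last exact: C1_continuous Cf.
    exact: C1_dcontinuous Cu.
rewrite !distE (key _ _ (C1_re t)) (key _ _ (C1_im t)).
by apply/eqP; rewrite eq_complex/= !eqxx.
Qed.

Definition Rq (q : int * int) du x : R := q.1%:~R * du true x + q.2%:~R * du false x.

Lemma dist_Dq q u du phi : C1 u du -> test_function phi ->
  dist u (Dq q phi) = - dist (Rq q du) phi.
Proof.
move=> Cu t; have cu := C1_continuous Cu.
have cd j : continuous (du j) by exact: C1_dcontinuous Cu.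
rewrite [LHS](good_dist cu _ _ (test_pd true t) (test_pd false t)).
rewrite (dist_pd true Cu t) (dist_pd false Cu t).
rewrite (dist_lin q.1%:~R q.2%:~R (cd true) (cd false) t) /cdir !rmorph_int.
generalize (dist (du true) phi), (dist (du false) phi) => a b; ring.
Qed.

(** The common shape $e_l(au+bw)$ of the images of [zeta] under the first and the fourth kind of
    generators. *)
Definition gform (l : int * int) (a : R[i]) u (b : R[i]) w (x : R * R) : R[i] :=
  a * (ek l x * (u x)%:C) + b * (ek l x * (w x)%:C).

Lemma periodic2_comp T1 T2 (h : T1 -> T2) (f : R * R -> T1) :
  periodic2 f -> periodic2 (fun x => h (f x)).
Proof. by move=> pf x; rewrite !(pf x).1 !(pf x).2. Qed.

Lemma gform_parts l a u b w :
  re_part (gform l a u b w) = (fun x =>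
    (complex.Re a * cos (dotk l x) - complex.Im a * sin (dotk l x)) * u x +
    (complex.Re b * cos (dotk l x) - complex.Im b * sin (dotk l x)) * w x) /\
  im_part (gform l a u b w) = (fun x =>
    (complex.Re a * sin (dotk l x) + complex.Im a * cos (dotk l x)) * u x +
    (complex.Re b * sin (dotk l x) + complex.Im b * cos (dotk l x)) * w x).
Proof.
by split; apply/funext => x; rewrite /re_part /im_part /gform /ek;
  case: (a) (b) => ? ? [? ?] /=; ring.
Qed.

Lemma L2_continuous (f : R * R -> R) : periodic2 f -> continuous f -> L2 f.
Proof.
move=> pf cf; split => //; first exact: continuous_measurable2.
by apply: (@continuous_integrable2 R (fun x => f x ^+ 2)); exact: continuousM2.
Qed.

Lemma gform_L2C l a u b w : periodic2 u -> continuous u -> periodic2 w -> continuous w ->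
  L2C (gform l a u b w).
Proof.
move=> pu cu pw cw.
have pg : periodic2 (gform l a u b w).
  move=> x; rewrite /gform !(pu x).1 !(pu x).2 !(pw x).1 !(pw x).2.
  by rewrite !(@periodic2_ek R l x).1 !(@periodic2_ek R l x).2.
have cc (p q : R) : continuous (fun x : R * R => p * cos (dotk l x) - q * sin (dotk l x)).
  by apply: continuousB2; apply: continuousM2; try exact: cst_continuous;
    [exact: continuous_cosk|exact: continuous_sink].
have cs (p q : R) : continuous (fun x : R * R => p * sin (dotk l x) + q * cos (dotk l x)).
  by apply: continuousD2; apply: continuousM2; try exact: cst_continuous;
    [exact: continuous_sink|exact: continuous_cosk].
have [E1 E2] := gform_parts l a u b w.
split; apply: L2_continuous.
- exact: (periodic2_comp _ pg).
- by rewrite E1; apply: continuousD2; apply: continuousM2.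
- exact: (periodic2_comp _ pg).
- by rewrite E2; apply: continuousD2; apply: continuousM2.
Qed.

Lemma dist_of_gform l a u b w phi : continuous u -> continuous w -> test_function phi ->
  dist_of (gform l a u b w) phi =
  a * dist u (fun x => ek l x * phi x) + b * dist w (fun x => ek l x * phi x).
Proof.
move=> cu cw t; have te := test_ekM l t; have [cr ci] := test_continuous te.
have key (p q r s : R) (f g : R * R -> R) : continuous f -> continuous g ->
    tintegral (fun x => p * (u x * f x) + q * (u x * g x) + (r * (w x * f x) + s * (w x * g x))) =
    p * tintegral (fun x => u x * f x) + q * tintegral (fun x => u x * g x) +
    (r * tintegral (fun x => w x * f x) + s * tintegral (fun x => w x * g x)).
  move=> cf cg.
  have cl (h : R * R -> R) (p' q' : R) : continuous h ->
      continuous (fun x => p' * (h x * f x) + q' * (h x * g x)).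
    by move=> ch; apply: continuousD2; apply: continuousM2;
      try exact: cst_continuous; exact: continuousM2.
  transitivity (tintegral (fun x => 1 * (p * (u x * f x) + q * (u x * g x)) +
      1 * (r * (w x * f x) + s * (w x * g x)))).
    by apply: eq_Rintegral => x _; ring.
  rewrite integral_lincomb; [|exact: cl..].
  by rewrite !integral_lincomb; try exact: continuousM2; ring.
rewrite !distE /dist_of /tint; set e := fun x => ek l x * phi x.
have -> : tintegral (re_part (fun x => gform l a u b w x * phi x)) =
  tintegral (fun x => complex.Re a * (u x * re_part e x) + - complex.Im a * (u x * im_part e x) +
    (complex.Re b * (w x * re_part e x) + - complex.Im b * (w x * im_part e x))).
  apply: eq_Rintegral => x _; rewrite /e /re_part /im_part /gform.
  by case: (phi x) (ek l x) => ? ? [? ?]; case: (a) (b) => ? ? [? ?] /=; ring.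
have -> : tintegral (im_part (fun x => gform l a u b w x * phi x)) =
  tintegral (fun x => complex.Re a * (u x * im_part e x) + complex.Im a * (u x * re_part e x) +
    (complex.Re b * (w x * im_part e x) + complex.Im b * (w x * re_part e x))).
  apply: eq_Rintegral => x _; rewrite /e /re_part /im_part /gform.
  by case: (phi x) (ek l x) => ? ? [? ?]; case: (a) (b) => ? ? [? ?] /=; ring.
rewrite !key//; case: (a) (b) => ? ? [? ?]; apply/eqP; rewrite eq_complex/=.
by apply/andP; split; apply/eqP; ring.
Qed.

(** The pairing of [v] with $e_l u$, split into the cosine and sine integrals that occur in
    [bracket_eq0]. *)
Definition Jint v (l : int * int) u : R[i] :=
  tintegral (fun x => v x * (cos (dotk l x) * u x)) +i*
  tintegral (fun x => v x * (sin (dotk l x) * u x)).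

Lemma inner_gform v l a u b w : (mu2 R).-integrable (@fund R) (EFin \o v) ->
  continuous u -> continuous w ->
  inner v (gform l a u b w) = a * Jint v l u + b * Jint v l w.
Proof.
move=> iv cu cw; have mf := @measurable_fund R.
have cc (h : R * R -> R) : continuous h -> continuous (fun x => cos (dotk l x) * h x).
  by move=> ch; apply: continuousM2 => //; exact: continuous_cosk.
have cs (h : R * R -> R) : continuous h -> continuous (fun x => sin (dotk l x) * h x).
  by move=> ch; apply: continuousM2 => //; exact: continuous_sink.
have key (p q r s : R) (f1 f2 f3 f4 : R * R -> R) :
    continuous f1 -> continuous f2 -> continuous f3 -> continuous f4 ->
    tintegral (fun x => p * (v x * f1 x) + q * (v x * f2 x) + (r * (v x * f3 x) + s * (v x * f4 x))) =
    p * tintegral (fun x => v x * f1 x) + q * tintegral (fun x => v x * f2 x) +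
    (r * tintegral (fun x => v x * f3 x) + s * tintegral (fun x => v x * f4 x)).
  move=> c1 c2 c3 c4.
  have I1 (p' : R) (g : R * R -> R) : continuous g ->
      (mu2 R).-integrable (@fund R) (EFin \o (fun x => p' * (v x * g x))).
    move=> cg; rewrite (_ : (fun x => _) = (fun x => v x * (p' * g x))).
      by apply: integrable2M => //; apply: continuousM2 => //; exact: cst_continuous.
    by apply/funext => x; ring.
  have I2 (p' q' : R) (g h : R * R -> R) : continuous g -> continuous h ->
      (mu2 R).-integrable (@fund R) (EFin \o (fun x => p' * (v x * g x) + q' * (v x * h x))).
    move=> cg ch; rewrite (_ : (fun x => _) = (fun x => v x * (p' * g x + q' * h x))).
      apply: integrable2M => //; apply: continuousD2; apply: continuousM2 => //;
        exact: cst_continuous.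
    by apply/funext => x; ring.
  rewrite !RintegralD //; try exact: I1; try exact: I2.
  by rewrite !RintegralZl //; apply: integrable2M.
rewrite /inner /tint /Jint.
have -> : tintegral (re_part (fun x => (v x)%:C * gform l a u b w x)) =
  tintegral (fun x => complex.Re a * (v x * (cos (dotk l x) * u x)) +
      - complex.Im a * (v x * (sin (dotk l x) * u x)) +
    (complex.Re b * (v x * (cos (dotk l x) * w x)) +
      - complex.Im b * (v x * (sin (dotk l x) * w x)))).
  apply: eq_Rintegral => x _; rewrite /re_part /gform /ek.
  by case: (a) (b) => ? ? [? ?] /=; ring.
have -> : tintegral (im_part (fun x => (v x)%:C * gform l a u b w x)) =
  tintegral (fun x => complex.Re a * (v x * (sin (dotk l x) * u x)) +
      complex.Im a * (v x * (cos (dotk l x) * u x)) +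
    (complex.Re b * (v x * (sin (dotk l x) * w x)) +
      complex.Im b * (v x * (cos (dotk l x) * w x)))).
  apply: eq_Rintegral => x _; rewrite /im_part /gform /ek.
  by case: (a) (b) => ? ? [? ?] /=; ring.
rewrite !key; try exact: cc; try exact: cs.
case: (a) (b) => ? ? [? ?]; apply/eqP; rewrite eq_complex/=.
by apply/andP; split; apply/eqP; ring.
Qed.

Lemma Jint_lin v l (p q : R) u w : (mu2 R).-integrable (@fund R) (EFin \o v) ->
  continuous u -> continuous w ->
  Jint v l (fun x => p * u x + q * w x) = p%:C * Jint v l u + q%:C * Jint v l w.
Proof.
move=> iv cu cw; rewrite -inner_gform//.
have -> : Jint v l (fun x => p * u x + q * w x) =
    inner v (gform l 1 (fun x => p * u x + q * w x) 0 (fun=> 0)).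
  rewrite inner_gform//; first by rewrite mul0r addr0 mul1r.
    by apply: continuousD2; apply: continuousM2 => //; exact: cst_continuous.
  exact: cst_continuous.
congr inner; apply/funext => x; rewrite /gform.
by apply/eqP; rewrite eq_complex/=; apply/andP; split; apply/eqP; ring.
Qed.

Lemma C1_lin (p q : R) u du w dw : C1 u du -> C1 w dw ->
  C1 (fun x => p * u x + q * w x) (fun j x => p * du j x + q * dw j x).
Proof.
move=> [pu cu pdu duP] [pw cw pdw dwP].
have cl (f g : R * R -> R) : continuous f -> continuous g ->
    continuous (fun x => p * f x + q * g x).
  by move=> cf cg; apply: continuousD2; apply: continuousM2 => //; exact: cst_continuous.
split.
- by apply: (periodic2_op2 (fun a b : R => p * a + q * b)).
- exact: cl.
- move=> j; have [pj cj] := pdu j; have [pj' cj'] := pdw j; split; last exact: cl.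
  by apply: (periodic2_op2 (fun a b : R => p * a + q * b)).
- move=> j x; exact: is_deriveD (is_deriveZ p (duP j x)) (is_deriveZ q (dwP j x)).
Qed.

Section Generators.
Variables (zeta : R * R -> R) (dz : bool -> R * R -> R) (d2z : bool -> bool -> R * R -> R).
Hypothesis Cz : C1 zeta dz.
Hypothesis Cdz : forall j, C1 (dz j) (d2z j).

Definition Lz (l : int * int) : R * R -> R := Rq (perpk l) dz.

Definition dLz (l : int * int) (j : bool) (x : R * R) : R :=
  (perpk l).1%:~R * d2z true j x + (perpk l).2%:~R * d2z false j x.

Lemma C1_Lz l : C1 (Lz l) (dLz l).
Proof. exact: C1_lin. Qed.

Lemma acts_to_HH l : acts_to (HH l) zeta (gform l (cH R l) (Lz l) 0 (Lz l)).
Proof.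
have [pL cL _ _] := C1_Lz l; split; first exact: gform_L2C.
move=> phi t; rewrite dist_of_gform//.
have cz := C1_continuous Cz; have gz := good_dist cz; have te := test_ekM l t.
rewrite (HHE l gz t) -(Dperp_ek l t) (dist_Dq (perpk l) Cz te) -/(Lz l).
generalize (dist (Lz l) (fun x => ek l x * phi x)), (cH R l) => a b; ring.
Qed.

Definition PLz (k l : int * int) : R * R -> R := Rq (perpk k) (dLz l).

Lemma PLz_continuous k l : continuous (PLz k l) /\ periodic2 (PLz k l).
Proof.
have [_ _ pd _] := C1_Lz l; have [p1 c1] := pd true; have [p2 c2] := pd false; split.
  by apply: continuousD2; apply: continuousM2 => //; exact: cst_continuous.
by apply: (periodic2_op2 (fun a b : R => (perpk k).1%:~R * a + (perpk k).2%:~R * b)).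
Qed.

Lemma acts_to_comm3 k l : k != 0 ->
  acts_to (comm (comm (comm (@lap R) (HH k)) (HH (- k))) (HH l)) zeta
    (gform l (cH R l * (2 / (normk2 R k)%:C) * (2 * II * cdot R (perpk k) l)) (PLz k l)
      (cH R l * (2 / (normk2 R k)%:C) * - cdot R (perpk k) l ^+ 2) (Lz l)).
Proof.
move=> k0; have [pL cL _ _] := C1_Lz l; have [cP pP] := PLz_continuous k l.
split; first exact: gform_L2C.
move=> phi t; rewrite dist_of_gform//.
have cz := C1_continuous Cz; have gz := good_dist cz; have te := test_ekM l t.
have tP := test_Dq (perpk k) t; have tL := test_Dq (perpk l) t.
have teP := test_ekM l tP; have teL := test_ekM l tL.
have tePL := test_ekM l (test_Dq (perpk k) tL).
rewrite (comm3E l k0 gz t).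
have -> : (fun x => ek l x * (2 * II * cdot R (perpk k) l * Dq (perpk k) (Dq (perpk l) phi) x +
     - cdot R (perpk k) l ^+ 2 * Dq (perpk l) phi x)) = (fun x =>
  (2 * II * cdot R (perpk k) l) * (ek l x * Dq (perpk k) (Dq (perpk l) phi) x) +
     (- cdot R (perpk k) l ^+ 2) * (ek l x * Dq (perpk l) phi x)).
  apply/funext => x.
  generalize (ek l x), (Dq (perpk k) (Dq (perpk l) phi) x), (Dq (perpk l) phi x), (cdot R (perpk k) l), II.
  by move=> a b c d i; ring.
rewrite (gz _ _ _ _ tePL teL) (DqC (perpk k) (perpk l) t) -(Dperp_ek l tP) -(Dperp_ek l t).
rewrite (dist_Dq (perpk l) Cz teP) (dist_Dq (perpk l) Cz te) -/(Lz l).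
have E : dist (Lz l) (fun x => ek l x * Dq (perpk k) phi x) =
  - dist (PLz k l) (fun x => ek l x * phi x) - II * cdot R (perpk k) l * dist (Lz l) (fun x => ek l x * phi x).
  rewrite -(dist_Dq (perpk k) (C1_Lz l) te) (Dq_ek (perpk k) l t).
  have -> : (fun x => ek l x * (1 * Dq (perpk k) phi x + II * cdot R (perpk k) l * phi x)) =
    (fun x => 1 * (ek l x * Dq (perpk k) phi x) + (II * cdot R (perpk k) l) * (ek l x * phi x)).
    apply/funext => x; generalize (ek l x), (Dq (perpk k) phi x), (phi x), (II * cdot R (perpk k) l).
    by move=> a b c d; ring.
  rewrite [in RHS](good_dist cL _ _ teP te).
  generalize (dist (Lz l) (fun x => ek l x * Dq (perpk k) phi x)).
  by generalize (dist (Lz l) (fun x => ek l x * phi x)), (II * cdot R (perpk k) l) => a b c; ring.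
rewrite E; have := @sqrII R.
generalize (dist (PLz k l) (fun x => ek l x * phi x)), (dist (Lz l) (fun x => ek l x * phi x)).
generalize (cdot R (perpk k) l), (cH R l), (2 / (normk2 R k)%:C), II.
move=> d c e i a b ii.
(* Moving $P_k$ from the test function across $e_l$ produces $2\iota^2\kappa^2$, and transposing
   $P_l$ turns $-\kappa^2$ into $+\kappa^2$; together they give $-\kappa^2$ again. *)
rewrite [LHS](_ : _ = c * e * (2 * i * d * a + (2 * (i * i) + 1) * d ^+ 2 * b)); last by ring.
by rewrite ii; ring.
Qed.
End Generators.
End ActsTo.

(** * Wave vectors that avoid the degenerate directions *)

Lemma int_sqrD (m : int) : 0 <= m * m + m.
Proof.
case: (leP 0 m) => m0; first by rewrite addr_ge0 ?mulr_ge0.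
have -> : m * m + m = (- m) * (- m - 1) by ring.
by rewrite mulr_ge0; lia.
Qed.

(** This number is $(e_1+2l)\cdot l=l_1+2|l|^2$, and $l_1+l_1^2\ge0$ for integers, so it is at least
    $|l|^2$. The factor 2 matters: $(e_1+l)\cdot l$ vanishes at $l=-e_1$. *)
Lemma int_shift_neq0 (a b : int) : 0 < a * a + b * b ->
  (1 + 2 * a) * a + (0 + 2 * b) * b != 0.
Proof.
move=> ab; rewrite gt_eqF//.
have -> : (1 + 2 * a) * a + (0 + 2 * b) * b = (a * a + b * b) + b * b + (a * a + a) by ring.
by rewrite ltr_wpDr ?int_sqrD// ltr_wpDr// -expr2 sqr_ge0.
Qed.

Section Orthogonality.
Variable R : realType.
Local Notation plane := (measurableTypeR R * measurableTypeR R)%type.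
Local Notation tintegral f := (\int[mu2 R]_(x in @fund R) f x)%R.
Local Notation II := ((0 +i* 1)%C : R[i]%C).

Lemma g_PSA_generator (A : operator R) : psa_generator A -> g_PSA A.
Proof.
move=> gA; exists 1%N, (fun=> 1), (fun=> A); split => // T phi.
by rewrite big_ord1 [RHS]mul1r.
Qed.

Section Conditions.
Variables (zeta v : R * R -> R) (dz : bool -> R * R -> R) (d2z : bool -> bool -> R * R -> R).
Hypothesis Cz : C1 zeta dz.
Hypothesis Cdz : forall j, C1 (dz j) (d2z j).
Hypothesis iv : (mu2 R).-integrable (@fund R) (EFin \o v).
Hypothesis horth : forall A : operator R, g_PSA A ->
  forall g : R * R -> R[i]%C, acts_to A zeta g -> inner v g = 0.

Lemma realC_neq0 (r : R) : r != 0 -> (r%:C)%C != 0.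
Proof. by rewrite (inj_eq (@complexI R)). Qed.

Lemma normk2_neq0 (k : int * int) : k != 0 -> ((normk2 R k)%:C)%C != 0.
Proof. by move=> k0; rewrite realC_neq0// gt_eqF// (lt_le_trans ltr01 (normk2_ge1 R k0)). Qed.

Lemma II_neq0 : II != 0.
Proof. by rewrite eq_complex/= eqxx/= oner_eq0. Qed.

Lemma cH_neq0 k : k != 0 -> cH R k != 0.
Proof. by move=> k0; rewrite /cH mulf_neq0 ?invr_eq0 ?II_neq0 ?normk2_neq0. Qed.

Lemma Jint_Lz l : l != 0 -> Jint v l (Lz dz l) = 0.
Proof.
move=> l0; have [_ cL _ _] := C1_Lz Cdz l.
have := horth (g_PSA_generator (psa_gen1 R l0)) (acts_to_HH Cz Cdz l).
rewrite inner_gform// mul0r addr0 => /eqP; rewrite mulf_eq0 (negPf (cH_neq0 l0)) => /eqP.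
exact.
Qed.

Lemma Jint_PLz k l : k != 0 -> l != 0 -> cdot R (perpk k) l != 0 ->
  Jint v l (PLz d2z k l) = 0.
Proof.
move=> k0 l0 kl; have [_ cL _ _] := C1_Lz Cdz l; have [cP _] := PLz_continuous Cdz k l.
have := horth (g_PSA_generator (psa_gen4 R k0 l0)) (acts_to_comm3 Cz Cdz l k0).
rewrite inner_gform// Jint_Lz// mulr0 addr0.
have two : 2 != 0 :> R[i]%C by rewrite pnatr_eq0.
have two' : 2 / ((normk2 R k)%:C)%C != 0.
  by apply: mulf_neq0 => //; rewrite invr_eq0; exact: normk2_neq0.
have c0 : cH R l * (2 / ((normk2 R k)%:C)%C) * (2 * II * cdot R (perpk k) l) != 0.
  apply: mulf_neq0; apply: mulf_neq0 => //; first exact: cH_neq0.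
  by apply: mulf_neq0 => //; exact: II_neq0.
by move=> /eqP; rewrite mulf_eq0 (negPf c0) => /eqP.
Qed.

Lemma cdot_real q k : cdot R q k = ((q.1 * k.1 + q.2 * k.2)%:~R : R)%:C%C.
Proof. by rewrite /cdot /cdir/= rmorph_int intrD !intrM. Qed.

(** The pairing is linear in the direction [q] of the outer derivative and vanishes whenever $q\cdot
    l\ne0$. As $e_j$ may violate this condition, it is written as $(e_j+2l)-2l$, a combination of
    two admissible directions. *)
Lemma Jint_dLz l j : l != 0 -> Jint v l (dLz d2z l j) = 0.
Proof.
move=> l0; have [_ _ cd _] := C1_Lz Cdz l.
pose F (q : int * int) := Jint v l (Rq q (dLz d2z l)).
have FE q : F q = (q.1%:~R%:C)%C * Jint v l (dLz d2z l true) +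
    (q.2%:~R%:C)%C * Jint v l (dLz d2z l false).
  by rewrite /F /Rq Jint_lin//; [case: (cd true)|case: (cd false)].
have F0 (q : int * int) : q.1 * l.1 + q.2 * l.2 != 0 -> F q = 0.
  (* The wave vector whose rotation is [q]. *)
  move=> ql; have qE : perpk (- q.2, q.1) = q by rewrite /perpk/= opprK -surjective_pairing.
  have := @Jint_PLz (- q.2, q.1) l _ l0 _; rewrite /PLz qE; apply.
    apply: contra ql; rewrite xpair_eqE/= oppr_eq0 => /andP[/eqP-> /eqP->].
    by rewrite !mul0r addr0.
  by rewrite cdot_real realC_neq0// intr_eq0.
have ll : 0 < l.1 * l.1 + l.2 * l.2.
  rewrite lt_neqAle addr_ge0 -?expr2 ?sqr_ge0// andbT eq_sym paddr_eq0 ?sqr_ge0// !sqrf_eq0.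
  by apply: contra l0 => /andP[/eqP a /eqP b]; case: l a b {F FE F0 cd} => ? ? /= -> ->.
have Fl : F l = 0 by apply: F0; rewrite gt_eqF.
have Fsum (q : int * int) : F (q.1 + 2 * l.1, q.2 + 2 * l.2) = F q + 2 * F l.
  rewrite !FE /= !intrD !intrM !rmorphD !rmorphM /= !rmorph_int.
  by generalize (Jint v l (dLz d2z l true)), (Jint v l (dLz d2z l false)) => a b; ring.
have key (q : int * int) : (q.1 + 2 * l.1) * l.1 + (q.2 + 2 * l.2) * l.2 != 0 -> F q = 0.
  by move=> h; have := F0 (q.1 + 2 * l.1, q.2 + 2 * l.2) h; rewrite Fsum Fl mulr0 addr0.
case: j.
- have : F (1, 0) = 0 by apply: key; exact: int_shift_neq0.
  by rewrite FE/= mul1r mul0r addr0.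
- have : F (0, 1) = 0.
    by apply: key; rewrite addrC; apply: int_shift_neq0; rewrite addrC.
  by rewrite FE/= mul1r mul0r add0r.
Qed.
End Conditions.
End Orthogonality.

(** * Assembling the argument *)

Section Replace.
Variable R : realType.
Local Notation tintegral f := (\int[mu2 R]_(x in @fund R) f x)%R.

Lemma ae_eq_tintegralM (v V g : R * R -> R) :
  (mu2 R).-integrable (@fund R) (EFin \o v) -> continuous V -> continuous g ->
  ae_eq (mu2 R) (@fund R) v V ->
  tintegral (fun x => v x * g x) = tintegral (fun x => V x * g x).
Proof.
move=> iv cV cg vV; have mf := @measurable_fund R; rewrite /Rintegral; congr fine.
apply: ae_eq_integral => //.
- exact: measurable_int (integrable2M iv cg).
- exact: measurable_int (continuous_integrable2 (continuousM2 cV cg)).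
- by apply: filterS vV => x h /h /= ->.
Qed.
End Replace.

(** [Hs] and [acts_to] are insensitive to periodic changes of [zeta] on null sets, whereas
    [nowhere_one_dim] is pointwise and such a change can destroy one-dimensionality everywhere.
    Continuity of [zeta] selects the representative; for [v] the conclusion is almost everywhere. *)
Theorem proposition4p11 (R : realType) (s : R) (zeta v : R * R -> R)
  (hs : 4 < s)
  (hzeta : Hs s zeta) (czeta : continuous zeta)
  (hnow : nowhere_one_dim zeta)
  (hv : Hs s v)
  (horth : forall A : operator R, g_PSA A ->
     forall g : R * R -> R[i]%C, acts_to A zeta g -> inner v g = 0) :
  {ae mu2 R, forall x, v x = 0}.
Proof.
have [e eb] := nat_int2_bij.
have sz := Hs_summable hs hzeta eb; have sv := Hs_summable hs hv eb.
have [[pz mz z2] _ _] := hzeta; have [[pv mv v2] v0 _] := hv.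
have iz : (mu2 R).-integrable (@fund R) (EFin \o zeta) by apply: L2_integrable; split.
have iv : (mu2 R).-integrable (@fund R) (EFin \o v) by apply: L2_integrable; split.
have sz2 := summable_coefS sz; have sv2 := summable_coefS sv.
have sz1 := summable_coefS sz2; have sv1 := summable_coefS sv2.
have zae := trigser_coef iz eb sz1; have vae := trigser_coef iv eb sv1.
set cz := (fun n => coef zeta (e n)) in sz sz2 sz1 zae.
set cv := (fun n => coef v (e n)) in sv sv2 sv1 vae.
(* Equality must hold at every point, not just almost everywhere, for [hnow] to apply to the
   series. *)
have zE : zeta = trigser e cz.
  have cD : continuous (fun x => zeta x - trigser e cz x).
    by apply: continuousB2 => //; exact: continuous_trigser.
  have pD : periodic2 (fun x => zeta x - trigser e cz x).
    by apply: (periodic2_op2 (fun a b : R => a - b)) => //; exact: periodic_trigser.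
  apply/funext => x; apply/eqP; rewrite -subr_eq0; apply/eqP.
  apply: (continuous_ae0 cD); apply: (periodic_ae0 pD).
  by apply: filterS zae => y h /h ->; rewrite subrr.
pose V := trigser e cv.
pose dV j := trigser e (dcoef e (dir R j) cv).
pose d2V j i := trigser e (dcoef e (dir R i) (dcoef e (dir R j) cv)).
pose dz j := trigser e (dcoef e (dir R j) cz).
pose d2z j i := trigser e (dcoef e (dir R i) (dcoef e (dir R j) cz)).
have CV : C1 V dV by exact: C1_trigser.
have CdV j : C1 (dV j) (d2V j) by apply: C1_trigser; exact: summable_dcoef.
have Cz : C1 zeta dz by rewrite zE; exact: C1_trigser.
have Cdz j : C1 (dz j) (d2z j) by apply: C1_trigser; exact: summable_dcoef.
have gz : gradient zeta dz by rewrite zE; exact: gradient_trigser.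
have gdz j : gradient (dz j) (d2z j) by apply: gradient_trigser; exact: summable_dcoef.
have gV : gradient V dV by exact: gradient_trigser.
have d2VC : d2V true false = d2V false true by rewrite /d2V dcoefC.
have d2zC i j : d2z i j = d2z j i by rewrite /d2z dcoefC.
have cV := C1_continuous CV.
have bracket (g : R * R -> R) dg : C1 g dg ->
    (forall l, l != 0 -> Jint v l (fun x =>
      l.2%:~R * dg true x - l.1%:~R * dg false x) = 0) ->
    forall x, dV false x * dg true x = dV true x * dg false x.
  move=> Cg H x; apply/eqP; rewrite -subr_eq0; apply/eqP.
  apply: (bracket_eq0 CV CdV d2VC Cg) => l.
  have [l1 l2] : dotk l (dir R true) = l.1%:~R /\ dotk l (dir R false) = l.2%:~R.
    by rewrite /dotk/= !mulr1 !mulr0 addr0 add0r.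
  rewrite l1 l2; have cdg j : continuous (dg j) by exact: C1_dcontinuous Cg.
  have cL : continuous (fun x => l.2%:~R * dg true x - l.1%:~R * dg false x).
    by apply: continuousB2; apply: continuousM2 => //; exact: cst_continuous.
  (* No generator has frequency 0, but there the integrand vanishes identically. *)
  have [->|l0] := eqVneq l 0.
    by split; rewrite (@eq_Rintegral _ _ _ _ _ (fun=> 0)) ?Rintegral_cst ?mul0r//;
      try (exact: measurable_fund); move=> y _; rewrite !mul0r subrr !mulr0.
  have := H l l0; rewrite /Jint => /eqP; rewrite eq_complex/= => /andP[/eqP J1 /eqP J2].
  rewrite -(ae_eq_tintegralM iv cV _ vae); last first.
    by apply: continuousM2 => //; exact: continuous_cosk.
  rewrite -(ae_eq_tintegralM iv cV _ vae); last first.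
    by apply: continuousM2 => //; exact: continuous_sink.
  by [].
have B0 : forall x, dV false x * dz true x = dV true x * dz false x.
  apply: (bracket zeta dz Cz) => l l0; rewrite -[RHS](Jint_Lz Cz Cdz iv horth l0).
  by congr Jint; apply/funext => x; rewrite /Lz /Rq/= mulrNz mulNr.
have B1 i : forall x, dV false x * d2z i true x = dV true x * d2z i false x.
  apply: (bracket (dz i) (d2z i) (Cdz i)) => l l0.
  rewrite -[RHS](Jint_dLz Cz Cdz iv horth i l0).
  by congr Jint; apply/funext => x; rewrite /dLz/= mulrNz mulNr !(d2zC _ i).
have dV0 j x : dV j x = 0.
  apply/eqP/negPn/negP => dVx.
  pose U : set (R * R) := [set y | dV j y != 0].
  have oU : open U.
    apply: (@open_comp _ _ (dV j) [set r : R | r != 0]) => [y _|]; last exact: open_neq.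
    exact: (C1_dcontinuous CV).
  (* Either the gradient of [zeta] is nonzero somewhere in [U], and its direction is locally
     constant there, or [zeta] is locally constant on [U] and one-dimensional along any vector, such
     as $(1,0)$. *)
  have [[y [Uy zy]]|nz] := pselect (exists y, U y /\ (dz true y, dz false y) != 0).
    have cdz i : continuous (dz i) by exact: C1_dcontinuous Cz.
    have [|W [oW W0 oneW]] := one_dim_parallel gz gdz cdz oU Uy zy.
      move=> w i Uw; rewrite !(d2zC _ i); have := B0 w; have := B1 i w.
      (* The gradient of [zeta] and its derivative are both parallel to the gradient of [V];
         cancelling the nonzero component [j] of the latter shows that they are parallel to each
         other. *)
      move: Uw; rewrite /U /=; case: (j) => Vw e1 e0; apply: (mulfI Vw).
        by rewrite [LHS]mulrCA -e0 mulrCA mulrA e1 mulrA.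
      by rewrite mulrA e1 mulrAC mulrC -e0; ring.
    exact: hnow oW W0 oneW.
  have : nbhs x U by exact: open_nbhs_nbhs.
  rewrite -nbhs_ballE => -[r /= r0 rU].
  have W0 : (ball x r : set (R * R)) !=set0 by exists x; exact: ballxx.
  apply: (hnow _ (ball_open x r) W0).
  apply: (@one_dim_ball _ zeta dz x r (1, 0) gz r0).
    by rewrite xpair_eqE/= oner_eq0.
  move=> y /rU Uy; have /eqP : (dz true y, dz false y) == 0.
    by apply/negPn/negP => h; apply: nz; exists y.
  by move=> [-> ->]; rewrite !mulr0.
have Vcst x : V x = V 0.
  have := @const_segment _ (fun t : R => V (0 + t *: x))
    (fun t => x.1 * dV true (0 + t *: x) + x.2 * dV false (0 + t *: x)).
  rewrite scale1r scale0r !add0r; apply => t _; first exact: gradient_line.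
  by rewrite !dV0 !mulr0 addr0.
(* The constant is identified by the mean, which is zero for [v] and hence for [V]. *)
have V00 : V 0 = 0.
  have c1 : continuous (fun _ : R * R => 1 : R) by exact: cst_continuous.
  have := ae_eq_tintegralM iv cV c1 vae.
  under eq_Rintegral do rewrite mulr1.
  rewrite v0; under eq_Rintegral do rewrite mulr1 Vcst.
  rewrite Rintegral_cst; last exact: measurable_fund.
  rewrite mu2_fund => /esym/eqP; rewrite mulf_eq0 => /orP[/eqP //|].
  by rewrite [fine _]/(_ ^+ 2) sqrf_eq0 gt_eqF// pi2_gt0.
apply: (periodic_ae0 pv); apply: filterS vae => x h /h ->.
by rewrite -/V Vcst V00.
Qed.
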